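(* Let $G$ be a finite simple planar graph that contains no cycle of length $4$ and no cycle of length $5$ (as subgraphs). Then $V(G)$ can be partitioned into two (possibly empty) sets $V_1$ and $V_2$ such that the induced subgraph $G[V_1]$ is a forest with maximum degree at most $3$ and the induced subgraph $G[V_2]$ is a forest with maximum degree at most $4$.
   Context: All graphs are finite and simple. ''Without $4$-cycles and $5$-cycles'' means that the graph has no subgraph (not necessarily induced) isomorphic to a cycle of length $4$ or to a cycle of length $5$. Such a partition $(V_1,V_2)$ is called an $(\mathcal{F}_3,\mathcal{F}_4)$-partition, where $\mathcal{F}_d$ denotes the class of forests with maximum degree at most $d$. *)

(* Defs.v *)
From mathcomp Require Import all_boot all_order all_algebra.
From mathcomp Require Import boolp classical_sets reals topology normedtype.

Set Implicit Arguments.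
Unset Strict Implicit.
Unset Printing Implicit Defensive.

Import numFieldNormedType.Exports.

(* A finite simple graph is a symmetric irreflexive relation on a finType. *)

(* For k >= 3, [e] has a subgraph isomorphic to the cycle of length [k].
   (For k = 2 the condition would hold as soon as there is an edge.) *)
Definition has_cycle (T : finType) (e : rel T) (k : nat) : Prop :=
  exists2 c : seq T, size c = k & ucycle e c.

Definition forest (T : finType) (e : rel T) : Prop :=
  forall k : nat, 3 <= k -> ~ has_cycle e k.

Definition degree (T : finType) (e : rel T) (x : T) : nat := #|e x|.

Definition max_degree (T : finType) (e : rel T) : nat := \max_(x : T) degree e x.

Definition induced (T : finType) (e : rel T) (A : {set T}) :
    rel {x : T | x \in A} :=
  fun x y => e (val x) (val y).

Arguments induced {T} e A x y.

Definition forest_class (d : nat) (T : finType) (e : rel T) : Prop :=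
  forest e /\ max_degree e <= d.

Section Planarity.
Local Open Scope ring_scope.
Local Open Scope classical_set_scope.

Definition simple_arc (R : realType) (p q : R * R) (A : set (R * R)) : Prop :=
  exists f : R -> R * R,
    [/\ {within `[0, 1], continuous f},
        {in `[0, 1] &, injective f},
        f 0 = p, f 1 = q & f @` `[0, 1] = A].

(* A drawing without crossings in the plane: vertices are distinct points, the
   edge {x, y} is a simple arc [arc {x, y}] joining the points of x and y and
   containing no other vertex, and two distinct edges meet only in the points
   of their common endvertices. *)
Definition plane_drawing (R : realType) (T : finType) (e : rel T)
    (pt : T -> R * R) (arc : {set T} -> set (R * R)) : Prop :=
  [/\ injective pt,
      forall x y, e x y -> simple_arc (pt x) (pt y) (arc [set x; y]%SET),
      forall x y z, e x y -> arc [set x; y]%SET (pt z) -> z \in [set x; y]%SET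
    & forall x y u v, e x y -> e u v -> [set x; y]%SET != [set u; v]%SET ->
        arc [set x; y]%SET `&` arc [set u; v]%SET
          `<=` [set pt z | z in [set` [set x; y]%SET :&: [set u; v]%SET]] ].

Definition planar (R : realType) (T : finType) (e : rel T) : Prop :=
  exists (pt : T -> R * R) (arc : {set T} -> set (R * R)),
    plane_drawing e pt arc.

End Planarity.

(* Main.v *)
(* The two classes have to be forests of maximum degree 3 and 4.  If a vertex
   receives a colour that occurs on at most one of its neighbours then no cycle
   appears, so that extending a colouring is only a matter of degrees.  In a
   minimal uncolourable set this excludes many configurations around a vertex,
   and by discharging there is a nonempty set H with 12 |H| + t <= 4 d, where d
   is the sum of the degrees of G[H] and t the part of d due to the edges lying
   in triangles.

   On the other hand, without 4- and 5-cycles a nonempty even set of edges is a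
   triangle or has at least 6 elements, so that Euler's formula for G[H] gives
   4 d < 12 |H| + t.  All that is needed of it is that a family of F nonempty
   even sets covers each of the m edges at most twice and spans all even sets,
   whence m <= |H| - 1 + F.  These sets are the face boundaries, and no Jordan
   curve theorem is required: the drawing is rounded to a labelling of a fine
   grid in which the vertices become connected classes and the edges become
   adjacencies, and there the squares can be two-coloured explicitly with any
   given even set as boundary. *)

Require Import Defs.
From mathcomp Require Import all_boot reals zify boolp.
From mathcomp Require all_order all_algebra lra classical_sets topology normedtype.

Set Implicit Arguments.
Unset Strict Implicit.
Unset Printing Implicit Defensive.

(** * Colourings with bounded degrees *)

(** Seeing a colour on one neighbour only is not yet enough: that neighbour may be saturated, having
    already 3 or 4 neighbours of its own colour. Small degree helps, because a saturated vertex with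
    an uncoloured neighbour then has almost no neighbour of the other colour and can be switched.
    Hence the distinguished class of good vertices of large degree, which alone send charge.

    At a good vertex [x] some parts of the neighbourhood are erased together with [x] and restored
    last, each of them costing [x] at most one neighbour of its own colour. Without 4-cycles a
    neighbourhood is a disjoint union of single vertices and edges, and such an edge, forming a
    triangle with [x], contains at most one vertex in the colour of [x]. So it is the number of
    these pieces, not the degree, that limits the saturation of [x], and the final charge of [x] is
    computed piece by piece as well.

    The initial charge of [x] is 4 deg(x) - t(x) - 12, where deg(x) is taken in G[H] and t(x) counts
    the edges at [x] that lie in triangles. *)

Lemma cards_disjoint (T : finType) (A B : {set T}) : A :&: B = set0 -> #|A| + #|B| = #|A :|: B|.
Proof. by move=> AB0; rewrite cardsU AB0 cards0 subn0. Qed.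

Section Colouring.
Variables (T : finType) (e : rel T).
Hypotheses (e_sym : symmetric e) (e_irr : irreflexive e).

Definition nbr (x : T) : {set T} := [set y | e x y].
Definition deg (x : T) : nat := #|nbr x|.
(** Colour [false] belongs to the forest of maximum degree 3, colour [true] to that of maximum
    degree 4. *)
Definition cap (c : bool) : nat := 3 + c.

Implicit Types (f g : T -> option bool) (c : bool) (x y z : T).

Definition upd f x o : T -> option bool := fun z => if z == x then o else f z.
Definition cdeg f c x : nat := #|[set y in nbr x | f y == Some c]|.
Definition valid f : Prop :=
  (forall x c, f x = Some c -> cdeg f c x <= cap c) /\
  (forall s c, ucycle e s -> 3 <= size s ->
     all (fun x => f x == Some c) s -> False).

Lemma in_nbr x y : (y \in nbr x) = e x y. Proof. by rewrite inE. Qed.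

Lemma valid_sub f g : valid f -> (forall x, g x = None \/ g x = f x) -> valid g.
Proof.
move=> [fd fc] sub.
have sub' x c : g x = Some c -> f x = Some c by case: (sub x) => ->.
split=> [x c gx | s c us s3 /allP sg].
  apply: leq_trans (fd x c (sub' _ _ gx)); apply/subset_leq_card/subsetP => y.
  by rewrite !inE => /andP[-> /eqP /sub' ->]; rewrite eqxx.
by apply: (fc s c us s3); apply/allP => x /sg /eqP /sub' ->.
Qed.

Lemma upd_same f x o : upd f x o x = o. Proof. by rewrite /upd eqxx. Qed.
Lemma upd_other f x o z : z != x -> upd f x o z = f z.
Proof. by rewrite /upd => /negbTE->. Qed.

Lemma valid_uncolour f x : valid f -> valid (upd f x None).
Proof.
by move=> vf; apply: (valid_sub vf) => z; rewrite /upd; case: ifP; [left | right].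
Qed.

(** A monochromatic cycle through [x] would need two neighbours of [x] coloured [c], and only [p]
    can be one. Of the old vertices only [p] gains a neighbour of its own colour, whence the strict
    bound. *)
Lemma valid_add f x c p : valid f -> f x = None ->
  (forall y, e x y -> f y = Some c -> y = p /\ cdeg f c p < cap c) ->
  valid (upd f x (Some c)).
Proof.
move=> [fd fc] fx xp; split=> [y c' | s c' us s3 /allP sg].
  rewrite {1}/upd; have [-> [<-] | yx fy] := eqVneq y x.
    rewrite /cdeg; apply: (@leq_trans 1); last by case: c {xp}.
    apply: (@leq_trans #|[set p]|); last by rewrite cards1.
    apply/subset_leq_card/subsetP => z; rewrite !inE => /andP[exz].
    rewrite upd_other; last by apply: contraTneq exz => ->; rewrite e_irr.
    by move/eqP => /(xp _ exz)[-> _].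
  case exy: (e x y); last first.
    apply: leq_trans (fd y c' fy); apply/subset_leq_card/subsetP => z.
    rewrite !inE => /andP[eyz]; rewrite eyz upd_other //.
    by apply: contraTneq eyz => ->; rewrite e_sym exy.
  have [cc | cc] := eqVneq c c'; last first.
    apply: leq_trans (fd y c' fy); apply/subset_leq_card/subsetP => z.
    rewrite !inE => /andP[->]; rewrite /upd; case: (z =P x) => // _ /eqP[cc'].
    by rewrite cc' eqxx in cc.
  rewrite -cc in fy *; have [yp lp] := xp _ exy fy; rewrite -{}yp in lp.
  apply: leq_trans lp; rewrite -addn1 -(cards1 x).
  apply: leq_trans (leq_card_setU _ _); apply/subset_leq_card/subsetP => z.
  by rewrite !inE /upd; case: (z =P x) => [-> | _ /andP[-> ->]]; rewrite ?orbT.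
have [xs | xs] := boolP (x \in s); last first.
  apply: (fc s c' us s3); apply/allP => z zs; have:= sg z zs.
  by rewrite upd_other //; apply: contraNneq xs => <-.
have cc : c = c' by have:= sg x xs; rewrite upd_same => /eqP[].
rewrite -cc in sg.
have [i t st] := rot_to xs.
have us' : ucycle e (x :: t).
  by rewrite -st /ucycle rot_cycle rot_uniq.
have s3' : 3 <= size (x :: t) by rewrite -st size_rot.
have sg' z : z \in t -> upd f x (Some c) z == Some c.
  by move=> zt; apply: sg; rewrite -(mem_rot i) st inE zt orbT.
case: t {st} us' s3' sg' => [|y [|z t]] // /andP[cy /= /and3P[xt yt ut]] _ sg'.
move: cy; rewrite /cycle rcons_path /= => /andP[/andP[exy _] lx].
set w := last z t in lx.
have wt : w \in z :: t by apply: mem_last.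
have wx : w != x by apply: contraNneq xt => <-; rewrite inE wt orbT.
have yx : y != x by apply: contraNneq xt => <-; rewrite inE eqxx.
have wy : w != y by apply: contraNneq yt => <-.
have := sg' w; rewrite inE wt orbT upd_other // => /(_ isT)/eqP fw.
have := sg' y; rewrite inE eqxx upd_other // => /(_ isT)/eqP fy.
rewrite e_sym in lx.
have [wp _] := xp _ lx fw; have [yp _] := xp _ exy fy.
by rewrite wp yp eqxx in wy.
Qed.

Lemma valid_add0 f x c : valid f -> f x = None ->
  (forall y, e x y -> f y <> Some c) -> valid (upd f x (Some c)).
Proof. by move=> vf fx h; apply: (@valid_add _ _ _ x) => // y /h. Qed.

Lemma triangle_valid f x y z c : valid f -> e x y -> e y z -> e z x ->
  f x = Some c -> f y = Some c -> f z = Some c -> False.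
Proof.
move=> [_ fc] exy eyz ezx fx fy fz; apply: (fc [:: x; y; z] c) => //; last first.
  by rewrite /= fx fy fz eqxx.
have ne a b : e a b -> a != b by move=> ab; apply: contraTneq ab => ->; rewrite e_irr.
by rewrite /ucycle /cycle /= exy eyz ezx !inE (negbTE (ne _ _ exy)) eq_sym
           (negbTE (ne _ _ ezx)) (ne _ _ eyz).
Qed.

(* By [free_vertex], a vertex that is not good can always be recoloured, or some
   of its neighbours can, so as to make room for a new neighbour. *)
Definition good x : bool :=
  (6 <= deg x) || (deg x == 5) && [exists z, e x z && (6 <= deg z)].

(* The only vertices recoloured besides [p] are moved from colour [true] to
   colour [false], where they are isolated once [p] has left. *)
Lemma free_vertex f v p c : valid f -> f v = None -> e v p -> ~~ good p ->
  f p = Some c -> exists g, [/\ valid g,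
    forall t, (g t == None) = (f t == None),
    g p = Some c -> cdeg g c p < cap c &
    forall t, g t = f t \/ t = p \/
      [/\ c = false, f t = Some true, g t = Some false, e p t /\ ~~ e v t &
          forall r, e t r -> f r = Some false -> r = p]].
Proof.
move=> vf fv evp gp fp.
have [lt | ge] := ltnP (cdeg f c p) (cap c); first by exists f; split=> // t; left.
have epv : e p v by rewrite e_sym.
have vp : v != p by apply: contraTneq evp => ->; rewrite e_irr.
pose A b := [set y in nbr p | f y == Some b].
(* The uncoloured [v] counts besides the two colours. So a saturated [p] of degree at most 5 has no
   neighbour of the other colour, or exactly one in case [c = false]. *)
have dAB : #|A c| + #|A (~~ c)| + 1 <= deg p.
  rewrite -(cards1 v) /deg !cards_disjoint.
  - apply/subset_leq_card/subsetP => y; rewrite !inE.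
    by move=> /orP[/orP[]/andP[]// | /eqP->].
  - apply/setP => y; rewrite !inE; apply/negbTE/negP => /andP[h /eqP yv].
    by move: h; rewrite yv fv /= !andbF.
  - apply/setP => y; rewrite !inE; apply/negbTE/negP.
    by move=> /andP[/andP[_ /eqP->] /andP[_ /eqP[]]]; case: c {ge fp}.
have d5 : deg p <= 5 by rewrite leqNgt; apply: contra gp => h; rewrite /good h.
have ge' : cap c <= #|A c| by [].
have flip g : (forall y, e p y -> g y <> Some (~~ c)) -> valid g ->
    valid (upd (upd g p None) p (Some (~~ c))).
  move=> h vg; apply: valid_add0; [exact: valid_uncolour | by rewrite upd_same |].
  move=> y epy; rewrite upd_other; first exact: h.
  by apply: contraTneq epy => ->; rewrite e_irr.
have [A0 | /set0Pn[z zA]] := eqVneq (A (~~ c)) set0.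
  exists (upd (upd f p None) p (Some (~~ c))); split.
  - apply: flip => // y epy fy; have: y \in A (~~ c) by rewrite !inE epy fy eqxx.
    by rewrite A0 inE.
  - by move=> t; rewrite /upd; case: (t =P p) => // ->; rewrite fp.
  - by rewrite upd_same => -[]; case: (c).
  - by move=> t; rewrite /upd; case: eqP; [right; left | left].
have A1 : 1 <= #|A (~~ c)| by apply/card_gt0P; exists z.
have cF : c = false by apply/negbTE/negP => cT; move: ge' dAB d5 A1; rewrite cT /cap; lia.
subst c; rewrite /cap addn0 in ge' ge; rewrite /= in dAB A1 zA flip.
have dp5 : deg p = 5 by lia.
have A1' : #|A true| = 1 by lia.
have Az y : e p y -> f y = Some true -> y = z.
  move=> epy fy; have yA : y \in A true by rewrite !inE epy fy eqxx.
  by move/eqP/cards1P: A1' => [w Aw]; move: yA zA; rewrite Aw !inE => /eqP-> /eqP->.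
move: zA; rewrite !inE => /andP[epz /eqP fz].
have zp : z != p by apply: contraTneq epz => ->; rewrite e_irr.
have [ltz | gez] := ltnP (cdeg f true z) 4.
  exists (upd (upd f p None) p (Some true)); split.
  - apply: (@valid_add _ _ _ z); [exact: valid_uncolour | by rewrite upd_same |].
    move=> y epy; rewrite upd_other; last first.
      by apply: contraTneq epy => ->; rewrite e_irr.
    move=> /(Az _ epy) ->; split=> //; apply: leq_ltn_trans ltz.
    apply/subset_leq_card/subsetP => t; rewrite !inE /upd.
    by case: (t =P p) => // _; rewrite andbF.
  - by move=> t; rewrite /upd; case: (t =P p) => // ->; rewrite fp.
  - by rewrite upd_same.
  - by move=> t; rewrite /upd; case: eqP; [right; left | left].
(* [p] has degree 5 without being good, so [z] has degree at most 5. Four neighbours coloured [true]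
   and [p] are then all its neighbours, and [z] can be switched to [false] together with [p] being
   switched to [true]. *)
have dz5 : deg z <= 5.
  rewrite leqNgt; apply: contra gp => h; rewrite /good dp5 /=.
  by apply/existsP; exists z; rewrite epz.
have zB y : e z y -> y = p \/ f y = Some true.
  move=> ezy; have [->|yp] := eqVneq y p; [by left | right].
  apply/eqP; apply: contraLR dz5 => fy; rewrite -ltnNge.
  apply: (@leq_trans (#|[set y in nbr z | f y == Some true]| + (#|[set p]| + #|[set y]|))).
    by rewrite !cards1 addn2 !ltnS.
  rewrite /deg !cards_disjoint.
  - apply/subset_leq_card/subsetP => t; rewrite !inE.
    by move=> /orP[/andP[]// | /orP[]/eqP->] //; rewrite e_sym.
  - apply/setP => t; rewrite !inE; apply/negbTE/negP.
    by move=> /andP[/andP[_ ft] /orP[]/eqP tt]; move: ft; rewrite tt ?fp // (negbTE fy).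
  - apply/setP => t; rewrite !inE; apply/negbTE/negP => /andP[/eqP-> /eqP py].
    by rewrite py eqxx in yp.
pose f1 := upd (upd f z None) p None.
have vf1 : valid f1 by do 2!apply: valid_uncolour.
pose f2 := upd f1 p (Some true).
have vf2 : valid f2.
  apply: valid_add0 => // [|y epy]; first by rewrite /f1 upd_same.
  rewrite /f1 /upd; do 2!case: eqP => //; move=> yz _ /(Az _ epy) yz'.
  by case: yz.
exists (upd f2 z (Some false)); split.
- apply: valid_add0 => // [|y ezy].
    by rewrite /f2 upd_other // /f1 upd_other // upd_same.
  rewrite /f2 /f1 /upd; case: eqP => // yp; case: eqP => // yz.
  by case: (zB _ ezy) => // ->.
- move=> t; rewrite /f2 /f1 /upd; case: (t =P z) => [->|_]; first by rewrite fz.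
  by case: (t =P p) => // ->; rewrite fp.
- by rewrite upd_other 1?eq_sym // /f2 upd_same.
- move=> t; rewrite /f2 /f1 /upd.
  case: (t =P z) => [->|_]; last by case: (t =P p); [right; left | left].
  right; right; split=> //.
    split=> //; apply/negP; rewrite e_sym => ezv; case: (zB _ ezv) => [vp' | fv'].
      by rewrite vp' eqxx in vp.
    by rewrite fv' in fv.
  by move=> r ezr fr; case: (zB _ ezr) => // fr'; rewrite fr' in fr.
Qed.

Hypothesis noC4 : forall a b c d : T, e a b -> e b c -> e c d -> e d a ->
  a != c -> b != d -> False.
Implicit Types (U V P K : {set T}).

Lemma edge_neq a b : e a b -> a != b.
Proof. by move=> ab; apply: contraTneq ab => ->; rewrite e_irr. Qed.

(** [free_vertex] makes [p] unsaturated or takes the colour [c] from it, after which [y] is a leaf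
    or isolated in that colour. The last clause lists all vertices that may have been recoloured. *)
Lemma place f y p c : valid f -> f y = None -> e y p ->
  (forall t, e y t -> f t = Some c -> t = p /\ ~~ good p) ->
  exists g, [/\ valid g, g y = Some c,
    forall t, t != y -> (g t == None) = (f t == None) &
    forall t, g t = f t \/ t = y \/
      (t = p /\ f t = Some c /\ g t = Some (~~ c)) \/
      [/\ c = false, f t = Some true, g t = Some false, e p t /\ ~~ e y t &
          forall r, e t r -> f r = Some false -> r = p]].
Proof.
move=> vf fy eyp h.
have [fp | fp] := eqVneq (f p) (Some c); last first.
  have h0 t : e y t -> f t <> Some c.
    by move=> eyt ft; case: (h _ eyt ft) => tp _; rewrite -tp ft eqxx in fp.
  exists (upd f y (Some c)); split.
  - exact: valid_add0.
  - exact: upd_same.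
  - by move=> t ty; rewrite upd_other.
  - by move=> t; rewrite /upd; case: eqP; [right; left | left].
have [_ gp] := h _ eyp fp.
have [g [vg gN gsat gch]] := free_vertex vf fy eyp gp fp.
have gy : g y = None by apply/eqP; rewrite gN fy.
have yp := edge_neq eyp.
exists (upd g y (Some c)); split.
- apply: (@valid_add _ _ _ p) => // t eyt gt.
  suff tp : t = p by split=> //; apply: gsat; rewrite -tp.
  case: (gch t) => [gf | [// | [_ _ _ [_ /negP[]] //]]].
  by apply: (h t eyt _).1; rewrite -gf.
- exact: upd_same.
- by move=> t ty; rewrite upd_other.
- move=> t; have [->|ty] := eqVneq t y; first by right; left.
  rewrite upd_other //; case: (gch t) => [|[tp|[c0 ft gt [h1 h2] h3]]]; first by left.
    have [gpp | gpp] := eqVneq (g p) (Some c); first by left; rewrite tp fp.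
    right; right; left; rewrite tp; split=> //; split=> //.
    have : g p != None by rewrite gN fp.
    by move: gpp; case: (g p) => [[]|]; case: (c).
  by right; right; right.
Qed.

(** * Units: parts of a neighbourhood that can be coloured last *)

(** Recolouring for the sake of [U] starts at vertices of [P] and reaches at most their neighbours.
    The vertices of [U] receive new colours and are left out of the count. *)
Definition stays U P f g : Prop := forall t, t \notin U -> t \notin P ->
  (forall p, p \in P -> ~~ e t p) -> g t = f t /\
  forall c, f t = Some c ->
    #|[set w in nbr t :\: U | g w == Some c]| <=
    #|[set w in nbr t :\: U | f w == Some c]|.

Lemma stays_trans U P f g h : stays U P f g -> stays U P g h -> stays U P f h.
Proof.
move=> fg gh t tU tP tp; have [gf le1] := fg t tU tP tp.
have [hg le2] := gh t tU tP tp; rewrite hg gf; split=> // c ft.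
by apply: leq_trans (le2 c _) (le1 c ft); rewrite gf.
Qed.

Lemma stays_in U P f g : (forall t, t \notin U -> g t = f t) -> stays U P f g.
Proof.
move=> gf t tU _ _; split=> [|c _]; first exact: gf.
apply/subset_leq_card/subsetP => w; rewrite !inE => /andP[/andP[wU ->]].
by rewrite gf // wU.
Qed.

(** A vertex recoloured besides [y] and [p] passes to [false], and [p] is the only possible [false]
    vertex next to it; so no degree grows away from [P]. For [c = true] no such vertex is recoloured
    and [p] can only pass from [true] to [false]. *)
Lemma place_in U P f y p c : y \in U -> p \in P -> valid f -> f y = None ->
  e y p -> (forall t, e y t -> f t = Some c -> t = p /\ ~~ good p) ->
  exists g, [/\ valid g, g y = Some c, stays U P f g,
    forall t, t != y -> (g t == None) = (f t == None) &
    (forall t, t != p -> t != y -> ~~ e p t || e y t -> g t = f t) /\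
    (c = true -> forall t, t != y -> f t = Some false -> g t = Some false)].
Proof.
move=> yU pP vf fy eyp h; have [g [vg gy gN gch]] := place vf fy eyp h.
exists g; split=> //.
- move=> t tU tP tp.
  have gt : g t = f t.
    case: (gch t) => [//|[ty|[[tp' _]|[_ _ _ [ept _] _]]]].
    - by rewrite ty yU in tU.
    - by rewrite tp' pP in tP.
    - by have := tp p pP; rewrite e_sym ept.
  split=> // c' ft; apply/subset_leq_card/subsetP => w; rewrite !inE.
  move=> /andP[/andP[wU etw] gw]; rewrite wU etw /= -(eqP gw) eq_sym.
  case: (gch w) => [->//|[wy|[[wp _]|[_ _ gw' _ hr]]]].
  - by rewrite wy yU in wU.
  - by have := tp p pP; rewrite -wp etw.
  - have tp' : t = p.
      apply: hr; first by rewrite e_sym.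
      by rewrite ft -(eqP gw) gw'.
    by rewrite tp' pP in tP.
- split=> [t tp ty ept|cT t ty ft].
    case: (gch t) => [//|[ty'|[[tp' _]|[_ _ _ [h1 h2] _]]]].
    + by rewrite ty' eqxx in ty.
    + by rewrite tp' eqxx in tp.
    + by move: ept; rewrite h1 (negbTE h2).
  case: (gch t) => [->//|[ty'|[[_ [ft' _]]|[c0 _ _ _ _]]]].
  + by rewrite ty' eqxx in ty.
  + by rewrite cT ft in ft'.
  + by rewrite c0 in cT.
Qed.

(* Without 4-cycles the items partition the neighbourhood of [x]: they are
   singletons and pairs forming a triangle with [x]. *)
Definition item x w : {set T} := [set z in nbr x | (z == w) || e w z].
Definition items x : {set {set T}} := [set item x w | w in nbr x].
Definition weak x y : bool :=
  (deg y == 3) && [forall r, e y r ==> (r != x) ==> ~~ good r].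
(** Of the neighbours that the item has outside itself and [x], all but at most one are not good, so
    that at most one of them can resist a recolouring. *)
Definition simple_unit x U : bool :=
  (#|U| == 1) && [forall y in U, (deg y == 2) || weak x y]
  || [&& #|U| == 2, [forall y in U, deg y == 3] & [exists y in U, weak x y]].

Lemma item_refl x w : e x w -> w \in item x w.
Proof. by move=> exw; rewrite !inE exw eqxx. Qed.

Lemma item_in x w : e x w -> item x w \in items x.
Proof. by move=> exw; apply: imset_f; rewrite inE. Qed.

(** Otherwise [x t w z] is a 4-cycle. *)
Lemma item_mate x w z t : e x w -> e x z -> e w z -> e x t -> e w t -> t = z.
Proof.
move=> exw exz ewz ext ewt; apply/eqP/negPn/negP => tz.
by apply: (@noC4 x t w z); rewrite // 1?e_sym ?edge_neq // e_sym.
Qed.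

Lemma items_mem x U w : U \in items x -> w \in U -> e x w /\ U = item x w.
Proof.
case/imsetP => v; rewrite inE => exv ->; rewrite !inE => /andP[exw /orP[/eqP->//|evw]].
split=> //; apply/setP => t; rewrite !inE.
case ext: (e x t) => //=; apply/orP/orP => -[/eqP->|].
- by right; rewrite e_sym.
- by move=> evt; left; rewrite (item_mate exv exw evw ext evt).
- by right.
- by move=> ewt; left; apply/eqP; apply: (@item_mate x w v); rewrite // e_sym.
Qed.

Lemma itemsP x U : U \in items x ->
  (exists w, [/\ U = [set w], e x w & forall z, e x z -> ~~ e w z]) \/
  (exists w z, [/\ U = [set w; z], w != z, e x w, e x z & e w z]).
Proof.
case/imsetP => w; rewrite inE => exw ->.
have [/existsP[z /andP[exz ewz]] | /existsPn no] :=
  boolP [exists z, e x z && e w z].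
  right; exists w, z; split=> //; last exact: edge_neq.
  apply/setP => t; rewrite !inE; apply/andP/orP => [[ext /orP[->|ewt]]|[/eqP->|/eqP->]].
  - by left.
  - by right; rewrite (item_mate exw exz ewz ext ewt).
  - by rewrite exw eqxx.
  - by rewrite exz ewz orbT.
left; exists w; split=> // [|z exz]; last by have := no z; rewrite exz.
apply/setP => t; rewrite !inE; have [->|tw] := eqVneq t w; first by rewrite exw.
by have := no t; case: (e x t) => //= /negbTE.
Qed.

Lemma items_partition x : partition (items x) (nbr x).
Proof.
apply/and3P; split.
- apply/eqP/setP => w; rewrite inE; apply/bigcupP/idP => [[U Ui wU]|exw].
    by case: (items_mem Ui wU).
  by exists (item x w); [exact: item_in | exact: item_refl].
- apply/trivIsetP => U V Ui Vi UV; rewrite -setI_eq0; apply: contra_neqT UV.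
  case/set0Pn => w; rewrite inE => /andP[wU wV].
  by have [_ ->] := items_mem Ui wU; have [_ ->] := items_mem Vi wV.
- apply/imsetP => -[w]; rewrite inE => exw /setP/(_ w).
  by rewrite item_refl // inE.
Qed.

Lemma nbr2 v a : deg v = 2 -> e v a ->
  exists r, [/\ e v r, r != a & forall t, e v t -> (t == a) || (t == r)].
Proof.
move=> dv eva; have : #|nbr v :\ a| == 1.
  by have := cardsD1 a (nbr v); rewrite -/(deg v) dv inE eva add1n => -[] <-.
case/cards1P => r /setP hr; exists r.
have := hr r; rewrite !inE eqxx => /andP[ra evr]; split=> // t evt.
by have := hr t; rewrite !inE evt andbT; case: eqP => //= _ <-.
Qed.

Lemma nbr3_1 v a : deg v = 3 -> e v a ->
  exists b r, [/\ b != r, e v b /\ e v r, b != a, r != a &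
    forall t, e v t -> [|| t == a, t == b | t == r]].
Proof.
move=> dv eva; have : #|nbr v :\ a| == 2.
  by have := cardsD1 a (nbr v); rewrite -/(deg v) dv inE eva add1n => -[] <-.
case/cards2P => b [r [br /setP hr]]; exists b, r.
have := hr r; have := hr b; rewrite !inE !eqxx orbT => /andP[ba evb] /andP[ra evr].
split=> // t evt.
by have := hr t; rewrite !inE evt andbT; case: eqP => //= _ <-.
Qed.

Lemma nbr3_2 v a b : deg v = 3 -> e v a -> e v b -> a != b ->
  exists r, [/\ e v r, r != a, r != b & forall t, e v t -> [|| t == a, t == b | t == r]].
Proof.
move=> dv eva evb ab; have [c [d [cd [evc evd] ca da h]]] := nbr3_1 dv eva.
have := h _ evb; rewrite eq_sym (negbTE ab) /= => /orP[]/eqP bE; subst b.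
  by exists d; split; rewrite // 1?eq_sym.
by exists c; split=> // t /h; rewrite orbCA => /or3P[]->; rewrite ?orbT.
Qed.

Lemma cdeg_split U f c x : cdeg f c x =
  #|[set w in nbr x :\: U | f w == Some c]| +
  #|[set w in nbr x :&: U | f w == Some c]|.
Proof.
rewrite addnC cards_disjoint.
  apply: eq_card => w; rewrite !inE.
  by case: (e x w); case: (w \in U); rewrite ?orbF.
apply/setP => w; rewrite !inE.
by case: (w \in U); rewrite ?andbF.
Qed.

Definition grows f g U : Prop :=
  forall t, (f t != None) || (t \in U) -> g t != None.

(* A unit can be coloured at the cost of at most one more neighbour of [x] in
   the colour of [x], and at no cost unless all its keys have the other
   colour. *)
Record unit_spec x U P K : Prop := UnitSpec {
  us_P : forall p, p \in P ->
    [/\ ~~ e x p, p != x & exists2 u, u \in U & e u p];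
  us_K : K \subset P;
  us_K0 : K != set0;
  us_colour : forall f c, valid f -> f x = Some c -> cdeg f c x < cap c ->
    exists g, [/\ valid g, stays U P f g, grows f g U &
      cdeg g c x <= (cdeg f c x).+1];
  us_free : forall f c k, valid f -> f x = Some c -> k \in K ->
    f k <> Some (~~ c) ->
    exists g, [/\ valid g, stays U P f g, grows f g U,
      cdeg g c x <= cdeg f c x &
      c = false -> forall t, t \notin U -> f t = Some false -> g t = Some false]
}.

Lemma stays_at x U P f g c : stays U P f g -> x \notin U ->
  (forall p, p \in P -> ~~ e x p /\ p != x) -> f x = Some c ->
  g x = Some c /\
  cdeg g c x <= cdeg f c x + #|[set w in nbr x :&: U | g w == Some c]|.
Proof.
move=> st xU xP fx; case: (st x xU).
- by apply/negP => /xP[_ /eqP].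
- by move=> p /xP[].
move=> gx /(_ c fx) le; split; first by rewrite gx.
by rewrite (cdeg_split U g) leq_add2r (leq_trans le) // (cdeg_split U f) leq_addr.
Qed.

(** All neighbours of [y] other than [x] are keys. If one of them lacks the colour opposite to that
    of [x], at most one of them has it and this one is not good, so [y] can be given the opposite
    colour. Otherwise [y] takes the colour of [x] and becomes a leaf at [x]. *)
Lemma single_unit x y : e x y -> (forall z, e x z -> ~~ e y z) ->
  (deg y == 2) || weak x y ->
  exists P, unit_spec x [set y] P P.
Proof.
move=> exy no2 wy; have eyx : e y x by rewrite e_sym.
pose O := nbr y :\ x.
have yx := edge_neq eyx.
have xU : x \notin [set y] by rewrite inE eq_sym.
have OP p : p \in O -> [/\ ~~ e x p, p != x & e y p].
  by rewrite !inE => /andP[px eyp]; split=> //; apply/negP => /no2; rewrite eyp.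
have [OK O0] : (forall a, a \in O -> exists2 p, p \in O &
    forall t, t \in O -> t != a -> t = p /\ ~~ good p) /\ O != set0.
  case/orP: wy => [/eqP d2|/andP[/eqP d3 /forallP wk]].
    have [r [eyr rx h]] := nbr2 d2 eyx.
    have rO : r \in O by rewrite !inE rx.
    have Or t : t \in O -> t = r.
      by rewrite !inE => /andP[tx /h]; rewrite (negbTE tx) => /eqP.
    split; last by apply/set0Pn; exists r.
    by move=> a /Or->; exists r => // t /Or->; rewrite eqxx.
  have [b [r [br [eyb eyr] bx rx h]]] := nbr3_1 d3 eyx.
  have ng t : t \in O -> ~~ good t.
    by rewrite !inE => /andP[tx eyt]; have := wk t; rewrite eyt tx.
  have bO : b \in O by rewrite !inE bx.
  have rO : r \in O by rewrite !inE rx.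
  have Obr t : t \in O -> (t == b) || (t == r).
    by rewrite !inE => /andP[tx /h]; rewrite (negbTE tx).
  split; last by apply/set0Pn; exists r.
  move=> a /Obr/orP[]/eqP->; [exists r => // t tO tb | exists b => // t tO tr].
    by have := Obr t tO; rewrite (negbTE tb) => /eqP->; split; rewrite ?ng.
  by have := Obr t tO; rewrite (negbTE tr) orbF => /eqP->; split; rewrite ?ng.
have free f c k : valid f -> f x = Some c -> k \in O -> f k <> Some (~~ c) ->
    exists g, [/\ valid g, stays [set y] O f g, grows f g [set y],
      cdeg g c x <= cdeg f c x &
      c = false -> forall t, t \notin [set y] -> f t = Some false -> g t = Some false].
  move=> vf fx kO fk; have [p pO hp] := OK k kO.
  have vf0 := valid_uncolour y vf; set f0 := upd f y None in vf0.
  have [||||||g [vg gy st gN [_ gT]]] := @place_in [set y] O f0 y p (~~ c).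
  - exact: set11.
  - by [].
  - by [].
  - exact: upd_same.
  - by case: (OP p pO).
  - move=> t eyt; rewrite /f0 upd_other; last by rewrite eq_sym edge_neq.
    move=> ft; apply: hp.
      rewrite !inE eyt andbT; apply: contra_eq_neq ft => ->; rewrite fx.
      by case: (c).
    by apply: contra_not_neq fk => <-.
  have st' : stays [set y] O f g.
    apply: stays_trans st; apply: stays_in => t; rewrite inE => ty.
    by rewrite /f0 upd_other.
  exists g; split=> //.
  - move=> t; have [->|ty] := eqVneq t y; first by rewrite gy.
    by rewrite inE (negbTE ty) orbF gN // /f0 upd_other.
  - have [|_ le] := stays_at st' xU _ fx; first by move=> p' /OP[].
    apply: leq_trans le _; rewrite [X in _ + X](_ : _ = 0) ?addn0 //.
    apply: eq_card0 => w; rewrite !inE; apply/negbTE/negP.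
    by move=> /andP[/andP[_ /eqP->]]; rewrite gy; case: (c).
  - move=> c0 t; rewrite inE => ty ft; apply: gT => //; first by rewrite c0.
    by rewrite /f0 upd_other.
exists O; split=> //.
- by move=> p /OP[h1 h2 h3]; split=> //; exists y; rewrite // inE.
- move=> f c vf fx lt.
  have [/existsP[k /andP[kO /eqP fk]]|/existsPn all] :=
      boolP [exists k, (k \in O) && (f k != Some (~~ c))].
    have [g [vg st gr le _]] := free f c k vf fx kO fk.
    by exists g; split=> //; apply: leq_trans le _.
  have vf0 := valid_uncolour y vf; set f0 := upd f y None in vf0.
  have f0x : f0 x = Some c by rewrite /f0 upd_other // eq_sym.
  exists (upd f0 y (Some c)); split.
  + apply: (@valid_add _ _ _ x) => //; first exact: upd_same.
    move=> t eyt; rewrite /f0 upd_other; last by rewrite eq_sym edge_neq.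
    move=> ft; suff -> : t = x.
      split=> //; apply: leq_ltn_trans lt; apply/subset_leq_card/subsetP => w.
      by rewrite !inE /f0 /upd; case: (w =P y); rewrite ?andbF.
    apply/eqP/negPn/negP => tx; have := all t; rewrite !inE tx eyt ft.
    by case: (c).
  + by apply: stays_in => t; rewrite inE => ty; rewrite /f0 !upd_other.
  + move=> t; have [->|ty] := eqVneq t y; first by rewrite upd_same.
    by rewrite inE (negbTE ty) orbF /f0 !upd_other.
  + rewrite -addn1 -(cards1 y); apply: leq_trans (leq_card_setU _ _).
    apply/subset_leq_card/subsetP => w; rewrite !inE /f0 /upd.
    by case: (w =P y) => [_|_ ->]; rewrite ?orbT.
Qed.

(** The third neighbour [v'] of [v] can be relieved, so [v] can take the colour opposite to that of
    [x] whenever [u] does not have it. The only key is the third neighbour [u'] of [u]: if it lacks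
    the opposite colour, then [u] takes this colour too, as a leaf at [v]; otherwise [u] becomes a
    leaf at [x]. As there are no 4-cycles, the recolouring around [v'] touches neither [x] nor
    [u']. *)
Lemma pair_unit x u v : e x u -> e x v -> e u v -> deg u = 3 -> deg v = 3 ->
  weak x v -> exists P K, unit_spec x [set u; v] P K.
Proof.
move=> exu exv euv du dv wv.
have eux : e u x by rewrite e_sym.
have evx : e v x by rewrite e_sym.
have evu : e v u by rewrite e_sym.
have ux := edge_neq eux; have vx := edge_neq evx; have uv := edge_neq euv.
have xu := edge_neq exu; have xv := edge_neq exv; have vu := edge_neq evu.
have [u' [euu' u'x u'v hu]] := nbr3_2 du eux euv xv.
have [v' [evv' v'x v'u hv]] := nbr3_2 dv evx evu xu.
have gv' : ~~ good v'.
  by case/andP: wv => _ /forallP/(_ v'); rewrite evv' v'x.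
have exu' : ~~ e x u'.
  by apply: contra u'v => exu'; apply/eqP; apply: (@item_mate x u v).
have exv' : ~~ e x v'.
  by apply: contra v'u => exv'; apply/eqP; apply: (@item_mate x v u).
have ev'u' : ~~ e v' u'.
  apply/negP => h; apply: (@noC4 v v' u' u) => //; first by rewrite e_sym.
  by rewrite eq_sym.
have u'v' : u' != v'.
  apply: contraNneq exv' => E; subst v'; have xv' := v'x.
  by case: (@noC4 x u u' v) => //; rewrite 1?e_sym // eq_sym.
have uu' := edge_neq euu'; have vv' := edge_neq evv'.
pose U := [set u; v]; pose P := [set u'; v'].
have xU : x \notin U by rewrite !inE negb_or xu xv.
have PP p : p \in P -> ~~ e x p /\ p != x.
  by rewrite !inE => /orP[]/eqP->.
have uncol f : valid f -> exists f0, [/\ valid f0, f0 u = None, f0 v = None,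
    stays U P f f0 & forall t, t \notin U -> f0 t = f t].
  move=> vf; exists (upd (upd f v None) u None); have st t : t \notin U ->
      upd (upd f v None) u None t = f t.
    by rewrite !inE negb_or => /andP[tu tv]; rewrite !upd_other.
  split=> //; [by do 2!apply: valid_uncolour | exact: upd_same | | exact: stays_in].
  by rewrite upd_other // upd_same.
have notU t : t != u -> t != v -> t \notin U by move=> tu tv; rewrite !inE negb_or tu.
have placev f c : valid f -> f v = None -> f x = Some (~~ c) -> f u <> Some c ->
   exists g, [/\ valid g, g v = Some c, stays U P f g,
    forall t, t != v -> (g t == None) = (f t == None) &
    [/\ g u = f u, g u' = f u' &
    (c = true -> forall t, t != v -> f t = Some false -> g t = Some false)]].
  move=> vf fv fx fu.
  have [||||||g [vg gv st gN [gs gT]]] := @place_in U P f v v' c.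
  - by rewrite !inE eqxx orbT.
  - by rewrite !inE eqxx orbT.
  - by [].
  - by [].
  - by [].
  - move=> t evt ft; case/or3P: (hv t evt) => /eqP tE; subst t => //.
    by move: ft; rewrite fx => -[]; case: (c).
  exists g; split=> //; split=> //.
    by apply: gs; rewrite // ?evu ?orbT // eq_sym.
  by apply: gs; rewrite // ev'u'.
have addu f c p : valid f -> f u = None ->
    (forall t, e u t -> f t = Some c -> t = p) -> cdeg f c p < cap c ->
    let g := upd f u (Some c) in [/\ valid g, stays U P f g & g u = Some c].
  move=> vf fu h lt g; split; last exact: upd_same.
    by apply: (@valid_add _ _ _ p) => // t eut /(h t eut).
  apply: stays_in => t tU; rewrite /g upd_other //.
  by apply: contraNneq tU => ->; rewrite !inE eqxx.
have growsU f f0 g : (forall t, t \notin U -> f0 t = f t) ->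
    (forall t, t != u -> t != v -> (g t == None) = (f0 t == None)) ->
    g u != None -> g v != None -> grows f g U.
  move=> ff0 gf gu gv t; have [->//|tu] := eqVneq t u.
  have [->//|tv] := eqVneq t v.
  by rewrite gf // ff0 ?notU // !inE (negbTE tu) (negbTE tv) !orbF.
have free f c : valid f -> f x = Some c -> f u' <> Some (~~ c) ->
    exists g, [/\ valid g, stays U P f g, grows f g U,
      cdeg g c x <= cdeg f c x &
      c = false -> forall t, t \notin U -> f t = Some false -> g t = Some false].
  move=> vf fx fu'; have [f0 [vf0 f0u f0v st0 f0E]] := uncol f vf.
  have f0x : f0 x = Some (~~ ~~ c) by rewrite negbK f0E.
  have f0u' : f0 u' = f u' by apply/f0E/notU; rewrite // eq_sym.
  have [|g1 [vg1 g1v st1 g1N [g1u g1u' g1T]]] := placev f0 (~~ c) vf0 f0v f0x.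
    by rewrite f0u.
  have g1x : g1 x = Some c.
    by case: (stays_at st1 xU PP (c := c)); rewrite ?f0E.
  have [|||vg st2 gu] := addu g1 (~~ c) v vg1.
  - by rewrite g1u f0u.
  - move=> t eut gt; case/or3P: (hu t eut) => /eqP tE; subst t => //.
      by move: gt; rewrite g1x => -[]; case: (c).
    by case: fu'; rewrite -f0u' -g1u'.
  - apply: (@leq_ltn_trans 1); last by case: (c).
    apply: (@leq_trans #|[set v']|); last by rewrite cards1.
    apply/subset_leq_card/subsetP => w; rewrite !inE => /andP[/hv].
    case/or3P => /eqP->; rewrite ?eqxx //; first by rewrite g1x; case: (c).
    by rewrite g1u f0u.
  set g := upd g1 u _ in vg st2 gu.
  have gv : g v = Some (~~ c) by rewrite /g upd_other.
  have stg : stays U P f g by apply: stays_trans st0 (stays_trans st1 st2).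
  exists g; split=> //.
  - apply: (growsU f f0) => //; last by rewrite gv.
      by move=> t tu tv; rewrite /g upd_other // g1N.
    by rewrite gu.
  - have [//|_ le] := stays_at stg xU _ fx.
    apply: leq_trans le _; rewrite [X in _ + X](_ : _ = 0) ?addn0 //.
    apply: eq_card0 => w; rewrite !inE; apply/negbTE/negP.
    by move=> /andP[/andP[_ /orP[]/eqP->]]; rewrite ?gu ?gv; case: (c).
  - move=> c0 t tU ft; have := tU; rewrite !inE negb_or => /andP[tu tv].
    by rewrite /g upd_other // g1T ?c0 ?f0E.
exists P, [set u']; split.
- move=> p pP; have [h1 h2] := PP p pP; split=> //.
  move: pP; rewrite !inE => /orP[]/eqP->; [exists u | exists v];
  by rewrite // !inE eqxx ?orbT.
- by rewrite sub1set !inE eqxx.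
- by apply/set0Pn; exists u'; rewrite inE.
- move=> f c vf fx lt.
  have [fu' | fu'] := eqVneq (f u') (Some (~~ c)); last first.
    have [g [vg st gr le _]] := free f c vf fx (elimN eqP fu').
    by exists g; split=> //; apply: leq_trans le _.
  have [f0 [vf0 f0u f0v st0 f0E]] := uncol f vf.
  have f0x : f0 x = Some c by rewrite f0E.
  have f0u' : f0 u' = f u' by apply/f0E/notU; rewrite // eq_sym.
  have [||vg1 st1 g1u] := addu f0 c x vf0 f0u.
  + move=> t eut ft; case/or3P: (hu t eut) => /eqP tE; subst t => //.
      by rewrite f0v in ft.
    by move: ft; rewrite f0u' fu' => -[]; case: (c).
  + apply: leq_ltn_trans lt; apply/subset_leq_card/subsetP => w; rewrite !inE.
    have [wU|wU] := boolP (w \in U); last by rewrite f0E.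
    by move: wU; rewrite !inE => /orP[]/eqP->; rewrite ?f0u ?f0v andbF.
  set g1 := upd f0 u (Some c) in vg1 st1 g1u.
  have [|||g [vg gv st2 gN [gu _ _]]] := placev g1 (~~ c) vg1.
  + by rewrite /g1 upd_other.
  + by rewrite negbK /g1 upd_other // eq_sym.
  + by rewrite g1u => -[]; case: (c).
  have stg : stays U P f g by apply: stays_trans st0 (stays_trans st1 st2).
  exists g; split=> //.
  + apply: (growsU f f0) => //; last by rewrite gv.
      by move=> t tu tv; rewrite gN // /g1 upd_other.
    by rewrite gu g1u.
  + have [//|_ le] := stays_at stg xU _ fx.
    apply: leq_trans le _; rewrite -[in X in _ <= X]addn1 leq_add2l -(cards1 u).
    apply/subset_leq_card/subsetP => w; rewrite !inE.
    by move=> /andP[/andP[_ /orP[->//|/eqP->]]]; rewrite gv; case: (c).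
- by move=> f c k vf fx; rewrite inE => /eqP->; apply: free.
Qed.

Lemma simple_unit_spec x U : U \in items x -> simple_unit x U ->
  exists P K, unit_spec x U P K.
Proof.
move=> Ui uU; case: (itemsP Ui) => [[w [UE exw no]]|[w [z [UE wz exw exz ewz]]]].
  case/orP: uU => [|/and3P[]]; rewrite UE cards1 //= => /forallP/(_ w).
  rewrite inE eqxx /= => h; have [P hP] := single_unit exw no h.
  by exists P, P.
case/orP: uU => [/andP[]|/and3P[_ /forallP d3 /existsP[v /andP[vU wv]]]].
  by rewrite UE cards2 wz.
have dw : deg w = 3 by have := d3 w; rewrite UE !inE eqxx => /eqP.
have dz : deg z = 3 by have := d3 z; rewrite UE !inE eqxx orbT => /eqP.
move: vU; rewrite UE !inE => /orP[]/eqP vE; subst v; last exact: pair_unit.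
by rewrite setUC; apply: pair_unit; rewrite // e_sym.
Qed.

(** * Tight vertices: a second kind of unit *)

(** Degree counts at a vertex with four items: one pair with a vertex of degree 2, [a] simple units
    and [h] other items. *)
Lemma arith_hs (a b h k : nat) : a + h + 1 = 4 -> b <= k -> k <= h -> b + a + 1 <= 4.
Proof. lia. Qed.

Lemma arith_hs1 (a h : nat) : a + h + 1 = 4 -> h = 1 -> 0 + a + 1 <= 3.
Proof. lia. Qed.

Lemma arith_leaf (a b h : nat) : a + h + 1 = 4 -> b <= 1 -> b + a <= 4.
Proof. lia. Qed.

Definition pair2 U : bool := (#|U| == 2) && [exists q in U, deg q == 2].
Definition single3 x U : bool :=
  [&& #|U| == 1, [forall p in U, deg p == 3] & ~~ simple_unit x U].
(** In discharging, such a vertex is short of its 12 by 1 or 2 if its pair brings only the usual 4.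
    The third vertex of the triangle formed with the vertex of degree 2 therefore sends it 2, and
    can do so because the pair containing the tight vertex is a unit there. *)
Definition tight y : bool :=
  [&& good y, #|items y| == 4,
    [exists U in items y, pair2 U &&
       [forall V in items y, (V != U) ==> simple_unit y V || single3 y V]]
    & #|[set V in items y | single3 y V]| <= 1].
Definition tight_unit U : bool := pair2 U && [exists y in U, tight y].
Definition is_unit x U : bool := simple_unit x U || tight_unit U.

Lemma good_deg x : good x -> 5 <= deg x.
Proof. by case/orP => [|/andP[/eqP->//]]; apply: ltnW. Qed.

(** Two vertices of colour [c] in one item would form a triangle of colour [c] with [x]. *)
Lemma cdeg_items f x c (A : {set {set T}}) : valid f -> f x = Some c ->
  A \subset items x -> (forall U w, U \in A -> w \in U -> f w <> Some c) ->
  cdeg f c x + #|A| <= #|items x|.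
Proof.
move=> vf fx Asub Ac; rewrite -(cardsID A (items x)) (setIidPr Asub) addnC leq_add2l.
rewrite /cdeg -(@card_in_imset _ _ (item x) [set y in nbr x | f y == Some c]).
  apply/subset_leq_card/subsetP => _ /imsetP[w + ->].
  rewrite !inE => /andP[exw /eqP fw]; rewrite item_in // andbT.
  by apply/negP => /Ac/(_ (item_refl exw)).
move=> u w; rewrite !inE => /andP[exu /eqP fu] /andP[exw /eqP fw] uw.
apply/eqP; apply: contraT => unew.
have : w \in item x u by rewrite uw item_refl.
rewrite !inE exw eq_sym (negbTE unew) /= => euw.
by case: (triangle_valid vf exu euw _ fx fu fw); rewrite e_sym.
Qed.

Lemma cdeg_sub f g c x : (forall t, e x t -> g t = Some c -> f t = Some c) ->
  cdeg g c x <= cdeg f c x.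
Proof.
move=> h; apply/subset_leq_card/subsetP => t; rewrite !inE.
by move=> /andP[ext /eqP /(h _ ext)->]; rewrite ext eqxx.
Qed.

Lemma cdeg1 f c x p : (forall t, e x t -> f t = Some c -> t = p) -> cdeg f c x <= 1.
Proof.
move=> h; rewrite -(cards1 p); apply/subset_leq_card/subsetP => t; rewrite !inE.
by move=> /andP[ext /eqP /(h _ ext)->].
Qed.

Lemma cdeg0 f c x : (forall t, e x t -> f t <> Some c) -> cdeg f c x = 0.
Proof.
move=> h; apply: eq_card0 => t; rewrite !inE; apply/negbTE/negP.
by move=> /andP[/h ft /eqP].
Qed.

Lemma cdeg_deg f c x : cdeg f c x <= deg x.
Proof. by apply/subset_leq_card/subsetP => t; rewrite !inE => /andP[]. Qed.

Lemma cdeg_add f c c' x y : cdeg (upd f y (Some c')) c x <= (cdeg f c x).+1.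
Proof.
rewrite -addn1 -(cards1 y); apply: leq_trans (leq_card_setU _ _).
apply/subset_leq_card/subsetP => t; rewrite !inE /upd.
by case: (t =P y) => [_|_ ->]; rewrite ?orbT.
Qed.

Definition absorbs x U : Prop := forall f c, valid f -> f x = Some c ->
  cdeg f c x < cap c -> exists g, [/\ valid g, g x = Some c, grows f g U &
    cdeg g c x <= (cdeg f c x).+1].

Lemma item_notin x U : U \in items x -> x \notin U.
Proof. by move=> Ui; apply/negP => /(items_mem Ui)[]; rewrite e_irr. Qed.

(** A neighbour of [w] in [U] would put [w] into the item [U], and a neighbour of [w] in [P] would
    close a 4-cycle through [U] and [x]. Hence colouring one unit at [x] does not disturb the other
    neighbours of [x]. *)
Lemma spec_away x U P K f g w : U \in items x -> unit_spec x U P K ->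
  stays U P f g -> e x w -> w \notin U ->
  g w = f w /\ forall c, f w = Some c -> cdeg g c w <= cdeg f c w.
Proof.
move=> Ui sp st exw wU.
have noUw u : u \in U -> ~~ e u w.
  move=> uU; apply: contra wU => euw; have [exu ->] := items_mem Ui uU.
  by rewrite !inE exw euw orbT.
have [||gw le] := st w wU.
- by apply/negP => /(us_P sp)[]; rewrite exw.
- move=> p /(us_P sp)[exp px [u uU eup]]; apply/negP => ewp.
  have [exu _] := items_mem Ui uU.
  apply: (@noC4 w p u x) => //; rewrite 1?e_sym //.
  by apply: contraNneq wU => ->.
split=> // c fw; rewrite (cdeg_split U g) (cdeg_split U f) leq_add ?le //.
rewrite [X in X <= _](_ : _ = 0) //; apply: eq_card0 => u; rewrite !inE.
by apply/negbTE/negP => /andP[/andP[ewu /noUw]]; rewrite e_sym ewu.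
Qed.

Lemma spec_at x U P K f g c : U \in items x -> unit_spec x U P K ->
  stays U P f g -> f x = Some c -> g x = Some c.
Proof.
move=> Ui sp st fx; have [|->//] := stays_at st (item_notin Ui) _ fx.
by move=> p /(us_P sp)[].
Qed.

Lemma simple_unit_absorbs x U : U \in items x -> simple_unit x U -> absorbs x U.
Proof.
move=> Ui /(simple_unit_spec Ui)[P [K sp]] f c vf fx lt.
have [g [vg st gr le]] := us_colour sp vf fx lt; exists g; split=> //.
exact: spec_at Ui sp st fx.
Qed.

Definition colours_all f g (us : seq {set T}) : Prop :=
  forall t, (f t != None) || has (fun U => t \in U) us -> g t != None.

Lemma absorbs_list x (us : seq {set T}) f c : {in us, forall U, absorbs x U} ->
  valid f -> f x = Some c -> cdeg f c x + size us <= cap c ->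
  exists g, [/\ valid g, g x = Some c, colours_all f g us &
    cdeg g c x <= cdeg f c x + size us].
Proof.
elim: us f => [|U us IH] f pr vf fx /= le.
  by exists f; split=> // [t|]; rewrite ?orbF ?addn0.
have [||g [vg gx gr leg]] := pr U _ f c vf fx; first by rewrite inE eqxx.
  by rewrite addnS in le; apply: leq_trans (leq_addr _ _) le.
have [||h [vh hx hr leh]] := IH g _ vg gx.
- by move=> V Vus; apply: pr; rewrite inE Vus orbT.
- by apply: leq_trans le; rewrite addnS -addSn leq_add2r.
exists h; split=> //.
  by move=> t /or3P[ht|ht|ht]; apply: hr; apply/orP; [left|left|right]; rewrite // gr // ht ?orbT.
by rewrite addnS -addSn; apply: leq_trans leh _; rewrite leq_add2r.
Qed.

Lemma simple_unit_list y (us : seq {set T}) f c :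
  {in us, forall U, U \in items y /\ simple_unit y U} ->
  valid f -> f y = Some c -> cdeg f c y + size us <= cap c ->
  exists g, [/\ valid g, g y = Some c, colours_all f g us,
    cdeg g c y <= cdeg f c y + size us &
    forall w, e y w -> ~~ has (fun U => w \in U) us -> g w = f w /\
      forall c', f w = Some c' -> cdeg g c' w <= cdeg f c' w].
Proof.
elim: us f => [|U us IH] f pr vf fy /= le.
  by exists f; split=> // [t|]; rewrite ?orbF ?addn0.
have [Ui uU] := pr U (mem_head _ _).
have [P [K sp]] := simple_unit_spec Ui uU.
have [|g [vg st gr leg]] := us_colour sp vf fy.
  by rewrite addnS in le; apply: leq_trans (leq_addr _ _) le.
have [||h [vh hy hr leh hw]] := IH g _ vg (spec_at Ui sp st fy).
- by move=> V Vus; apply: pr; rewrite inE Vus orbT.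
- by apply: leq_trans le; rewrite addnS -addSn leq_add2r.
exists h; split=> //.
- by move=> t /or3P[ht|ht|ht]; apply: hr; apply/orP; [left|left|right]; rewrite // gr // ht ?orbT.
- by rewrite addnS -addSn; apply: leq_trans leh _; rewrite leq_add2r.
- move=> w eyw; rewrite negb_or => /andP[wU wus].
  have [gw gle] := spec_away Ui sp st eyw wU.
  have [hgw hle] := hw w eyw wus; rewrite hgw gw; split=> // c' fw.
  by apply: leq_trans (hle c' _) (gle c' fw); rewrite gw.
Qed.

Lemma tight_unit_split z U : U \in items z -> tight_unit U -> exists q y,
  [/\ U = [set q; y], e z q, e z y, e q y & [/\ deg q = 2, tight y & q != y]].
Proof.
move=> Ui /andP[/andP[U2 /existsP[q /andP[qU /eqP dq]]] /existsP[y /andP[yU ty]]].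
have qy : q != y.
  by apply: contraTneq ty => <-; rewrite /tight /good dq.
case: (itemsP Ui) U2 qU yU => [[w [-> _ _]]|]; first by rewrite cards1.
move=> [w [v [-> wv ezw ezv ewv]]] _.
rewrite !inE => /orP[]/eqP E1 /orP[]/eqP E2; subst q y; rewrite ?eqxx // in qy *.
  by exists w, v.
by exists v, w; split=> //; [exact: setUC | rewrite e_sym].
Qed.

(** Once [q], [y] and the simple units at [y] are erased, at most one neighbour [p] of [y] besides
    [z] is coloured, and [p] has degree 3. Normally [y] takes the colour opposite to that of [z],
    and so does [q] as a leaf at [y]; then [z] pays nothing. The exception is [c = true] with [p]
    missing or not coloured [true]: here [y] becomes a leaf at [z], and [q] gets [false]. *)
Lemma tight_unit_colour z U f c : U \in items z -> tight_unit U -> valid f ->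
  f z = Some c -> cdeg f c z < cap c \/ c = false ->
  exists g, [/\ valid g, g z = Some c, grows f g U &
    cdeg g c z <= cdeg f c z + c].
Proof.
move=> Ui /(tight_unit_split Ui)[q [y [UE ezq ezy eqy [dq ty qy]]]] vf fz lt.
have eyz : e y z by rewrite e_sym.
have eqz : e q z by rewrite e_sym.
have eyq : e y q by rewrite e_sym.
have yz := edge_neq eyz; have qz := edge_neq eqz.
have hq t : e q t -> (t == z) || (t == y).
  have [r [eqr rz h]] := nbr2 dq eqz.
  by move=> /h; have := h _ eqy; rewrite (negbTE yz) /= => /eqP<-.
case/and4P: ty => gy /eqP I4 /existsP[U0 /and3P[U0i T2U0 /forallP allU]] h1.
have qzi : item y q \in items y by rewrite item_in.
have qzE : item y q = [set q; z].
  apply/setP => t; rewrite !inE; apply/andP/orP => [[eyt /orP[->|]]|[/eqP->|/eqP->]].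
  - by left.
  - by move=> /hq/orP[->|/eqP ty]; [right | rewrite ty e_irr in eyt].
  - by rewrite eyq eqxx.
  - by rewrite eyz eqz orbT.
(* The pair of [q] and [z] is neither a simple unit nor a single vertex, as [q] has degree 2; so it
   is the exceptional item of [y]. *)
have U0E : U0 = item y q.
  apply/eqP; apply: contraT => ne; have := allU (item y q).
  rewrite qzi eq_sym ne /= /simple_unit /single3 qzE cards2 qz /= orbF.
  move=> /andP[/forallP/(_ q)]; rewrite !inE eqxx dq //.
pose inner := [set V in items y | simple_unit y V].
pose hs := [set V in items y | single3 y V].
have cardI : #|inner| + #|hs| + 1 = 4.
  rewrite -I4 -(cards1 (item y q)) !cards_disjoint.
  - apply: eq_card => V; rewrite !inE; apply/idP/idP.
      by move=> /orP[/orP[]/andP[]|/eqP->].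
    move=> Vi; have := allU V; rewrite Vi U0E /=.
    by case: eqP => [->|_] /=; rewrite ?eqxx ?orbT // => ->.
  - apply/setP => V; rewrite !inE; apply/negbTE/negP => /andP[+ /eqP VE].
    rewrite VE qzi /= /simple_unit /single3 qzE cards2 qz /= orbF.
    by move=> /andP[/forallP/(_ q)]; rewrite !inE eqxx dq.
  - apply/setP => V; rewrite !inE; apply/negbTE/negP.
    by move=> /andP[/andP[_ uV] /andP[_ /and3P[_ _ /negP[]]]].
pose us := enum inner.
have usP : {in us, forall V, V \in items y /\ simple_unit y V}.
  by move=> V; rewrite mem_enum inE => /andP[].
have sus : size us = #|inner| by rewrite -cardE.
pose B := [set t | has (fun V => t \in V) us].
have BP t : t \in B -> e y t /\ t \notin [set q; z].
  rewrite inE => /hasP[V Vus tV]; have [Vi uV] := usP V Vus.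
  have [eyt VE] := items_mem Vi tV; split=> //.
  apply/negP => tqz; move: uV; rewrite VE.
  have -> : item y t = item y q.
    by rewrite -qzE in tqz; have [_ ->] := items_mem qzi tqz.
  rewrite /simple_unit qzE cards2 qz /= => /andP[/forallP/(_ q)].
  by rewrite !inE eqxx dq.
have qB : q \notin B by apply/negP => /BP[_]; rewrite !inE eqxx.
have zB : z \notin B by apply/negP => /BP[_]; rewrite !inE eqxx orbT.
pose f1 t := if (t \in [set q; y]) || (t \in B) then None else f t.
have vf1 : valid f1 by apply: (valid_sub vf) => t; rewrite /f1; case: ifP; [left|right].
have f1q : f1 q = None by rewrite /f1 !inE eqxx.
have f1y : f1 y = None by rewrite /f1 !inE eqxx orbT.
have zqy : z \notin [set q; y] by rewrite !inE negb_or eq_sym qz eq_sym yz.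
have f1z : f1 z = Some c by rewrite /f1 (negbTE zqy) (negbTE zB).
have cz : cdeg f1 c z <= cdeg f c z.
  by apply: cdeg_sub => t _; rewrite /f1; case: ifP.
have noq : ~~ has (fun V => q \in V) us by move: qB; rewrite inE.
have noz : ~~ has (fun V => z \in V) us by move: zB; rewrite inE.
have [p hp] : exists p, (deg p = 3 \/ #|hs| = 0) /\
    forall t, e y t -> f1 t != None -> t = z \/ (#|hs| = 1 /\ t = p).
  have cov t : e y t -> f1 t != None -> t = z \/ item y t \in hs.
    move=> eyt; rewrite /f1; case: ifPn => // /norP[+ tB] _.
    rewrite !inE negb_or => /andP[tq _].
    have ti := item_in eyt.
    have := allU (item y t); rewrite ti U0E /=.
    case: eqP => [E _|_ /= /orP[u|->]]; last by right.
      have : t \in item y q by rewrite -E item_refl.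
      by rewrite qzE !inE (negbTE tq) => /eqP->; left.
    case/negP: tB; rewrite inE; apply/hasP; exists (item y t); last exact: item_refl.
    by rewrite mem_enum inE ti.
  have [h0|/set0Pn[V Vh]] := eqVneq hs set0.
    exists z; split; first by right; rewrite h0 cards0.
    by move=> t eyt ft; case: (cov t eyt ft); [left | rewrite h0 inE].
  have hs1 : #|hs| = 1 by apply/eqP; rewrite eqn_leq h1; apply/card_gt0P; exists V.
  have := Vh; rewrite inE => /andP[Vi /and3P[/cards1P[p VE] d3 _]].
  exists p; split.
    by left; move/forallP/(_ p): d3; rewrite VE inE eqxx => /eqP.
  move=> t eyt ft; case: (cov t eyt ft) => [|th]; [by left | right; split=> //].
  have : item y t = V.
    by move/eqP/cards1P: hs1 => [W hsW]; move: th Vh; rewrite hsW !inE => /eqP-> /eqP->.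
  by move=> E; have := item_refl eyt; rewrite E VE inE => /eqP.
have finish g : valid g -> g z = Some c -> g q != None -> g y != None ->
    (forall t, t != q -> (f1 t != None) || (t \in B) || (t == y) -> g t != None) ->
    cdeg g c z <= cdeg f c z + c ->
    exists g, [/\ valid g, g z = Some c, grows f g U & cdeg g c z <= cdeg f c z + c].
  move=> vg gz gq gy' gr le; exists g; split=> // t.
  have [->//|tq] := eqVneq t q.
  rewrite UE !inE (negbTE tq) /= => ht; apply: gr => //.
  have [|ty] := eqVneq t y; first by rewrite orbT.
  have [|tB] := boolP (t \in B); first by rewrite orbT.
  by rewrite /f1 !in_set2 (negbTE tq) (negbTE ty) (negbTE tB) !orbF; rewrite (negbTE ty) orbF in ht.
have stepq g c' : valid g -> g q = None -> (g y = Some c' -> cdeg g c' y < cap c') ->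
    g z <> Some c' -> valid (upd g q (Some c')).
  move=> vg gq lty gz; apply: (@valid_add _ _ _ y) => // t eqt gt.
  case/orP: (hq t eqt) => /eqP tE; subst t => //; split=> //; exact: lty.
have after g h : colours_all g h us -> g y != None ->
    (forall t, (f1 t != None) || (t == y) -> g t != None) ->
    forall t, t != q -> (f1 t != None) || (t \in B) || (t == y) -> h t != None.
  move=> ca gy' gr t tq; rewrite orbAC => /orP[/gr gt|tB]; apply: ca; rewrite ?gt //.
  by move: tB; rewrite inE => ->; rewrite orbT.
have updN b t : (f1 t != None) || (t == y) -> upd f1 y (Some b) t != None.
  by rewrite /upd; case: (t =P y) => //; rewrite orbF.
have bnd g c' : (forall t, t != y -> g t = f1 t) -> f1 z <> Some c' ->
    cdeg g c' y <= #|hs|.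
  move=> ge nz; have [h0|h0] := eqVneq #|hs| 0.
    rewrite h0 cdeg0 // => t eyt; rewrite ge; last by rewrite eq_sym edge_neq.
    move=> ft; case: (hp.2 t eyt) => [|tz|[]]; [by rewrite ft|by rewrite tz in ft|].
    by rewrite h0.
  have -> : #|hs| = 1 by apply/eqP; rewrite eqn_leq h1 lt0n.
  apply: (@cdeg1 _ _ _ p) => t eyt; rewrite ge; last by rewrite eq_sym edge_neq.
  move=> ft; case: (hp.2 t eyt) => [|tz|[]//]; first by rewrite ft.
  by rewrite tz in ft.
have [pf | pf] := boolP ((c == false) || (#|hs| == 1) && (f1 p == Some true)).
  pose g1 := upd f1 y (Some (~~ c)).
  have nz : f1 z <> Some (~~ c) by rewrite f1z => -[]; case: (c).
  have vg1 : valid g1.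
    apply: (@valid_add _ _ _ p) => // t eyt ft.
    have [|tz|[hs1 tp]] := hp.2 t eyt; [by rewrite ft|by case: nz; rewrite -tz|].
    split=> //; case: hp => -[dp|]; last by rewrite hs1.
    move=> _; case/orP: pf => [/eqP c0|/andP[_ /eqP fp]].
      by rewrite c0 /=; apply: leq_ltn_trans (cdeg_deg _ _ _) _; rewrite dp.
    move: ft nz; rewrite tp fp => -[cT]; rewrite f1z => _.
    by rewrite -cT; apply: leq_ltn_trans (cdeg_deg _ _ _) _; rewrite dp.
  (* This leaves room for the simple units at [y], one for each, and for [q]. *)
  have leb : cdeg g1 (~~ c) y + #|inner| + 1 <= cap (~~ c).
    have [cF|cT] := eqVneq c false.
      have := bnd g1 (~~ c) (fun t ty => upd_other _ _ ty) nz.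
      by move/(arith_hs cardI)/(_ (leqnn _)); rewrite cF.
    have {}cT : c = true by case: (c) cT.
    move: pf; rewrite cT /= => /andP[/eqP hs1 /eqP fp].
    rewrite cdeg0 ?[cap _]/= => [|t eyt]; first exact: arith_hs1 cardI hs1.
    rewrite /g1 cT upd_other; last by rewrite eq_sym edge_neq.
    move=> ft; have [|tz|[_ tp]] := hp.2 t eyt; first by rewrite ft.
      by move: ft; rewrite tz f1z cT.
    by rewrite tp fp in ft.
  have [||g2 [vg2 g2y g2all g2le g2w]] := simple_unit_list (y := y) (c := ~~ c) usP vg1.
  - exact: upd_same.
  - by rewrite sus; apply: leq_trans leb; rewrite leq_addr.
  have [g2q _] := g2w q eyq noq; have [g2z g2zle] := g2w z eyz noz.
  have g1q : g1 q = None by rewrite /g1 upd_other.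
  have g1z : g1 z = Some c by rewrite /g1 upd_other // eq_sym.
  apply: (finish (upd g2 q (Some (~~ c)))).
  - apply: stepq; rewrite ?g2q ?g1q ?g2z ?g1z //; last by case; case: (c).
    move=> _; rewrite sus in g2le; apply: leq_ltn_trans g2le _.
    by rewrite addn1 in leb.
  - by rewrite upd_other ?g2z // eq_sym.
  - by rewrite upd_same.
  - by rewrite upd_other ?g2y // eq_sym.
  - move=> t tq; rewrite upd_other //; apply: (after g1) => //.
      by rewrite /g1 upd_same.
    by move=> t'; apply: updN.
  - have le0 : cdeg (upd g2 q (Some (~~ c))) c z <= cdeg g2 c z.
      apply: cdeg_sub => t _; rewrite /upd; case: (t =P q) => // _ [].
      by case: (c).
    have le1 : cdeg g1 c z <= cdeg f1 c z.
      apply: cdeg_sub => t _; rewrite /g1 /upd; case: (t =P y) => // _ [].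
      by case: (c).
    exact: leq_trans le0 (leq_trans (g2zle c g1z) (leq_trans le1 (leq_trans cz (leq_addr _ _)))).
move: pf; rewrite negb_or => /andP[/eqP cT pf].
have {}cT : c = true by case: (c) cT.
subst c; case: lt => // lt.
have f1t t : e y t -> f1 t = Some true -> t = z.
  move=> eyt ft; have [|//|[hs1 tp]] := hp.2 t eyt; first by rewrite ft.
  by move: pf; rewrite hs1 -tp ft.
pose g1 := upd f1 y (Some true).
have vg1 : valid g1.
  apply: (@valid_add _ _ _ z) => // t eyt /(f1t t eyt)->.
  by split=> //; apply: leq_ltn_trans cz lt.
have leb : cdeg g1 true y + #|inner| <= 4.
  have : cdeg g1 true y <= 1.
    apply: (@cdeg1 _ _ _ z) => t eyt; rewrite /g1 upd_other; first exact: f1t.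
    by rewrite eq_sym edge_neq.
  exact: arith_leaf cardI.
have [||g2 [vg2 g2y g2all g2le g2w]] := simple_unit_list (y := y) (c := true) usP vg1.
- exact: upd_same.
- by rewrite sus.
have [g2q _] := g2w q eyq noq; have [g2z g2zle] := g2w z eyz noz.
have g1q : g1 q = None by rewrite /g1 upd_other.
have g1z : g1 z = Some true by rewrite /g1 upd_other // eq_sym.
apply: (finish (upd g2 q (Some false))).
- by apply: stepq; rewrite ?g2q ?g1q ?g2z ?g1z ?g2y.
- by rewrite upd_other ?g2z // eq_sym.
- by rewrite upd_same.
- by rewrite upd_other ?g2y // eq_sym.
- move=> t tq; rewrite upd_other //; apply: (after g1) => //.
    by rewrite /g1 upd_same.
  by move=> t'; apply: updN.
- have le0 : cdeg (upd g2 q (Some false)) true z <= cdeg g2 true z.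
    by apply: cdeg_sub => t _; rewrite /upd; case: (t =P q).
  apply: leq_trans le0 (leq_trans (g2zle true g1z) _); rewrite addn1.
  by apply: leq_trans (cdeg_add _ _ _ _ _) _; rewrite ltnS.
Qed.

(** * A minimal uncolourable set *)

Variable S : {set T}.
Hypothesis eS : forall x y, e x y -> x \in S.
Hypothesis colour_proper : forall D : {set T}, D \proper S ->
  exists2 f, valid f & forall x, (f x != None) = (x \in D).
Hypothesis no_colouring : forall f, valid f -> (forall x, x \in S -> f x != None) ->
  False.

Lemma remove (X : {set T}) x : x \in S -> x \in X -> exists f, [/\ valid f,
  forall y, y \in X -> f y = None & forall y, y \in S -> y \notin X -> f y != None].
Proof.
move=> xS xX; have [|f vf fD] := colour_proper (D := S :\: X).
  rewrite properE subsetDl; apply/subsetPn; exists x => //.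
  by rewrite inE xX.
exists f; split=> // [y yX|y yS yX]; last by rewrite fD inE yX.
by apply/eqP; rewrite -[_ == _]negbK fD inE yX.
Qed.

Lemma edgeS x y : e x y -> y \in S. Proof. by rewrite e_sym => /eS. Qed.

Lemma remove1 x : x \in S -> exists f, [/\ valid f, f x = None &
  forall y, y \in S -> y != x -> f y != None].
Proof.
move=> xS; have [f [vf fx fS]] := remove xS (set11 x).
exists f; split=> //; first by apply: fx; rewrite inE.
by move=> y yS yx; apply: fS; rewrite ?inE.
Qed.

Lemma finish1 f g x c : (forall y, y \in S -> y != x -> f y != None) ->
  (forall t, t != x -> (g t == None) = (f t == None)) -> g x = Some c -> valid g ->
  False.
Proof.
move=> fS gf gx vg; apply: (no_colouring vg) => y yS.
by have [->|yx] := eqVneq y x; rewrite ?gx // gf // fS.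
Qed.

Lemma one_nbr f c x : cdeg f c x <= 1 -> (forall t, e x t -> f t <> Some c) \/
  exists p, [/\ e x p, f p = Some c & forall t, e x t -> f t = Some c -> t = p].
Proof.
rewrite leq_eqVlt ltnS leqn0 => /orP[/cards1P[p /setP hp]|/eqP/cards0_eq/setP h0].
  right; exists p; have := hp p; rewrite !inE eqxx => /andP[exp /eqP fp].
  by split=> // t ext ft; have := hp t; rewrite !inE ext ft eqxx /= => /esym/eqP.
by left=> t ext ft; have := h0 t; rewrite !inE ext ft eqxx.
Qed.

Lemma cdeg_total f x : cdeg f false x + cdeg f true x <= deg x.
Proof.
rewrite /cdeg cards_disjoint.
  by apply/subset_leq_card/subsetP => t; rewrite !inE => /orP[]/andP[].
apply/setP => t; rewrite !inE; case: (f t) => [[]|] /=; by rewrite ?andbF.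
Qed.

Lemma deg_ge2 x : x \in S -> 2 <= deg x.
Proof.
move=> xS; rewrite ltnNge; apply/negP => d1.
have [f [vf fx fS]] := remove1 xS.
have [c /cards0_eq/setP c0] : exists c, cdeg f c x = 0.
  have := leq_trans (cdeg_total f x) d1.
  case E: (cdeg f false x) => [|k]; first by exists false.
  by rewrite addSn ltnS leqn0 addn_eq0 => /andP[_ /eqP]; exists true.
apply: (@finish1 f (upd f x (Some c)) x c) => //.
- by move=> t tx; rewrite upd_other.
- exact: upd_same.
- apply: valid_add0 => // y exy fy; have := c0 y.
  by rewrite !inE exy fy eqxx.
Qed.

(** If both neighbours of [x] have the same colour, the other colour is free for [x]. Otherwise [x]
    can take the colour of [y], since a [y] that is not good can be relieved. *)
Lemma nbr_good_deg2 x y : e x y -> deg x = 2 -> good y.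
Proof.
move=> exy dx; apply: contraT => gy; have xS := eS exy.
have [f [vf fx fS]] := remove1 xS.
have [r [exr ry h]] := nbr2 dx exy.
have fy : f y != None by apply: fS (edgeS exy) _; rewrite eq_sym edge_neq.
case fyE: (f y) fy => [c|//] _.
have [frE | frE] := eqVneq (f r) (Some c).
  case: (@finish1 f (upd f x (Some (~~ c))) x (~~ c)) => //.
  - by move=> t tx; rewrite upd_other.
  - exact: upd_same.
  - apply: valid_add0 => // t /h/orP[]/eqP->; rewrite ?fyE ?frE => -[]; by case: (c).
have [|g [vg gx gN _]] := place (c := c) vf fx exy.
  by move=> t /h/orP[]/eqP-> // ft; rewrite ft eqxx in frE.
by case: (@finish1 f g x c).
Qed.

(** Some colour occurs at most once among three neighbours, and a vertex that is not good makes room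
    for [x]. *)
Lemma exists_good_deg3 x : x \in S -> deg x <= 3 -> exists2 y, e x y & good y.
Proof.
move=> xS d3; have [/existsP[y /andP[exy gy]]|/existsPn ng] :=
  boolP [exists y, e x y && good y]; first by exists y.
have {}ng y : e x y -> ~~ good y by move=> exy; have := ng y; rewrite exy.
have [f [vf fx fS]] := remove1 xS.
have [c c1] : exists c, cdeg f c x <= 1.
  have [le|gt] := leqP (cdeg f false x) 1; [by exists false | exists true].
  rewrite -(leq_add2l 2); apply: leq_trans d3; apply: leq_trans (cdeg_total f x).
  by rewrite leq_add2r.
case: (one_nbr c1) => [h|[p [exp fp h]]].
  case: (@finish1 f (upd f x (Some c)) x c) => //.
  - by move=> t tx; rewrite upd_other.
  - exact: upd_same.
  - exact: valid_add0.
have [|g [vg gx gN _]] := place (c := c) vf fx exp.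
  by move=> t ext ft; split; [exact: h | exact: ng].
by case: (@finish1 f g x c).
Qed.

Lemma unit_absorbs x U : U \in items x -> is_unit x U -> absorbs x U.
Proof.
move=> Ui /orP[|uB] f c vf fx lt; first by move/(simple_unit_absorbs Ui); apply.
have [|g [vg gx gr le]] := tight_unit_colour Ui uB vf fx; first by left.
exists g; split=> //; apply: leq_trans le _.
by rewrite -addn1 leq_add2l leq_b1.
Qed.

Lemma items0 x U : U \in items x -> exists w, w \in U.
Proof. by case/imsetP=> w; rewrite inE => exw ->; exists w; rewrite item_refl. Qed.

(** When [U] is erased, [x] has to be saturated, since otherwise [U] could be restored; and each
    other item contains at most one neighbour in the colour of [x]. A tight unit can even be
    restored at a saturated [x] of colour [false], so there the colour is [true] and the count is 4
    + 1. *)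
Lemma unit_items x U : U \in items x -> is_unit x U ->
  4 <= #|items x| /\ (tight_unit U -> 5 <= #|items x|).
Proof.
move=> Ui uU; have [w wU] := items0 Ui; have [exw _] := items_mem Ui wU.
have [f [vf fU fS]] := remove (edgeS exw) wU.
have xU := item_notin Ui.
have xS := eS exw.
case fx: (f x) (fS x xS xU) => [c|//] _.
have fin g : valid g -> grows f g U -> False.
  move=> vg gr; apply: (no_colouring vg) => t tS; apply: gr.
  by have [tU|tU] := boolP (t \in U); rewrite ?orbT // fS.
have sat : cap c <= cdeg f c x.
  rewrite leqNgt; apply/negP => lt.
  by have [g [vg _ gr _]] := unit_absorbs Ui uU vf fx lt; apply: fin gr.
have le := @cdeg_items f x c [set U] vf fx.
have {}le : cdeg f c x + 1 <= #|items x|.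
  rewrite -(cards1 U); apply: le; first by rewrite sub1set.
  by move=> V v; rewrite inE => /eqP-> /fU ->.
have le2 := leq_trans (leq_add sat (leqnn 1)) le; split.
  by apply: leq_trans le2; rewrite addn1 ltnS /cap leq_addr.
move=> uB; suff cT : c = true by rewrite cT in le2.
apply/negbNE/negP => /negbTE cF.
have [|g [vg _ gr _]] := tight_unit_colour Ui uB vf fx; first by right.
exact: fin gr.
Qed.

Lemma pair2_split x U : U \in items x -> pair2 U -> exists q z,
  [/\ U = [set q; z], e x q, e x z, e q z & [/\ deg q = 2, good z & q != z]].
Proof.
move=> Ui /andP[U2 /existsP[q /andP[qU /eqP dq]]].
have gz z : e q z -> good z by move=> eqz; apply: nbr_good_deg2 eqz dq.
case: (itemsP Ui) U2 qU => [[w [-> _ _]]|]; first by rewrite cards1.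
move=> [w [v [-> wv exw exv ewv]]] _.
rewrite !inE => /orP[]/eqP E; subst q.
  by exists w, v; split=> //; split=> //; apply: gz.
have evw : e v w by rewrite e_sym.
by exists v, w; split=> //; [exact: setUC | split; rewrite ?gz // eq_sym].
Qed.

(** With [q] erased, equal colours on [x] and [z] would leave the other colour to [q]. So only [x]
    has the colour of [x] among the neighbours of [q], and it must be saturated by neighbours in
    other items. *)
Lemma pair2_items x U : U \in items x -> pair2 U -> 4 <= #|items x|.
Proof.
move=> Ui tU; have [q [z [UE exq exz eqz [dq gz qz]]]] := pair2_split Ui tU.
have [f [vf fq fS]] := remove1 (eS eqz).
have eqx : e q x by rewrite e_sym.
have [r [eqr rx h]] := nbr2 dq eqx.
have {r eqr rx h}hq t : e q t -> (t == x) || (t == z).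
  have zx : z != x by rewrite eq_sym edge_neq.
  by move=> /h; have := h z eqz; rewrite (negbTE zx) /= => /eqP<-.
have fx : f x != None by apply: fS (eS exq) _; rewrite edge_neq.
case fxE: (f x) fx => [c|//] _.
have fz : f z <> Some c.
  move=> fz; case: (@finish1 f (upd f q (Some (~~ c))) q (~~ c)) => //.
  - by move=> t tx; rewrite upd_other.
  - exact: upd_same.
  - by apply: valid_add0 => // t /hq/orP[]/eqP->; rewrite ?fxE ?fz => -[]; case: (c).
have sat : cap c <= cdeg f c x.
  rewrite leqNgt; apply/negP => lt.
  case: (@finish1 f (upd f q (Some c)) q c) => //.
  - by move=> t tx; rewrite upd_other.
  - exact: upd_same.
  - apply: (@valid_add _ _ _ x) => // t /hq/orP[]/eqP-> //.
have := @cdeg_items f x c [set U] vf fxE; rewrite sub1set cards1 => le.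
have {}le : cdeg f c x + 1 <= #|items x|.
  apply: le => // V v; rewrite inE => /eqP->.
  by rewrite UE !inE => /orP[]/eqP->; rewrite ?fq.
by apply: leq_trans le; rewrite addn1 ltnS (leq_trans _ sat) // leq_addr.
Qed.

(** * Configurations excluded around a vertex *)

Definition units x : {set {set T}} := [set U in items x | is_unit x U].
Definition others x : {set T} := nbr x :\: cover (units x).

Definition base x f : Prop := [/\ valid f, f x = None,
  forall w, w \in cover (units x) -> f w = None &
  forall t, t \in S -> t != x -> t \notin cover (units x) -> f t != None].

Lemma base_ex x : x \in S -> exists f, base x f.
Proof.
move=> xS; have xX : x \in x |: cover (units x) by rewrite !inE eqxx.
have [f [vf fX fS]] := remove xS xX; exists f; split=> //.
- exact: fX.
- by move=> w wU; apply: fX; rewrite inE wU orbT.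
- by move=> t tS tx tU; apply: fS; rewrite // inE negb_or tU inE tx.
Qed.

Lemma others_colour x f t : base x f -> t \in others x -> f t != None.
Proof.
case=> _ _ _ fS; rewrite !inE => /andP[tU ext]; apply: fS => //.
  exact: edgeS ext.
by rewrite eq_sym edge_neq.
Qed.

Lemma base_nbr x f t c : base x f -> e x t -> f t = Some c -> t \in others x.
Proof.
case=> _ _ fU _ ext ft; rewrite !inE ext andbT.
by apply/negP => /fU; rewrite ft.
Qed.

Lemma mem_cover_units x t : (t \in cover (units x)) =
  has (fun U => t \in U) (enum (units x)).
Proof.
apply/bigcupP/hasP => -[U]; first by move=> Uu tU; exists U; rewrite ?mem_enum.
by rewrite mem_enum => Uu tU; exists U.
Qed.

(** The units are restored last, and each raises the colour degree of [x] by at most one. *)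
Lemma close x g c : valid g -> g x = Some c ->
  (forall t, t \in S -> t \notin cover (units x) -> g t != None) ->
  cdeg g c x + #|units x| <= cap c -> False.
Proof.
move=> vg gx gS le.
have [||||h [vh _ ha _]] := @absorbs_list x (enum (units x)) g c.
- by move=> U; rewrite mem_enum inE => /andP[Ui uU]; apply: unit_absorbs.
- by [].
- by [].
- by rewrite -cardE.
apply: (no_colouring vh) => t tS; apply: ha; rewrite -mem_cover_units.
by have [tU|tU] := boolP (t \in _); rewrite ?orbT // gS.
Qed.

Lemma close_iso x f c : base x f -> (forall t, t \in others x -> f t <> Some c) ->
  #|units x| <= cap c -> False.
Proof.
move=> bf h le; have [vf fx fU fS] := bf.
have h' t : e x t -> f t <> Some c.
  by move=> ext ft; apply: (h t (base_nbr bf ext ft)).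
apply: (@close x (upd f x (Some c)) c).
- exact: valid_add0.
- exact: upd_same.
- move=> t tS tU; rewrite /upd; case: (t =P x) => // /eqP tx; exact: fS.
- rewrite cdeg0 // => t ext; rewrite upd_other ?h' //; first exact: h'.
  by rewrite eq_sym edge_neq.
Qed.

Lemma close_leaf x f c p : base x f ->
  (forall t, t \in others x -> f t = Some c -> t = p) ->
  cdeg f c p < cap c -> #|units x| < cap c -> False.
Proof.
move=> bf h lt le; have [vf fx fU fS] := bf.
have h' t : e x t -> f t = Some c -> t = p.
  by move=> ext ft; apply: (h t) => //; apply: base_nbr bf ext ft.
apply: (@close x (upd f x (Some c)) c).
- by apply: (@valid_add _ _ _ p) => // t ext ft; split=> //; apply: h'.
- exact: upd_same.
- move=> t tS tU; rewrite /upd; case: (t =P x) => // /eqP tx; exact: fS.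
- rewrite -(add1n #|_|) in le; apply: leq_trans le; rewrite leq_add2r.
  apply: (@cdeg1 _ _ _ p) => t ext; rewrite upd_other; first exact: h'.
  by rewrite eq_sym edge_neq.
Qed.

Lemma close_place x f c p : base x f -> p \in others x -> ~~ good p ->
  (forall t, t \in others x -> f t = Some c -> t = p) ->
  #|units x| < cap c -> False.
Proof.
move=> bf po gp h le; have [vf fx fU fS] := bf.
have exp : e x p by move: po; rewrite !inE => /andP[].
have h' t : e x t -> f t = Some c -> t = p.
  by move=> ext ft; apply: (h t) => //; apply: base_nbr bf ext ft.
have [|g [vg gx gN gch]] := place (c := c) vf fx exp.
  by move=> t ext ft; split=> //; apply: h'.
apply: (@close x g c) => //.
- move=> t tS tU; have [->|tx] := eqVneq t x; first by rewrite gx.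
  by rewrite gN // fS.
- rewrite -(add1n #|_|) in le; apply: leq_trans le; rewrite leq_add2r.
  apply: (@cdeg1 _ _ _ p) => t ext gt.
  case: (gch t) => [gf|[tx|[[->//]|[_ _ _ [_ /negP[]]] //]]].
    by apply: h' => //; rewrite -gf.
  by rewrite tx e_irr in ext.
Qed.

Lemma ext_le1 x : x \in S -> #|others x| <= 1 -> #|units x| <= 3 -> False.
Proof.
move=> xS o1 u3; have [f bf] := base_ex xS.
have le c : #|units x| <= cap c by apply: leq_trans u3 _; rewrite leq_addr.
have [o0|/set0Pn[p po]] := eqVneq (others x) set0.
  by apply: (@close_iso x f true) => // t; rewrite o0 inE.
have op t : t \in others x -> t = p.
  by move=> to; move/card_le1_eqP: o1 => h; apply: h.
case fp: (f p) (others_colour bf po) => [c|//] _.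
apply: (@close_iso x f (~~ c)) => // t /op->; rewrite fp => -[]; by case: (c).
Qed.

(** If the other vertex shares the colour of [p], then [x] takes the opposite colour. Otherwise [x]
    takes the colour of [p], which can be relieved. *)
Lemma ext_pair x p : x \in S -> #|others x| <= 2 -> p \in others x -> ~~ good p ->
  #|units x| <= 2 -> False.
Proof.
move=> xS o2 po gp u2; have [f bf] := base_ex xS.
have lt c : #|units x| < cap c by apply: leq_ltn_trans u2 _; case: c.
case fp: (f p) (others_colour bf po) => [c|//] _.
have [/existsP[r /andP[ro /andP[rp /eqP fr]]]|/existsPn no] :=
    boolP [exists r, (r \in others x) && ((r != p) && (f r == Some c))]; last first.
  apply: (@close_place x f c p) => // t to ft; apply/eqP.
  by have := no t; rewrite to ft eqxx andbT negbK.
have oE t : t \in others x -> (t == p) || (t == r).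
  move=> to; apply: contraLR o2; rewrite negb_or -ltnNge => /andP[tp tr].
  have <- : #|[set p; r; t]| = 3.
    by rewrite setUC cardsU1 !inE cards2 (negbTE tp) (negbTE tr) eq_sym rp.
  apply/subset_leq_card/subsetP => s; rewrite in_setU in_set2 in_set1.
  by move=> /orP[/orP[]|]/eqP->.
apply: (@close_iso x f (~~ c)) => //; last exact: ltnW.
by move=> t /oE/orP[]/eqP->; rewrite ?fp ?fr => -[]; case: (c).
Qed.

Lemma cdeg_others x f c : base x f ->
  #|[set t in others x | f t == Some c]| = cdeg f c x.
Proof.
move=> bf; apply: eq_card => t; rewrite !inE; case ext: (e x t); rewrite ?andbF //= andbT.
case ft: (f t == Some c); rewrite ?andbF // andbT.
by have := base_nbr bf ext (eqP ft); rewrite !inE => /andP[].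
Qed.

(** Again some colour occurs at most once among three vertices, and the vertex that has it can be
    relieved. *)
Lemma ext_not_good x : x \in S -> #|others x| <= 3 ->
  (forall p, p \in others x -> ~~ good p) -> #|units x| <= 2 -> False.
Proof.
move=> xS o3 ng u2; have [f bf] := base_ex xS.
have lt c : #|units x| < cap c by apply: leq_ltn_trans u2 _; case: c.
have [c c1] : exists c, cdeg f c x <= 1.
  have [le|gt] := leqP (cdeg f false x) 1; [by exists false | exists true].
  rewrite -(leq_add2l 2); apply: leq_trans o3.
  apply: leq_trans (_ : cdeg f false x + cdeg f true x <= _).
    by rewrite leq_add2r.
  rewrite -!cdeg_others // cards_disjoint.
    by apply/subset_leq_card/subsetP => t; rewrite !inE => /orP[]/andP[].
  by apply/setP => t; rewrite !inE; case: (f t) => [[]|] /=; rewrite ?andbF.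
case: (one_nbr c1) => [h|[p [exp fp h]]].
  apply: (@close_iso x f c) => //; last exact: ltnW.
  by move=> t; rewrite !inE => /andP[_]; apply: h.
have po := base_nbr bf exp fp.
apply: (@close_place x f c p) => //; first exact: ng.
by move=> t; rewrite !inE => /andP[_]; apply: h.
Qed.

(** The two vertices of [U] have different colours, since otherwise a colour is free for [x]. The
    one coloured [true] is saturated, since otherwise [x] could be a leaf at it. Its four [true]
    neighbours, [x] and the other vertex of [U] give degree 6, and these four lie in four items
    besides that of [x]. *)
Lemma ext_triangle x U : U \in items x -> #|U| = 2 -> others x = U ->
  #|units x| <= 3 -> exists p, [/\ p \in U, good p & 5 <= #|items p|].
Proof.
move=> Ui U2 oU u3.
case: (itemsP Ui) => [[w [UE _ _]]|[u [v [UE uv exu exv euv]]]].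
  by rewrite UE cards1 in U2.
have xS := eS exu; have [f bf] := base_ex xS; have [vf fx _ _] := bf.
have uo : u \in others x by rewrite oU UE !inE eqxx.
have vo : v \in others x by rewrite oU UE !inE eqxx orbT.
have oE t : t \in others x -> (t == u) || (t == v) by rewrite oU UE !inE.
suff main p1 p2 : e x p1 -> e x p2 -> e p1 p2 -> p2 \in U ->
    (forall t, t \in others x -> (t == p1) || (t == p2)) ->
    f p1 = Some false -> f p2 = Some true ->
    exists p, [/\ p \in U, good p & 5 <= #|items p|].
  case fu: (f u) (others_colour bf uo) => [c|//] _.
  case fv: (f v) (others_colour bf vo) => [d|//] _.
  have [cd|cd] := eqVneq c d.
    case: (@close_iso x f (~~ c)) => //.
      by move=> t /oE/orP[]/eqP->; rewrite ?fu ?fv -?cd => -[]; case: (c).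
    by apply: leq_trans u3 _; rewrite leq_addr.
  case: c d fu fv cd => [] [] // fu fv _.
    apply: (main v u) => //; first by rewrite e_sym.
      by rewrite UE !inE eqxx.
    by move=> t /oE; rewrite orbC.
  by apply: (main u v) => //; rewrite UE !inE eqxx orbT.
move=> exp1 exp2 ep12 p2U oE' f1 f2; exists p2.
have ep2x : e p2 x by rewrite e_sym.
have ep21 : e p2 p1 by rewrite e_sym.
have sat : 4 <= cdeg f true p2.
  rewrite leqNgt; apply/negP => lt; apply: (@close_leaf x f true p2) => //.
  by move=> t /oE'/orP[]/eqP-> //; rewrite f1.
split=> //.
  rewrite /good; apply/orP; left; apply: leq_trans (_ : cdeg f true p2 + (1 + 1) <= _).
    by rewrite addn2 !ltnS.
  rewrite -{1}(cards1 x) -(cards1 p1) /cdeg !cards_disjoint.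
  - apply/subset_leq_card/subsetP => t; rewrite !inE.
    by move=> /orP[/andP[]//|/orP[]/eqP->].
  - apply/setP => t; rewrite !inE; apply/negbTE/negP.
    by move=> /andP[/andP[_ ft] /orP[]/eqP tE]; rewrite tE ?fx ?f1 in ft.
  - apply/setP => t; rewrite !inE; apply/negbTE/negP.
    by move=> /andP[/eqP-> /eqP xp1]; rewrite xp1 e_irr in exp1.
have := @cdeg_items f p2 true [set item p2 x] vf f2.
rewrite sub1set item_in // cards1 => le.
apply: leq_trans (le isT _); first by rewrite addn1 ltnS.
move=> V w; rewrite inE => /eqP->; rewrite !inE => /andP[ep2w /orP[/eqP->|exw]].
  by rewrite fx.
suff -> : w = p1 by rewrite f1.
by apply: (item_mate ep2x ep21 exp1).
Qed.

Lemma keys_dec x (us : seq {set T}) f :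
  {in us, forall U, U \in items x /\ simple_unit x U} ->
  (exists U P K k, [/\ U \in us, unit_spec x U P K, k \in K & f k <> Some false]) \/
  {in us, forall U, U \in items x /\ exists P K, unit_spec x U P K /\
     forall k, k \in K -> f k = Some false}.
Proof.
elim: us => [|U us IHus] h; first by right.
case: IHus => [V Vus|[V [P [K [k [Vus sp kK fk]]]]]|h'].
- by apply: h; rewrite inE Vus orbT.
- by left; exists V, P, K, k; split=> //; rewrite inE Vus orbT.
have [Ui uU] := h U (mem_head _ _); have [P [K sp]] := simple_unit_spec Ui uU.
have [/existsP[k /andP[kK /eqP fk]]|/existsPn no] :=
    boolP [exists k, (k \in K) && (f k != Some false)].
  by left; exists U, P, K, k; split=> //; rewrite mem_head.
right=> V; rewrite inE => /orP[/eqP->|]; last exact: h'.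
split=> //; exists P, K; split=> // k kK; apply/eqP.
by have := no k; rewrite kK /= negbK.
Qed.

(** With [x] coloured [false], restoring a unit changes no [false] vertex outside it. The keys of
    the remaining units are not adjacent to [x], hence not in that unit, and stay [false]. *)
Lemma free_list x (us : seq {set T}) f :
  {in us, forall U, U \in items x /\ exists P K, unit_spec x U P K /\
     forall k, k \in K -> f k = Some false} ->
  valid f -> f x = Some false ->
  exists g, [/\ valid g, g x = Some false & colours_all f g us].
Proof.
elim: us f => [|U us IHus] f h vf fx; first by exists f; split=> // t; rewrite orbF.
have [Ui [P [K [sp fK]]]] := h U (mem_head _ _).
have [k kK] := set0Pn _ (us_K0 sp).
have [|g [vg st gr _ gfalse]] := us_free sp vf fx kK; first by rewrite fK.
have [|g' [vg' gx' ga]] := IHus g _ vg (spec_at Ui sp st fx).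
  move=> V Vus; have [|Vi [P' [K' [sp' fK']]]] := h V; first by rewrite inE Vus orbT.
  split=> //; exists P', K'; split=> // k' k'K; apply: gfalse => //; last exact: fK'.
  apply/negP => k'U; have [exk' _] := items_mem Ui k'U.
  have := us_P sp' (subsetP (us_K sp') _ k'K).
  by rewrite exk' => -[].
exists g'; split=> // t /or3P[ht|ht|ht]; apply: ga; apply/orP; [left|left|right];
by rewrite // gr // ht ?orbT.
Qed.

Lemma tight_unit_list x (us : seq {set T}) f :
  {in us, forall U, U \in items x /\ tight_unit U} -> valid f -> f x = Some false ->
  exists g, [/\ valid g, g x = Some false & colours_all f g us].
Proof.
elim: us f => [|U us IHus] f h vf fx; first by exists f; split=> // t; rewrite orbF.
have [Ui uB] := h U (mem_head _ _).
have [|g [vg gx gr _]] := tight_unit_colour Ui uB vf fx; first by right.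
have [|g' [vg' gx' ga]] := IHus g _ vg gx.
  by move=> V Vus; apply: h; rewrite inE Vus orbT.
exists g'; split=> // t /or3P[ht|ht|ht]; apply: ga; apply/orP; [left|left|right];
by rewrite // gr // ht ?orbT.
Qed.

(* If some key is not coloured [false], then [x] can be coloured [true] with
   one unit at no cost; otherwise every unit is free once [x] is coloured
   [false]. *)
Lemma ext_units x : x \in S -> #|others x| <= 1 ->
  (forall p, p \in others x -> deg p = 3) -> #|others x| + #|units x| <= 5 -> False.
Proof.
move=> xS o1 d3 le5; have [f bf] := base_ex xS; have [vf fx fU fS] := bf.
pose wa := [seq U <- enum (units x) | simple_unit x U].
have waP : {in wa, forall U, U \in items x /\ simple_unit x U}.
  by move=> U; rewrite mem_filter mem_enum inE => /and3P[].
have oE p t : p \in others x -> t \in others x -> t = p.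
  by move=> po to; move/card_le1_eqP: o1 => h; apply: h.
case: (keys_dec f waP) => [[U [P [K [k [Uwa sp kK fk]]]]]|keys].
  have Uu : U \in units x by move: Uwa; rewrite mem_filter mem_enum => /andP[].
  have [Ui uU] := waP U Uwa.
  have [vg gx] : valid (upd f x (Some true)) /\ upd f x (Some true) x = Some true.
    split; last exact: upd_same.
    have [o0|/set0Pn[p po]] := eqVneq (others x) set0.
      by apply: valid_add0 => // t ext ft; have := base_nbr bf ext ft; rewrite o0 inE.
    apply: (@valid_add _ _ _ p) => // t ext ft.
    split; first exact: oE (base_nbr bf ext ft).
    by apply: leq_ltn_trans (cdeg_deg _ _ _) _; rewrite d3.
  have kx : k != x.
    by have [] := us_P sp (subsetP (us_K sp) _ kK).
  set g := upd f x (Some true) in vg gx.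
  have gk : g k <> Some false by rewrite /g upd_other.
  have [h [vh st gr le _]] := us_free sp vg gx kK gk.
  have hx := spec_at Ui sp st gx.
  have [||||h' [vh' _ ha _]] := @absorbs_list x (enum (units x :\ U)) h true.
  - by move=> V; rewrite mem_enum !inE => /and3P[_ Vi uV]; apply: unit_absorbs.
  - by [].
  - by [].
  (* The unit [U] was free, so the vertices of [others x] and the remaining units number at most 4,
     the capacity of [true]. *)
  - rewrite -cardE -ltnS -addnS; apply: leq_trans le5.
    have -> : #|units x| = #|units x :\ U|.+1 by rewrite (cardsD1 U) Uu.
    rewrite leq_add2r; apply: leq_trans le _; apply/subset_leq_card/subsetP => t.
    rewrite inE in_nbr => /andP[ext]; rewrite /g upd_other; last first.
      by rewrite eq_sym edge_neq.
    by move=> /eqP; apply: base_nbr.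
  apply: (no_colouring vh') => t tS; apply: ha; apply/orP.
  have [tU|tU] := boolP (t \in U); first by left; apply: gr; rewrite tU orbT.
  have [tc|tc] := boolP (t \in cover (units x)).
    right; case/bigcupP: tc => V Vu tV; apply/hasP; exists V => //.
    rewrite mem_enum !inE; move: Vu; rewrite inE => ->.
    by rewrite andbT; apply: contraNneq tU => <-.
  left; apply: gr; rewrite /g /upd; case: (t =P x) => // /eqP tx.
  by rewrite fS.
have [/existsP[p /andP[po /eqP fp]]|/existsPn no] :=
    boolP [exists p, (p \in others x) && (f p == Some false)].
  apply: (@close_iso x f true) => //.
    by move=> t to; rewrite (oE p t po to) fp.
  rewrite -ltnS; apply: leq_trans le5; rewrite -add1n leq_add2r.
  by apply/card_gt0P; exists p.
have vg : valid (upd f x (Some false)).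
  apply: valid_add0 => // t ext ft; have to := base_nbr bf ext ft.
  by have := no t; rewrite to ft eqxx.
have [||g1 [vg1 g1x ga1]] := @free_list x wa _ _ vg.
- move=> U Uwa; have [Ui [P [K [sp fK]]]] := keys U Uwa; split=> //.
  exists P, K; split=> // k kK; rewrite upd_other ?fK //.
  by have [] := us_P sp (subsetP (us_K sp) _ kK).
- exact: upd_same.
have [|||h [vh hx ha]] := @tight_unit_list x [seq U <- enum (units x) | ~~ simple_unit x U] g1.
- move=> U; rewrite mem_filter mem_enum inE => /and3P[nW Ui].
  by rewrite /is_unit (negbTE nW).
- by [].
- by [].
apply: (no_colouring vh) => t tS; apply: ha.
have [tc|tc] := boolP (t \in cover (units x)); last first.
  rewrite ga1 // /upd; case: (t =P x) => // /eqP tx.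
  by rewrite fS.
case/bigcupP: tc => U Uu tU; have [uU|uU] := boolP (simple_unit x U).
  rewrite ga1 //; apply/orP; right; apply/hasP; exists U => //.
  by rewrite mem_filter uU mem_enum.
apply/orP; right; apply/hasP; exists U => //.
by rewrite mem_filter uU mem_enum.
Qed.

(** * Discharging *)

Definition mates x w : {set T} := item x w :\ w.

(* The charge sent by [x] to [w]. *)
Definition flow x w : nat :=
  if ~~ (good x && e x w) then 0
  else if deg w == 2 then (#|item x w| == 1).*2
  else if deg w == 3 then
    if simple_unit x (item x w) then 2
    else if [forall m in mates x w, deg m == 3] then 1
    else if [forall m in mates x w, ~~ good m] || (5 <= #|items x|) then 2
    else if [exists m in mates x w, 5 <= #|items m|] then 0 else 1
  else if pair2 (item x w) && tight w then 2 else 0.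

Lemma not_good_deg x : deg x < 5 -> ~~ good x.
Proof. by move=> lt; apply/negP => /good_deg; rewrite leqNgt lt. Qed.

Lemma item_single x w : e x w -> (forall z, e x z -> ~~ e w z) -> item x w = [set w].
Proof.
move=> exw no; apply/setP => t; rewrite !inE; have [->|tw] := eqVneq t w.
  by rewrite exw.
by case ext: (e x t) => //=; apply/negbTE/no.
Qed.

Lemma item_pair x w z : e x w -> e x z -> e w z -> item x w = [set w; z].
Proof.
move=> exw exz ewz; apply/setP => t; rewrite !inE.
apply/andP/orP => [[ext /orP[->|ewt]]|[/eqP->|/eqP->]]; rewrite ?exw ?exz ?eqxx ?ewz ?orbT //.
  by left.
by right; rewrite (item_mate exw exz ewz ext ewt).
Qed.

Lemma mates_single x w : e x w -> (forall z, e x z -> ~~ e w z) -> mates x w = set0.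
Proof. by move=> exw no; rewrite /mates item_single // setDv. Qed.

Lemma mates_pair x w z : e x w -> e x z -> e w z -> mates x w = [set z].
Proof.
move=> exw exz ewz; rewrite /mates (item_pair exw exz ewz).
apply/setP => t; rewrite !inE; have [->|] //= := eqVneq t w.
by rewrite (negbTE (edge_neq ewz)).
Qed.

(** Deleting a vertex of degree 2 on a triangle lowers 12 |H| + t by 12 + 6 and 4 d only by 16, so
    the deletion helps the inequality. Two such vertices are never adjacent, because neighbours of
    vertices of degree 2 are good. *)
Definition ears : {set T} := [set q in S | (deg q == 2) &&
  [exists x, e q x && [exists z, e q z && e x z]]].
Definition H : {set T} := S :\: ears.
Definition in_tri x w : bool := [exists z in H, e x z && e w z].

Lemma deg2_nbr_good x y : deg x = 2 -> e y x -> good y.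
Proof. by move=> dx eyx; apply: (@nbr_good_deg2 x) => //; rewrite e_sym. Qed.

Lemma mem_H x : x \in S -> deg x != 2 -> x \in H.
Proof. by move=> xS /negbTE dx; rewrite !inE xS dx. Qed.

Lemma mem_H_single x w : e x w -> (forall z, e x z -> ~~ e w z) -> w \in H.
Proof.
move=> exw no; rewrite !inE (edgeS exw) andbT negb_and.
have [dw|//] := eqVneq (deg w) 2; apply/existsPn => y; apply/negP.
move=> /andP[ewy /existsP[z /andP[ewz eyz]]].
have ewx : e w x by rewrite e_sym.
have [r [_ _ h]] := nbr2 dw ewx.
have yz := edge_neq eyz.
case/orP: (h y ewy) => /eqP yE; case/orP: (h z ewz) => /eqP zE; subst y.
- by rewrite zE eqxx in yz.
- by have := no z eyz; rewrite ewz.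
- by subst z; have := no r; rewrite e_sym eyz => /(_ isT); rewrite ewy.
- by rewrite zE eqxx in yz.
Qed.

(* Bounds from below what [U] adds to the final charge of [x], to be at least 12. *)
Definition worth x U : nat :=
  if is_unit x U then 2 else if single3 x U then 3 else if #|U| == 1 then 4
  else if pair2 U then (if tight x then 6 else 4) else 6 - \sum_(w in U) flow x w.

Lemma tight_good x : tight x -> good x. Proof. by case/and4P. Qed.

Lemma not_simple_unit_deg2 x U : pair2 U -> ~~ simple_unit x U.
Proof.
move=> /andP[/eqP U2 /existsP[q /andP[qU /eqP dq]]].
rewrite /simple_unit U2 /=; apply/negP => /andP[/forallP/(_ q)].
by rewrite qU dq.
Qed.

Lemma tight_not_tight_unit x U : U \in items x -> tight_unit U -> ~~ tight x.
Proof.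
move=> Ui uB; apply/negP => /and4P[_ /eqP I4 _ _].
have [|_ /(_ uB)] := unit_items Ui; first by rewrite /is_unit uB orbT.
by rewrite I4.
Qed.

Lemma flow_big x w : 3 < deg w -> ~~ pair2 (item x w) -> flow x w = 0.
Proof.
move=> dw nT; rewrite /flow (negbTE nT) /=; case: ifP => // _.
by rewrite !gtn_eqF // ltnW.
Qed.

(** Two vertices of degree 3 receive 1 each. If there is just one, it is entitled to 2; but when [x]
    has at most four items a good partner relieves [x], of everything if it has at least five items
    itself, of one half otherwise. *)
Lemma flow_pair x u v : good x -> e x u -> e x v -> e u v ->
  ~~ pair2 [set u; v] -> ~~ is_unit x [set u; v] ->
  [/\ flow x u + flow x v <= 2,
      good u || good v -> #|items x| <= 4 -> flow x u + flow x v <= 1 &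
      forall p, p \in [set u; v] -> good p -> 5 <= #|items p| ->
        #|items x| <= 4 -> flow x u + flow x v = 0].
Proof.
move=> gx exu exv euv nT nU.
wlog le : u v exu exv euv nT nU / deg u <= deg v.
  move=> W; case/orP: (leq_total (deg u) (deg v)) => le; first exact: W.
  have [|||h1 h2 h3] := W v u exv exu _ _ _ le; rewrite 1?e_sym 1?setUC //.
  by split; rewrite addnC // 1?orbC // => p; rewrite setUC; apply: h3.
have evu : e v u by rewrite e_sym.
have iu : item x u = [set u; v] by apply: item_pair.
have iv : item x v = [set u; v] by rewrite setUC; apply: item_pair.
have u2 : deg u != 2.
  apply: contra nT => du; rewrite /pair2 cards2 edge_neq //=.
  by apply/existsP; exists u; rewrite !inE eqxx.
have du2 := deg_ge2 (edgeS exu).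
have du3 : 2 < deg u by rewrite ltn_neqAle eq_sym u2.
have nW : ~~ simple_unit x [set u; v] by apply: contra nU; rewrite /is_unit => ->.
have [du|du] := eqVneq (deg u) 3; last first.
  have du4 : 3 < deg u by rewrite ltn_neqAle eq_sym du.
  by rewrite !flow_big ?iu ?iv // (leq_trans du4).
have fu : flow x u = if deg v == 3 then 1
    else if ~~ good v || (5 <= #|items x|) then 2
    else if 5 <= #|items v| then 0 else 1.
  rewrite /flow gx exu du /= iu (negbTE nW) (mates_pair exu exv euv).
  have fs (P : pred T) : [forall m in [set v], P m] = P v.
    apply/forallP/idP => [/(_ v)|Pv m]; rewrite inE ?eqxx //.
    by apply/implyP => /eqP->.
  have es (P : pred T) : [exists m in [set v], P m] = P v.
    apply/existsP/idP => [[m]|Pv]; first by rewrite inE => /andP[/eqP->].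
    by exists v; rewrite inE eqxx.
  by rewrite !fs es.
have [dv|dv] := eqVneq (deg v) 3.
  have gu : ~~ good u by apply: not_good_deg; rewrite du.
  have gv : ~~ good v by apply: not_good_deg; rewrite dv.
  have fv : flow x v = 1.
    rewrite /flow gx exv dv /= iv (negbTE nW) (mates_pair exv exu evu).
    case: forallP => // -[] m; rewrite inE; apply/implyP => /eqP->.
    by rewrite du.
  rewrite fu fv dv eqxx; split=> //.
    by rewrite (negbTE gu) (negbTE gv).
  by move=> p; rewrite !inE => /orP[]/eqP->; rewrite ?(negbTE gu) ?(negbTE gv).
rewrite (negbTE dv) in fu.
have dv4 : 3 < deg v by rewrite ltn_neqAle eq_sym dv -du.
have fv : flow x v = 0 by apply: flow_big; rewrite ?iv.
have gu : ~~ good u by apply: not_good_deg; rewrite du.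
have nI : #|items x| <= 4 -> (5 <= #|items x|) = false.
  by move=> I4; rewrite leqNgt ltnS I4.
rewrite fv addn0 fu; split.
- by case: ifP => // _; case: ifP.
- by rewrite (negbTE gu) /= => -> /nI->; case: ifP.
- move=> p; rewrite !inE => /orP[]/eqP->; first by rewrite (negbTE gu).
  by move=> -> -> /nI->.
Qed.

(** Each neighbour in [H] brings 4. A pair inside [H] loses 2 for the two edges of its triangle at
    [x]. If a pair has a vertex of degree 2, this vertex is not in [H], so that the triangle
    disappears and one neighbour is left. *)
Lemma item_val x U : good x -> U \in items x ->
  \sum_(w in U :&: H) (in_tri x w + flow x w) + worth x U <=
  \sum_(w in U :&: H) (4 + flow w x).
Proof.
move=> gx Ui; case: (itemsP Ui) => [[w [UE exw no]]|[u [v [UE uv exu exv euv]]]].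
  have wH := mem_H_single exw no.
  have -> : U :&: H = [set w].
    by rewrite UE; apply/setIidPl; rewrite sub1set.
  rewrite !big_set1.
  have -> : in_tri x w = false.
    apply/negbTE/existsPn => z; apply/negP => /and3P[_ exz ewz].
    by have := no z exz; rewrite ewz.
  rewrite add0n; apply: leq_trans (leq_addr _ _).
  have iw : item x w = [set w] by apply: item_single.
  rewrite /worth UE cards1 /= /is_unit.
  have nT : pair2 [set w] = false by rewrite /pair2 cards1.
  rewrite /tight_unit nT orbF.
  rewrite /flow gx exw /= iw cards1 nT /= mates_single //.
  have -> : [forall m in set0, deg m == 3] by apply/forallP => m; rewrite inE.
  have [dw|dw] := eqVneq (deg w) 2.
    suff -> : simple_unit x [set w] by [].
    rewrite /simple_unit cards1 /= orbF; apply/forallP => y; rewrite inE.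
    by apply/implyP => /eqP->; rewrite dw.
  rewrite /single3 cards1 /=.
  have -> : [forall p in [set w], deg p == 3] = (deg w == 3).
    apply/forallP/idP => [/(_ w)|dw3 m]; rewrite inE ?eqxx //.
    by apply/implyP => /eqP->.
  have [dw3|dw3] := eqVneq (deg w) 3; case uW: (simple_unit x [set w]) => //=.
have evu : e v u by rewrite e_sym.
have [TU|nT] := boolP (pair2 U).
  have [q [z [UE' exq exz eqz [dq gz qz]]]] := pair2_split Ui TU.
  have zH : z \in H.
    by apply: mem_H (edgeS exz) _; rewrite gtn_eqF // (leq_trans _ (good_deg gz)).
  have qH : q \notin H.
    rewrite !inE dq eqxx (edgeS exq) /= andbT negbK; apply/existsP; exists x.
    rewrite e_sym exq; apply/existsP; exists z; rewrite eqz.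
    by rewrite exz.
  have -> : U :&: H = [set z].
    apply/setP => t; rewrite UE' in_setI in_set2 in_set1.
    have [->|tq] := eqVneq t q; first by rewrite (negbTE qH) andbF (negbTE qz).
    by have [->|] := eqVneq t z.
  rewrite !big_set1.
  have eqx : e q x by rewrite e_sym.
  have ezx : e z x by rewrite e_sym.
  have ezq : e z q by rewrite e_sym.
  have iz : item x z = U by rewrite UE' setUC; apply: item_pair.
  have -> : in_tri x z = false.
    apply/negbTE/existsPn => t; apply/negP => /and3P[tH ext ezt].
    by move: qH; rewrite -(item_mate exz exq ezq ext ezt) tH.
  have dz2 : (deg z == 2) = false by rewrite gtn_eqF // (leq_trans _ (good_deg gz)).
  have dz3 : (deg z == 3) = false by rewrite gtn_eqF // (leq_trans _ (good_deg gz)).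
  have dx2 : (deg x == 2) = false by rewrite gtn_eqF // (leq_trans _ (good_deg gx)).
  have dx3 : (deg x == 3) = false by rewrite gtn_eqF // (leq_trans _ (good_deg gx)).
  have ntq : ~~ tight q.
    by apply/negP => /tight_good/good_deg; rewrite dq.
  have uBz : tight_unit U = tight z.
    rewrite /tight_unit TU /=; apply/existsP/idP => [[t]|tz].
      by rewrite UE' !inE => /andP[/orP[]/eqP->] //; rewrite (negbTE ntq).
    by exists z; rewrite UE' !inE eqxx orbT.
  have T2x : pair2 (item z x).
    rewrite (item_pair ezx ezq) 1?e_sym // /pair2 cards2 edge_neq //=.
    by apply/existsP; exists q; rewrite !inE eqxx orbT dq.
  have fxz : flow x z = if tight z then 2 else 0.
    by rewrite /flow gx exz dz2 dz3 iz TU.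
  have fzx : flow z x = if tight x then 2 else 0.
    by rewrite /flow gz ezx dx2 dx3 T2x.
  have U2 : #|U| == 2 by case/andP: TU.
  rewrite fxz fzx /worth /is_unit (negbTE (not_simple_unit_deg2 _ TU)) uBz /=.
  rewrite /single3 (eqP U2) /= TU.
  have tt : tight z -> tight x = false.
    by move=> tz; apply/negbTE/(tight_not_tight_unit Ui); rewrite uBz.
  by case: (boolP (tight z)) => [/tt->|_] //; case: (tight x).
have hH w : w \in U -> w \in H.
  move=> wU; have [exw _] := items_mem Ui wU; apply: mem_H (edgeS exw) _.
  apply: contra nT => dw; rewrite /pair2 UE cards2 uv /=; apply/existsP.
  by exists w; rewrite -UE wU.
have -> : U :&: H = U by apply/setIidPl/subsetP.
have uU : u \in U by rewrite UE !inE eqxx.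
have vU : v \in U by rewrite UE !inE eqxx orbT.
have -> : \sum_(w in U) (in_tri x w + flow x w) = 2 + (flow x u + flow x v).
  have it w z : w \in U -> z \in U -> e w z -> in_tri x w = true.
    move=> wU zU ewz; apply/existsP; exists z; rewrite hH // ewz andbT.
    by case: (items_mem Ui zU).
  rewrite UE big_setU1 ?inE //= big_set1 (it u v) // (it v u) //.
  by rewrite addnACA.
apply: leq_trans (_ : 8 <= _); last first.
  rewrite UE big_setU1 ?inE //= big_set1.
  by rewrite addnACA leq_addr.
have U2 : #|U| = 2 by rewrite UE cards2 uv.
have uB : tight_unit U = false by rewrite /tight_unit (negbTE nT).
rewrite /worth /single3 U2 (negbTE nT) /=.
case: (boolP (is_unit x U)) => [uU'|nU].
  move: (uU'); rewrite /is_unit uB orbF => uW.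
  have d3 w : w \in U -> deg w = 3.
    move=> wU; move: uW; rewrite /simple_unit U2 /= => /andP[/forallP/(_ w)].
    by rewrite wU => /eqP.
  have fl w : w \in U -> flow x w = 2.
    move=> wU; have [exw iw] := items_mem Ui wU.
    by rewrite /flow gx exw (d3 w wU) /= -iw uW.
  by rewrite !fl.
have [||le _ _] := flow_pair gx exu exv euv; rewrite -?UE //.
rewrite UE big_setU1 ?inE //= big_set1 -addnA subnKC //.
by apply: leq_trans le _.
Qed.

Lemma items_deg x : deg x = \sum_(U in items x) #|U|.
Proof. exact: card_partition (items_partition x). Qed.

Definition singles x : {set {set T}} := [set U in items x | single3 x U].
Definition rest x : {set {set T}} := items x :\: units x :\: singles x.

Lemma single3_unit x U : single3 x U -> ~~ is_unit x U.
Proof.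
move=> /and3P[U1 _ nW]; rewrite /is_unit negb_or nW /tight_unit /pair2.
by rewrite (eqP U1).
Qed.

Lemma single3_deg x U t : single3 x U -> t \in U -> deg t = 3.
Proof. by case/and3P => _ /forallP/(_ t) + _ tU; rewrite tU => /eqP. Qed.

Lemma sum_items x (F : {set T} -> nat) : \sum_(U in items x) F U =
  \sum_(U in units x) F U + (\sum_(U in singles x) F U + \sum_(U in rest x) F U).
Proof.
rewrite (big_setID (units x)) /=; congr (_ + _).
  by apply: eq_bigl => U; rewrite !inE; case: (U \in items x).
rewrite (big_setID (singles x)) /=; congr (_ + _).
apply: eq_bigl => U; rewrite !inE; case: (U \in items x) => //=.
by case s3: (single3 x U); rewrite ?andbF // single3_unit.
Qed.

Lemma card_items x : #|items x| = #|units x| + (#|singles x| + #|rest x|).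
Proof. by have := sum_items x (fun=> 1); rewrite !sum1_card. Qed.

Lemma restP x U : U \in rest x -> [/\ U \in items x, ~~ is_unit x U & ~~ single3 x U].
Proof.
rewrite !inE; case: (U \in items x); rewrite ?andbF //= andbT.
by move=> /andP[].
Qed.

Lemma mem_others x t : t \in others x -> e x t /\
  (item x t \in singles x) || (item x t \in rest x).
Proof.
rewrite !inE => /andP[tc ext]; split=> //; rewrite item_in //=.
case: (single3 x _) => //=; rewrite andbT; apply: contra tc => tu.
by apply/bigcupP; exists (item x t); [rewrite inE item_in | exact: item_refl].
Qed.

Lemma card_others x : #|others x| <= #|singles x| + \sum_(U in rest x) #|U|.
Proof.
have -> : #|singles x| = \sum_(U in singles x) #|U|.
  rewrite -sum1_card; apply: eq_bigr => U; rewrite inE => /andP[_ /and3P[/eqP->]].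
  by [].
apply: leq_trans (_ : #|cover (singles x) :|: cover (rest x)| <= _).
  apply/subset_leq_card/subsetP => t /mem_others[ext /orP[]ti]; apply/setUP; [left|right];
  by apply/bigcupP; exists (item x t); rewrite ?item_refl.
by apply: leq_trans (leq_card_setU _ _) _; rewrite leq_add ?leq_card_cover.
Qed.

Lemma item_le2 x U : U \in items x -> #|U| <= 2.
Proof.
move=> /itemsP[[w [-> _ _]]|[u [v [-> uv _ _ _]]]]; first by rewrite cards1.
by rewrite cards2 uv.
Qed.

Lemma rest_le2 x : \sum_(U in rest x) #|U| <= 2 * #|rest x|.
Proof.
rewrite mulnC -sum_nat_const; apply: leq_sum => U /restP[Ui _ _].
exact: item_le2 Ui.
Qed.

Lemma worth_rest x U : good x -> U \in rest x -> 4 <= worth x U /\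
  (#|items x| <= 4 -> ~~ pair2 U -> #|U| = 2 -> forall p, p \in U -> good p ->
     5 <= worth x U /\ (5 <= #|items p| -> worth x U = 6)).
Proof.
move=> gx /restP[Ui nU n3]; rewrite /worth (negbTE nU) (negbTE n3).
case: (itemsP Ui) => [[w [UE _ _]]|[u [v [UE uv exu exv euv]]]].
  by rewrite UE cards1.
have -> : (#|U| == 1) = false by rewrite UE cards2 uv.
have [TU|nT] := boolP (pair2 U); first by case: ifP.
have [||le h1 h2] := flow_pair gx exu exv euv; rewrite -?UE //.
rewrite UE big_setU1 ?inE //= big_set1; split.
  by rewrite -[4]/(6 - 2) leq_sub2l.
move=> I4 _ _ p pU gp; split.
  rewrite -[5]/(6 - 1) leq_sub2l // h1 //.
  by move: pU; rewrite !inE => /orP[]/eqP<-; rewrite gp ?orbT.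
by move=> Ip; rewrite (h2 p).
Qed.

(** The cases go by the number of items. A unit brings 2, a single vertex of degree 3 not forming a
    unit 3 and every other item at least 4, so six items suffice. Less than 12 from four or five
    items means many units and few other neighbours, which the extension lemmas exclude. With at
    most three items there are no units, and the second half of the definition of [good] decides. *)
Lemma worth_sum x : x \in S -> good x -> 12 <= \sum_(U in items x) worth x U.
Proof.
move=> xS gx; rewrite sum_items.
have -> : \sum_(U in units x) worth x U = #|units x| * 2.
  rewrite -sum_nat_const; apply: eq_bigr => U; rewrite inE => /andP[_ uU].
  by rewrite /worth uU.
have -> : \sum_(U in singles x) worth x U = #|singles x| * 3.
  rewrite -sum_nat_const; apply: eq_bigr => U; rewrite inE => /andP[_ s3].
  by rewrite /worth (negbTE (single3_unit s3)) s3.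
have r4 : #|rest x| * 4 <= \sum_(U in rest x) worth x U.
  by rewrite -sum_nat_const; apply: leq_sum => U /(worth_rest gx)[].
have ci := card_items x; have co := card_others x; have rl := rest_le2 x.
set a := #|units x| in ci *; set b := #|singles x| in ci co *.
set r := #|rest x| in ci rl r4 *; set V := \sum_(U in rest x) worth x U in r4 *.
have s3 t : item x t \in singles x -> e x t -> deg t = 3.
  by rewrite inE => /andP[_ s] ext; apply: (single3_deg s); apply: item_refl.
have r0 : r = 0 -> forall p, p \in others x -> deg p = 3.
  move=> /cards0_eq r0 p /mem_others[exp]; rewrite r0 in_set0 orbF => ps; exact: s3 ps exp.
have ng t : deg t = 3 -> ~~ good t by move=> dt; apply: not_good_deg; rewrite dt.
have noA : 0 < a -> 4 <= #|items x|.
  by case/card_gt0P => U; rewrite inE => /andP[Ui uU]; have [] := unit_items Ui uU.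
have [I6|I5] := ltnP 5 #|items x|; first by clear -I6 ci r4; lia.
have E1 : r = 0 -> b <= 1 -> False.
  move=> rz b1; apply: (@ext_units x xS) => //; last first.
  - by apply: leq_trans I5; rewrite ci rz addn0 addnC leq_add2l; clear -co rl rz b1; lia.
  - exact: r0.
  - by clear -co rl rz b1; lia.
(* With five items, one of [rest x] gives 4 + 4 * 2 and two of [singles x] give 2 * 3 + 3 * 2; the
   remaining possibilities are excluded by [E1]. *)
have [I5'|I4] := ltnP 4 #|items x|.
  have [b1|b2] := leqP b 1; last by clear -I5' ci r4 b2; lia.
  have [/E1/(_ b1)//|rz] := eqVneq r 0.
  by clear -I5' ci r4 rz; lia.
have unitA U : U \in units x -> simple_unit x U.
  rewrite inE => /andP[Ui uU]; have [_ h] := unit_items Ui uU.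
  by move: uU; case/orP => // /h; rewrite leqNgt ltnS I4.
have [I4'|I3] := ltnP 3 #|items x|.
  have IE : #|items x| = 4 by apply/eqP; rewrite eqn_leq I4.
  (* If nothing is in [rest x], four single vertices of degree 3 bring 12. Two or three of them are
     excluded because none is good, and at most one by [E1]. *)
  have [rz|rpos] := posnP r.
    have [/(E1 rz)//|b2] := leqP b 1.
    have [b4|b3] := ltnP 3 b; first by clear -b4 ci r4; lia.
    case: (@ext_not_good x xS); first by clear -co rl rz b3; lia.
      by move=> p /(r0 rz); apply: ng.
    by rewrite -/a; clear -ci IE rz b2; lia.
  have [r2|r1] := ltnP 1 r; first by clear -ci IE r4 r2; lia.
  have {rpos}r1 : r = 1 by apply/eqP; rewrite eqn_leq r1.
  have [b2|b1] := ltnP 1 b; first by clear -ci IE r4 r1 b2; lia.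
  have /cards1P[U rU] : #|rest x| == 1 by rewrite -/r r1.
  have Ur : U \in rest x by rewrite rU inE.
  have [Ui nU n3] := restP Ur.
  have VE : V = worth x U by rewrite /V rU big_set1.
  have co' : #|others x| <= b + #|U| by move: co; rewrite rU big_set1.
  have oth p : p \in others x -> deg p = 3 \/ p \in U.
    move=> /mem_others[exp]; rewrite rU => /orP[ps|]; first by left; apply: s3 ps exp.
    by rewrite inE => /eqP<-; right; apply: item_refl.
  have aE : a + b = 3 by clear -ci IE r1; lia.
  have U_others p : p \in U -> p \in others x.
    move=> pU; have [exp UE] := items_mem Ui pU.
    rewrite !inE exp andbT; apply/bigcupP => -[W]; rewrite inE => /andP[Wi uW] pW.
    by move: nU; rewrite UE; have [_ <-] := items_mem Wi pW; rewrite uW.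
  have b01 : b = 0 \/ b = 1 by clear -b1; lia.
  have [U1|U2] : #|U| = 1 \/ #|U| = 2.
    have := item_le2 Ui; have [w wU] := items0 Ui.
    have : 0 < #|U| by apply/card_gt0P; exists w.
    by clear; lia.
  - case: b01 => bE; rewrite bE in co' aE.
      case: (@ext_le1 x xS); first by rewrite U1 in co'.
      by rewrite -/a; clear -aE; lia.
    have /card_gt0P[W] : 0 < b by rewrite bE.
    rewrite inE => /andP[Wi W3]; have [p pW] := items0 Wi.
    have [exp WE] := items_mem Wi pW.
    case: (@ext_pair x p xS); first by rewrite U1 in co'.
    - rewrite !inE exp andbT; apply/bigcupP => -[W']; rewrite inE => /andP[W'i uW'] pW'.
      by have := single3_unit W3; rewrite WE; have [_ <-] := items_mem W'i pW'; rewrite uW'.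
    - by apply: ng; apply: single3_deg W3 pW.
    - by rewrite -/a; clear -aE; lia.
  (* Here three items bring 6 or 7, so the pair has to bring 6 or 5. If it has a vertex of degree 2
     then [x] is tight and receives the extra 2. *)
  - have [TU|nT] := boolP (pair2 U).
      have tx : tight x.
        apply/and4P; split=> //; first by rewrite IE.
        apply/existsP; exists U; rewrite Ui TU /=; apply/forallP => W.
        apply/implyP => Wi; apply/implyP => WU; case s3W: (single3 x W); rewrite ?orbT //.
        rewrite orbF; apply: unitA; rewrite inE Wi; apply: contraT => nW.
        have : W \in rest x by rewrite !inE Wi nW s3W.
        by rewrite rU inE (negbTE WU).
      have -> : V = 6.
        by rewrite VE /worth (negbTE nU) (negbTE n3) U2 /= TU tx.
      by clear -aE; lia.
    have [_ /(_ I4 nT U2) h] := worth_rest gx Ur.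
    case: b01 => bE; rewrite bE in co' aE *.
      have oU : others x = U.
        apply/eqP; rewrite eq_sym eqEcard co' andbT.
        by apply/subsetP => p /U_others.
      have [|p [pU gp Ip]] := ext_triangle Ui U2 oU; first by rewrite -/a; clear -aE; lia.
      have [_ /(_ Ip)] := h p pU gp; rewrite -VE => ->.
      by clear -aE; lia.
    have [/existsP[p /andP[pU gp]]|/existsPn no] := boolP [exists p in U, good p].
      have [+ _] := h p pU gp; rewrite -VE; clear -aE; lia.
    case: (@ext_not_good x xS); first by rewrite U2 in co'.
      move=> p /oth[|pU]; first exact: ng.
      by have := no p; rewrite pU.
    by rewrite -/a; clear -aE; lia.
have az : a = 0 by apply/eqP; rewrite -leqn0 leqNgt; apply/negP => /noA; rewrite leqNgt ltnS I3.
have degx : deg x = b + \sum_(U in rest x) #|U|.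
  rewrite items_deg sum_items (_ : \sum_(U in units x) _ = 0); last first.
    by rewrite big_pred0 // => U; move/cards0_eq: az => ->; rewrite inE.
  rewrite add0n; congr (_ + _); rewrite /b -sum1_card; apply: eq_bigr => U.
  by rewrite inE => /andP[_ /and3P[/eqP->]].
have d5 := good_deg gx.
have [r3|r2] := ltnP 2 r; first by clear -r3 r4; lia.
(* Degree at least 5 now forces two pairs and one single vertex, so the degree is 5 and some
   neighbour [z] has degree at least 6. As [z] is good, its pair is worth 5, and 3 + 5 + 4 = 12. *)
have [re be] : r = 2 /\ b = 1 by clear -d5 degx rl ci I3 az r2; lia.
have dx5 : deg x = 5 by clear -d5 degx rl re be; lia.
have [z exz dz] : exists2 z, e x z & 6 <= deg z.
  by move: gx; rewrite /good dx5 /= => /existsP[z /andP[]]; exists z.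
have gz : good z by rewrite /good dz.
have Zr : item x z \in rest x.
  have zo : z \in others x.
    rewrite !inE exz andbT (_ : units x = set0) ?/cover ?big_set0 ?inE //.
    exact: cards0_eq.
  case: (mem_others zo) => _ /orP[zs|//].
  by have := s3 z zs exz; clear -dz; lia.
have [Zi nZ n3] := restP Zr.
have rle := rl; rewrite (big_setD1 _ Zr) /= in degx rle.
have rD : #|rest x :\ item x z| = 1.
  by have := cardsD1 (item x z) (rest x); rewrite Zr -/r re => -[].
have sD : \sum_(U in rest x :\ item x z) #|U| <= 2.
  apply: (@leq_trans (\sum_(U in rest x :\ item x z) 2)).
    by apply: leq_sum => U; rewrite inE => /andP[_ /restP[Ui _ _]]; apply: item_le2 Ui.
  by rewrite sum_nat_const rD.
have Z2 : #|item x z| = 2.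
  have := item_le2 Zi; rewrite dx5 be in degx; move: degx sD.
  set s := \sum_(i in _) _; set i := #|_|; clearbody s i; clear; lia.
have nT : ~~ pair2 (item x z).
  by apply/negP => /(pair2_items Zi); rewrite leqNgt ltnS I3.
have [_ /(_ I4 nT Z2 z (item_refl exz) gz)[v5 _]] := worth_rest gx Zr.
have vD : 4 <= \sum_(U in rest x :\ item x z) worth x U.
  apply: (@leq_trans (\sum_(U in rest x :\ item x z) 4)).
    by rewrite sum_nat_const rD.
  by apply: leq_sum => U; rewrite inE => /andP[_ /(worth_rest gx)[]].
rewrite /V (big_setD1 _ Zr) /= be az -[12]/(0 * 2 + (1 * 3 + (5 + 4))).
by rewrite !leq_add2l leq_add.
Qed.

Lemma not_good_nbr_deg2 x y : ~~ good x -> e x y -> deg y != 2.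
Proof.
move=> gx exy; apply: contra gx => /eqP dy; exact: deg2_nbr_good dy exy.
Qed.

(** In degree 3 the amount 4 per neighbour is exactly 12, so the 2 owed for the triangle has to be
    received. Two good vertices [y] and [b] share it. A single good one pays 2, or else pays 1 with
    [r] good and paying the rest. If neither is good then [r] is, and [x] forms a simple unit at
    [r]. *)
Lemma deg3_receives x y b : deg x = 3 -> e x y -> e x b -> e y b ->
  exists r, [/\ nbr x = y |: (b |: [set r]), r != y, r != b & y != b] /\
    ((forall z, e x z -> ~~ e r z) /\ 2 <= flow y x + flow b x + flow r x).
Proof.
move=> dx exy exb eyb.
have yb := edge_neq eyb.
have eby : e b y by rewrite e_sym.
have [r [exr ry rb h]] := nbr3_2 dx exy exb yb.
exists r; split; first split=> //.
  apply/setP => t; rewrite !inE; apply/idP/idP => [/h //|].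
  by move=> /or3P[]/eqP->.
have erx : e r x by rewrite e_sym.
have gx : ~~ good x by apply: not_good_deg; rewrite dx.
have no z : e r z -> ~~ e x z.
  move=> erz; apply/negP => exz; case/or3P: (h z exz) => /eqP zE; subst z.
  - by move: rb; rewrite (item_mate exy exb eyb exr _) ?eqxx // e_sym.
  - by move: ry; rewrite (item_mate exb exy eby exr _) ?eqxx // e_sym.
  - by rewrite e_irr in erz.
split; first by move=> z; apply: contraL => /no.
have ir := item_single erx no.
have fr : good r -> 0 < flow r x.
  move=> gr; rewrite /flow gr erx dx /= ir; case: ifP => // _.
  rewrite (mates_single erx no).
  have -> : [forall m in set0, deg m == 3] by apply/forallP => m; rewrite inE.
  by [].
suff main y' b' : e x y' -> e x b' -> e y' b' -> r != y' -> r != b' ->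
    (forall t, e x t -> [|| t == y', t == b' | t == r]) ->
    good y' -> ~~ good b' -> 2 <= flow y' x + flow r x.
  have [gy|gy] := boolP (good y); have [gb|gb] := boolP (good b).
  - have fl u v : e x u -> e x v -> e u v -> good u -> good v ->
        flow u x = if 5 <= #|items u| then 2 else if 5 <= #|items v| then 0 else 1.
      move=> exu exv euv gu gv; have eux : e u x by rewrite e_sym.
      have dv3 : (deg v == 3) = false by rewrite gtn_eqF // (leq_trans _ (good_deg gv)).
      rewrite /flow gu eux dx /= (mates_pair eux euv exv) (item_pair eux euv exv).
      have -> : simple_unit u [set x; v] = false.
        rewrite /simple_unit cards2 (edge_neq exv) /=; apply/negbTE/negP.
        by move=> /andP[/forallP/(_ v)]; rewrite !inE eqxx orbT dv3.
      have fs (P : pred T) : [forall m in [set v], P m] = P v.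
        apply/forallP/idP => [/(_ v)|Pv m]; rewrite inE ?eqxx //.
        by apply/implyP => /eqP->.
      have es (P : pred T) : [exists m in [set v], P m] = P v.
        apply/existsP/idP => [[m]|Pv]; first by rewrite inE => /andP[/eqP->].
        by exists v; rewrite inE eqxx.
      by rewrite !fs es dv3 gv.
    by rewrite (fl y b) // (fl b y) //; case: ifP; case: ifP.
  - by rewrite addnAC; apply: leq_trans (leq_addr _ _); apply: (main y b).
  - rewrite -addnA addnC; apply: leq_trans (leq_addr _ _); apply: (main b y) => //.
    by move=> t /h; rewrite orbCA.
  - have [t ext gt] : exists2 t, e x t & good t.
      by apply: exists_good_deg3; [exact: eS exy | rewrite dx].
    have tr : t = r.
      case/or3P: (h t ext) => /eqP tE; subst t => //.
        by rewrite gt in gy.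
      by rewrite gt in gb.
    subst t; rewrite addnC; apply: leq_trans (leq_addr _ _).
    rewrite /flow gt erx dx /= ir.
    suff -> : simple_unit r [set x] by [].
    rewrite /simple_unit cards1 /= orbF; apply/forallP => t; rewrite inE.
    apply/implyP => /eqP->; rewrite dx /= /weak dx /=.
    apply/forallP => s; apply/implyP => exs; apply/implyP => sr.
    by case/or3P: (h s exs) sr => /eqP-> //; rewrite eqxx.
move=> exu exv euv ru rv h' gu gv; have eux : e y' x by rewrite e_sym.
rewrite {1}/flow gu eux dx /= (mates_pair eux euv exv) (item_pair eux euv exv).
case: ifP => [_|nW]; first exact: leq_addr.
have fs (P : pred T) : [forall m in [set b'], P m] = P b'.
  apply/forallP/idP => [/(_ b')|Pv m]; rewrite inE ?eqxx //.
  by apply/implyP => /eqP->.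
rewrite !fs gv /=; case: eqP => [dv|_]; last exact: leq_addr.
rewrite -[2]/(1 + 1) leq_add2l; apply: fr; apply: contraFT nW => gr.
have nt t : e x t -> t != y' -> ~~ good t.
  by move=> ext ty; case/or3P: (h' t ext) ty => /eqP-> //; rewrite eqxx.
rewrite /simple_unit cards2 (edge_neq exv) /=; apply/andP; split.
  by apply/forallP => t; rewrite !inE; apply/implyP => /orP[]/eqP->; rewrite ?dx ?dv.
apply/existsP; exists x; rewrite !inE eqxx /= /weak dx /=.
by apply/forallP => t; apply/implyP => /nt ht; apply/implyP.
Qed.

Lemma deg2_H x w z : x \in H -> deg x = 2 -> e x w -> e x z -> e w z -> False.
Proof.
rewrite inE => /andP[xQ xS] dx exw exz ewz; case/negP: xQ.
rewrite inE xS dx /=; apply/existsP; exists w; rewrite exw.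
by apply/existsP; exists z; rewrite exz.
Qed.

Lemma discharge x : x \in H ->
  12 + \sum_(w in nbr x :&: H) (in_tri x w + flow x w) <=
  \sum_(w in nbr x :&: H) (4 + flow w x).
Proof.
move=> xH; have xS : x \in S by move: xH; rewrite inE => /andP[].
have [gx|gx] := boolP (good x).
  have part (F : T -> nat) : \sum_(w in nbr x :&: H) F w =
      \sum_(U in items x) \sum_(w in U :&: H) F w.
    have /and3P[/eqP cov triv _] := items_partition x.
    rewrite (eq_bigl (fun w => (w \in cover (items x)) && (w \in H))); last first.
      by move=> w; rewrite cov in_setI.
    rewrite big_trivIset_cond //; apply: eq_bigr => U _.
    by apply: eq_bigl => w; rewrite in_setI.
  rewrite !part; apply: leq_trans (leq_add (worth_sum xS gx) (leqnn _)) _.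
  rewrite -big_split /=; apply: leq_sum => U Ui.
  by rewrite addnC; apply: item_val.
have fl0 w : flow x w = 0 by rewrite /flow (negbTE gx).
have nH : nbr x :&: H = nbr x.
  apply/setIidPl/subsetP => w; rewrite in_nbr => exw.
  by apply: mem_H (edgeS exw) _; apply: not_good_nbr_deg2 gx exw.
rewrite nH (eq_bigr (fun w => nat_of_bool (in_tri x w))); last first.
  by move=> w _; rewrite fl0 addn0.
rewrite big_split /= sum_nat_const.
have tri_le : \sum_(w in nbr x) nat_of_bool (in_tri x w) <= deg x.
  by rewrite /deg -sum1_card; apply: leq_sum => w _; apply: leq_b1.
have d2 := deg_ge2 xS; rewrite -/(deg x).
have [d4|d3] := ltnP 3 (deg x).
  apply: leq_trans (leq_addr _ _); apply: leq_trans (leq_add (leqnn _) tri_le) _.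
  by clear -d4; lia.
(* A vertex of degree 2 in [H] lies in no triangle, so that each of its good neighbours sends 2 and
   8 + 2 + 2 = 12. *)
have [dx|dx] := eqVneq (deg x) 2.
  rewrite big1 ?addn0 => [|w]; last first.
    rewrite in_nbr => exw; apply/eqP; rewrite eqb0; apply/existsPn => z.
    by apply/negP => /and3P[_ exz ewz]; apply: (deg2_H xH dx exw exz).
  rewrite (eq_bigr (fun=> 2)) ?sum_nat_const -/(deg x) ?dx // => w.
  rewrite in_nbr => exw; have gw := nbr_good_deg2 exw dx.
  have ewx : e w x by rewrite e_sym.
  rewrite /flow gw ewx dx /= item_single ?cards1 // => z ewz.
  by apply/negP => exz; apply: (deg2_H xH dx exw exz).
have {d2 d3}dx : deg x = 3 by clear -d2 d3 dx; lia.
rewrite dx -[3 * 4]/12 leq_add2l.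
have [/existsP[y /andP[exy /existsP[b /and3P[_ exb eyb]]]]|/existsPn no] :=
    boolP [exists y, e x y && in_tri x y]; last first.
  by rewrite big1 // => w; rewrite in_nbr => exw; have := no w; rewrite exw /= => /negbTE->.
have [r [[-> ry rb yb] [nr le]]] := deg3_receives dx exy exb eyb.
have nb : b \notin [set r] by rewrite inE eq_sym.
have ny : y \notin b |: [set r] by rewrite !inE negb_or yb eq_sym.
rewrite !(big_setU1 _ ny, big_setU1 _ nb) /= !big_set1 !addnA.
apply: leq_trans le; have -> : in_tri x r = false.
  by apply/negbTE/existsPn => z; apply/negP => /and3P[_ /nr/negP].
by rewrite addn0 -[2]/(1 + 1) leq_add ?leq_b1.
Qed.

(* Summing the local inequalities over [H], the charge sent cancels the charge
   received. *)
Lemma dense_subset : exists H' : {set T}, H' != set0 /\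
  12 * #|H'| + \sum_(x in H') #|[set w in nbr x :&: H' | [exists z in H', e x z && e w z]]|
    <= 4 * \sum_(x in H') #|nbr x :&: H'|.
Proof.
exists H; split.
  have [S0|/set0Pn[x xS]] := eqVneq S set0.
    case: (no_colouring (f := fun=> None)).
      split=> [//|s c _ s3 /allP sn]; case: s s3 sn => // x s _ /(_ x (mem_head _ _)).
      by [].
    by move=> x; rewrite S0 inE.
  apply/set0Pn; have [dx|dx] := eqVneq (deg x) 2; last first.
    by exists x; apply: mem_H.
  have /card_gt0P[y] : 0 < deg x by rewrite dx.
  rewrite in_nbr => exy; exists y; apply: mem_H (edgeS exy) _.
  by rewrite gtn_eqF // (leq_trans _ (good_deg (nbr_good_deg2 exy dx))).
have : \sum_(x in H) (12 + \sum_(w in nbr x :&: H) (in_tri x w + flow x w)) <=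
    \sum_(x in H) \sum_(w in nbr x :&: H) (4 + flow w x).
  by apply: leq_sum => x xH; apply: discharge.
rewrite big_split /= sum_nat_const mulnC.
rewrite (eq_bigr (fun x => \sum_(w in nbr x :&: H) nat_of_bool (in_tri x w) +
  \sum_(w in nbr x :&: H) flow x w)); last by move=> x _; rewrite big_split.
rewrite [X in _ <= X](eq_bigr (fun x => 4 * #|nbr x :&: H| +
  \sum_(w in nbr x :&: H) flow w x)); last first.
  by move=> x _; rewrite big_split /= sum_nat_const mulnC.
rewrite [4 * _]big_distrr /= !big_split /= addnA.
have -> : \sum_(x in H) \sum_(w in nbr x :&: H) flow w x =
          \sum_(x in H) \sum_(w in nbr x :&: H) flow x w.
  rewrite (exchange_big_dep (mem H)) /=; last by move=> x w _; rewrite inE => /andP[].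
  apply: eq_bigr => w wH; apply: eq_bigl => x.
  by rewrite !in_setI !in_nbr wH andbT e_sym andbC.
rewrite leq_add2r; congr (_ + _ <= _); apply: eq_bigr => x _.
rewrite -sum1_card [RHS](eq_bigl (fun w => (w \in nbr x :&: H) && in_tri x w)); last first.
  by move=> w; rewrite inE.
by rewrite -big_mkcondr; apply: eq_bigr => w _; case: in_tri.
Qed.

End Colouring.

(** * Duality in the grid *)

Local Notation point := (nat * nat)%type.

Section GridSteps.
Implicit Types (p q : point) (s : seq point) (w : point * bool).

(** Standing still is allowed because a rounded curve may stay at a grid point. *)
Definition step p q : bool :=
  [|| p == q,
      (p.1 == q.1) && ((p.2.+1 == q.2) || (q.2.+1 == p.2)) |
      (p.2 == q.2) && ((p.1.+1 == q.1) || (q.1.+1 == p.1))].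

(** The free margin permits shifting sums over the grid without boundary terms. *)
Definition grid_labelling (T : finType) (e : rel T) (lab : point -> option T)
    (root : T -> point) (N : nat) : Prop :=
  [/\ forall p, lab p != None -> (0 < p.1 < N) && (0 < p.2 < N),
      forall p x, lab p = Some x -> exists s, [/\ path step (root x) s,
        last (root x) s = p & all (fun q => lab q == Some x) (root x :: s)] &
      forall x y, e x y ->
        exists a, [/\ step a.1 a.2, lab a.1 = Some x & lab a.2 = Some y]].

(* The grid edge [((i, j), d)] joins [(i, j)] to [(i, j+1)] if [d], and to
   [(i+1, j)] otherwise; [far] is its second end.  The unit square [(a, b)] has
   upper right corner [(a, b)]; the sides of a grid edge are the two squares
   that it separates. *)
Definition far w : point := if w.2 then (w.1.1, w.1.2.+1) else (w.1.1.+1, w.1.2).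
Definition side1 w : point := (w.1.1.+1, w.1.2.+1).
Definition side0 w : point := if w.2 then (w.1.1, w.1.2.+1) else (w.1.1.+1, w.1.2).
Definition uses w p q : bool :=
  ((w.1 == p) && (far w == q)) || ((w.1 == q) && (far w == p)).
Definition edge_of p q : point * bool := ((minn p.1 q.1, minn p.2 q.2), p.1 == q.1).

(** The step crosses the vertical ray going down from the square; along a closed walk the parity of
    these crossings is the winding number modulo 2. *)
Definition crosses (sq : point) p q : bool :=
  [&& p.1 != q.1, (minn p.1 q.1).+1 == sq.1 & p.2 < sq.2].
Definition below (c : point) p : bool := (p.1 == c.1) && (p.2 <= c.2).

(** Two squares above one another are told apart only by steps along the grid edge between them. For
    squares side by side, the difference records whether the step enters or leaves the vertical line
    below, apart from a step along [w] itself; this term telescopes. *)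
Lemma crosses_sides w p q : step p q ->
  crosses (side1 w) p q (+) crosses (side0 w) p q =
  uses w p q (+) (w.2 && (below w.1 p (+) below w.1 q)).
Proof.
case: w p q => [[i j] d] [p1 p2] [q1 q2].
rewrite /step /crosses /uses /below /side0 /side1 /far /= !xpair_eqE /=.
case: d => /=; rewrite ?xpair_eqE /=.
  case/or3P => [/andP[/eqP-> /eqP->]|/andP[/eqP-> /orP[]/eqP<-]|/andP[/eqP-> /orP[]/eqP<-]];
  lia.
case/or3P => [/andP[/eqP-> /eqP->]|/andP[/eqP-> /orP[]/eqP<-]|/andP[/eqP-> /orP[]/eqP<-]];
  lia.
Qed.

Lemma uses_edge_of p q : step p q -> p != q -> uses (edge_of p q) p q.
Proof.
case: p q => [p1 p2] [q1 q2].
rewrite /step /uses /edge_of /far /= !xpair_eqE /=.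
case/or3P => [->//|/andP[/eqP-> /orP[]/eqP<-]|/andP[/eqP-> /orP[]/eqP<-]] _;
rewrite ?eqxx ?(gtn_eqF (ltnSn _)) ?(ltn_eqF (ltnSn _)) /= ?xpair_eqE /=; lia.
Qed.

Fixpoint walk_sum (F : point -> point -> bool) p s : bool :=
  if s is q :: s' then F p q (+) walk_sum F q s' else false.

Lemma walk_sum_telescope (F G : point -> point -> bool) (b : point -> bool) p s :
  (forall p q, step p q -> F p q = G p q (+) (b p (+) b q)) -> path step p s ->
  walk_sum F p s = walk_sum G p s (+) (b p (+) b (last p s)).
Proof.
move=> FG; elim: s p => [|q s IHs] p /=; first by rewrite addbb.
move=> /andP[/FG-> /IHs->].
by case: (G p q); case: (walk_sum G q s); case: (b p); case: (b q); case: (b (last _ _)).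
Qed.

Lemma walk_sum_false (F : point -> point -> bool) (P : pred point) p s :
  (forall p q, P p -> P q -> F p q = false) -> P p -> all P s ->
  walk_sum F p s = false.
Proof.
move=> h; elim: s p => [|q s IHs] p //= Pp /andP[Pq Ps].
by rewrite h // IHs.
Qed.

Lemma walk_sum_add (F G : point -> point -> bool) p s :
  walk_sum (fun p q => F p q (+) G p q) p s = walk_sum F p s (+) walk_sum G p s.
Proof.
elim: s p => [|q s IHs] p //=; rewrite IHs.
by case: (F p q); case: (G p q); case: (walk_sum F q s); case: (walk_sum G q s).
Qed.

End GridSteps.

Lemma odd_card (I : finType) (A : {pred I}) : odd #|A| = \big[addb/false]_(i in A) true.
Proof. by rewrite -sum1_card (big_morph odd oddD (erefl : odd 0 = false)). Qed.

Lemma big_addb_and (I : Type) (r : seq I) (P : pred I) (F : I -> bool) (b : bool) :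
  \big[addb/false]_(i <- r | P i) (b && F i) =
  b && \big[addb/false]_(i <- r | P i) F i.
Proof. by case: b => //=; rewrite big1. Qed.

Lemma odd_card_set (I : finType) (A : {pred I}) (F : pred I) :
  odd #|[set i in A | F i]| = \big[addb/false]_(i in A) F i.
Proof.
rewrite odd_card (eq_bigl (fun i => (i \in A) && F i)).
  by rewrite big_mkcondr; apply: eq_bigr => i _; case: (F i).
by move=> i; rewrite inE.
Qed.

Section Duality.
Variables (T : finType) (e : rel T) (lab : point -> option T) (root : T -> point).
Variable N : nat.
Hypothesis e_irr : irreflexive e.
Hypothesis lab_grid : grid_labelling e lab root N.

Definition arcs : {set T * T} :=
  [set p | e p.1 p.2 && (enum_rank p.1 < enum_rank p.2)].
Definition inc (x : T) (p : T * T) : bool := (p.1 == x) || (p.2 == x).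

Lemma arcs_neq p : p \in arcs -> p.1 != p.2.
Proof.
by rewrite inE => /andP[ep _]; apply: contraTneq ep => ->; rewrite e_irr.
Qed.

Lemma uses_inj w w' p q : uses w p q -> uses w' p q -> w = w'.
Proof.
case: w w' p q => [[i j] d] [[i' j'] d'] [p1 p2] [q1 q2].
rewrite /uses /far /=; case: d; case: d'; rewrite /= !xpair_eqE /= => h1 h2;
congr (_, _, _); lia.
Qed.

(* [R] relates two squares separated by a grid edge that neither lies inside a
   label class nor represents an edge of the graph.  An [R]-invariant [h] has
   an even boundary, as is seen by adding up, over the points of a label class,
   the four differences around each of them.  Conversely an even set is closed
   up by walks inside the classes, and [h] is the parity of the number of its
   horizontal steps below a square. *)
Lemma grid_duality : exists (s0 s1 : T * T -> point) (R : point -> point -> Prop),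
  (forall h : point -> bool, (forall s s', R s s' -> h s = h s') -> forall x,
     ~~ odd #|[set p in arcs | (h (s0 p) != h (s1 p)) && inc x p]|) /\
  (forall C : {set T * T}, C \subset arcs ->
     (forall x, ~~ odd #|[set p in C | inc x p]|) ->
     exists2 h : point -> bool, (forall s s', R s s' -> h s = h s') &
       forall p, p \in arcs -> (h (s0 p) != h (s1 p)) = (p \in C)).
Proof.
have [lab_in lab_conn lab_edge] := lab_grid.
have /choice[gr gr_p] : forall p : T * T, exists a : point * point, p \in arcs ->
    [/\ step a.1 a.2, lab a.1 = Some p.1 & lab a.2 = Some p.2].
  move=> p; have [pA|_] := boolP (p \in arcs); last by exists ((0, 0), (0, 0)).
  by move: pA; rewrite inE => /andP[/lab_edge[a ha] _]; exists a.
have /choice[pth pth_p] : forall p : point, exists s, forall x, lab p = Some x ->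
    [/\ path step (root x) s, last (root x) s = p &
      all (fun q => lab q == Some x) (root x :: s)].
  move=> p; case: (pselect (exists x, lab p = Some x)) => [[x lp]|no].
    by have [s hs] := lab_conn p x lp; exists s => y; rewrite lp => -[<-].
  by exists [::] => x lp; case: no; exists x.
pose ew p := edge_of (gr p).1 (gr p).2.
have gr_neq p : p \in arcs -> (gr p).1 != (gr p).2.
  move=> pA; have [_ l1 l2] := gr_p p pA; apply: contraNneq (arcs_neq pA) => E.
  by rewrite E l2 in l1; case: l1 => ->.
have ew_uses p : p \in arcs -> uses (ew p) (gr p).1 (gr p).2.
  by move=> pA; apply: uses_edge_of; [case: (gr_p p pA) | exact: gr_neq].
have ew_lab p : p \in arcs ->
    (lab (ew p).1 = Some p.1 /\ lab (far (ew p)) = Some p.2) \/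
    (lab (ew p).1 = Some p.2 /\ lab (far (ew p)) = Some p.1).
  move=> pA; have [_ l1 l2] := gr_p p pA.
  by case/orP: (ew_uses p pA) => /andP[/eqP-> /eqP->]; [left | right].
have arcs_lt p : p \in arcs -> enum_rank p.1 < enum_rank p.2.
  by rewrite inE => /andP[].
(* The labels at its ends determine the unordered pair, and the ranks determine the order. *)
have ew_inj p q : p \in arcs -> q \in arcs -> ew p = ew q -> p = q.
  move=> pA qA E; have := arcs_lt p pA; have := arcs_lt q qA.
  case: (ew_lab p pA) (ew_lab q qA); rewrite E => -[-> ->] [][[E1] [E2]];
  case: p q E1 E2 {pA qA E} => [p1 p2] [q1 q2] /= -> -> // h1 h2.
    by have := ltn_trans h1 h2; rewrite ltnn.
  by have := ltn_trans h1 h2; rewrite ltnn.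
pose blocked w := (exists x, lab w.1 = Some x /\ lab (far w) = Some x) \/
  exists2 p, p \in arcs & ew p = w.
pose R s s' := exists w, [/\ ~ blocked w, s = side0 w & s' = side1 w].
exists (fun p => side0 (ew p)), (fun p => side1 (ew p)), R; split.
  move=> h hR x.
  pose d w := h (side1 w) (+) h (side0 w).
  have d0 w : ~ blocked w -> d w = false.
    by move=> nb; rewrite /d (hR (side0 w) (side1 w)) ?addbb //; exists w.
  pose u p := lab p == Some x.
  have u_in p : u p -> (0 < p.1 < N) && (0 < p.2 < N).
    by move=> /eqP up; apply: lab_in; rewrite up.
  pose wv (t : 'I_N.+1 * 'I_N.+1 * bool) : point * bool :=
    ((nat_of_ord t.1.1, nat_of_ord t.1.2), t.2).
  (* [F] retains the differences across grid edges with exactly one end in the class of [x]. *)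
  pose F w := (u w.1 (+) u (far w)) && d w.
  have shift (G : nat -> bool) : G 0 = false -> G N.+1 = false ->
      \big[addb/false]_(i < N.+1) G i.+1 = \big[addb/false]_(i < N.+1) G i.
    move=> G0 GN; have := @big_ord_recl bool false addb N.+1 (fun i => G (nat_of_ord i)).
    by rewrite big_ord_recr /= G0 GN addbF => ->.
  have sumF0 : \big[addb/false]_t F (wv t) = false.
    rewrite (eq_bigr (fun t : 'I_N.+1 * 'I_N.+1 * bool => F (wv (t.1, t.2)))); last by case.
    rewrite -(pair_bigA _ (fun ij b => F (wv (ij, b)))) /=.
    rewrite (eq_bigr (fun ij : 'I_N.+1 * 'I_N.+1 =>
      F (wv (ij, true)) (+) F (wv (ij, false)))); last first.
      by move=> ij _; rewrite big_bool.
    rewrite (eq_bigr (fun ij : 'I_N.+1 * 'I_N.+1 =>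
      (F ((nat_of_ord ij.1, nat_of_ord ij.2), true)) (+)
      (F ((nat_of_ord ij.1, nat_of_ord ij.2), false)))) //.
    rewrite -(pair_bigA _ (fun i j : 'I_N.+1 => F ((nat_of_ord i, nat_of_ord j), true) (+)
      F ((nat_of_ord i, nat_of_ord j), false))) /=.
    pose D b i j := d ((i, j), b); pose v i j := u (i, j).
    have v_in i j : v i j -> [/\ 0 < i, i < N, 0 < j & j < N].
      by move=> /u_in /= /andP[/andP[? ?] /andP[? ?]].
    have v0 i j : [|| i == 0, i == N.+1, j == 0 | j == N.+1] -> v i j = false.
      by move=> h0; apply/negbTE/negP => /v_in[]; move: h0; clear; lia.
    have E i j : F ((i, j), true) (+) F ((i, j), false) =
        (v i j && (D true i j (+) D false i j)) (+)
        ((v i j.+1 && D true i j) (+) (v i.+1 j && D false i j)).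
      rewrite /F /v /D /far /=.
      by case: (u (i, j)); case: (u (i, j.+1)); case: (u (i.+1, j));
         case: (d _); case: (d _).
    under eq_bigr do under eq_bigr do rewrite E.
    under eq_bigr do rewrite !big_split.
    rewrite !big_split /=.
    have -> : \big[addb/false]_(i < N.+1) \big[addb/false]_(j < N.+1)
        (v i j.+1 && D true i j) = \big[addb/false]_(i < N.+1)
        \big[addb/false]_(j < N.+1) (v i j && D true i j.-1).
      apply: eq_bigr => i _; apply: (shift (fun j => v i j && D true i j.-1));
      by rewrite v0 ?eqxx ?orbT.
    have -> : \big[addb/false]_(i < N.+1) \big[addb/false]_(j < N.+1)
        (v i.+1 j && D false i j) = \big[addb/false]_(i < N.+1)
        \big[addb/false]_(j < N.+1) (v i j && D false i.-1 j).
      rewrite exchange_big [RHS]exchange_big; apply: eq_bigr => j _.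
      apply: (shift (fun i => v i j && D false i.-1 j));
      by rewrite v0 ?eqxx ?orbT.
    rewrite -!big_split big1 // => i _; rewrite -!big_split big1 // => j _ /=.
    have [vij|] := boolP (v i j); last by [].
    have [i0 _ j0 _] := v_in _ _ vij; rewrite /D /d /side0 /side1 /=.
    rewrite !prednK //.
    case: (h (i.+1, j.+1)); case: (h (_, _)); case: (h (_, _)); case: (h (_, _)) => //.
  (* A grid edge leaving the class has [d] equal to [false] unless it represents an edge of the
     graph, and this edge is then incident with [x]. *)
  have sumF : \big[addb/false]_t F (wv t) =
      \big[addb/false]_(p in arcs) (d (ew p) && inc x p).
    have Ft t : F (wv t) = \big[addb/false]_(p in arcs | ew p == wv t) (d (ew p) && inc x p).
      case: (pselect (exists2 p, p \in arcs & ew p = wv t)) => [[p pA pE]|no].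
        rewrite (big_pred1 p).
          rewrite pE andbC /F; congr (_ && _); have pn := arcs_neq pA.
          have us y : u y = (lab y == Some x) by [].
          rewrite -pE !us /inc.
          case: (ew_lab p pA) => -[-> ->]; rewrite !(inj_eq Some_inj).
            by have [<-|] := eqVneq p.1 x; rewrite // eq_sym (negbTE pn).
          rewrite orbC; have [<-|] := eqVneq p.2 x; by rewrite // (negbTE pn).
        move=> q; apply/andP/eqP => [[qA /eqP qE]|->]; last by rewrite pE.
        by apply: ew_inj => //; rewrite qE pE.
      rewrite big_pred0; last first.
        by move=> q; apply/andP => -[qA /eqP qE]; apply: no; exists q.
      rewrite /F; case uu: (u _ (+) u _) => //=; apply: d0 => -[[y [l1 l2]]|[p pA pE]].
        by move: uu; rewrite /u l1 l2 addbb.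
      by apply: no; exists p.
    rewrite (eq_bigr _ (fun t _ => Ft t)) (exchange_big_dep (mem arcs)) /=; last first.
      by move=> t p _ /andP[].
    apply: eq_bigr => p pA; rewrite (eq_bigl (fun t => ew p == wv t)); last first.
      by move=> t; rewrite pA.
    have [_ l1 l2] := gr_p p pA.
    have /lab_in/andP[/andP[_ b1] /andP[_ b2]] : lab (gr p).1 != None by rewrite l1.
    have i1 : (ew p).1.1 < N.+1.
      by rewrite /= (leq_ltn_trans (geq_minl _ _)) // ltnS ltnW.
    have i2 : (ew p).1.2 < N.+1.
      by rewrite /= (leq_ltn_trans (geq_minl _ _)) // ltnS ltnW.
    rewrite (big_pred1 ((Ordinal i1, Ordinal i2), (ew p).2)) //.
  apply/negbT; rewrite -sumF0 sumF odd_card_set; apply: eq_bigr => p _.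
  by rewrite /d; case: (h _); case: (h _).
move=> C Csub Ceven.
(* A sum over the grid edge of [p] and the walks that lead to it from the roots of both ends; modulo
   2 the direction of a walk does not matter. *)
pose total (F : point -> point -> bool) p := F (gr p).1 (gr p).2 (+)
  (walk_sum F (root p.1) (pth (gr p).1) (+) walk_sum F (root p.2) (pth (gr p).2)).
pose h s := \big[addb/false]_(p in C) total (crosses s) p.
have hs w : h (side1 w) (+) h (side0 w) = \big[addb/false]_(p in C) total (uses w) p.
  rewrite -big_split /=.
  (* After telescoping only terms at the roots survive, and evenness of [C] makes each of them occur
     an even number of times. *)
  pose B y := w.2 && below w.1 (root y).
  have tot p : p \in arcs -> total (crosses (side1 w)) p (+) total (crosses (side0 w)) p =
      total (uses w) p (+) (B p.1 (+) B p.2).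
    move=> pA; have [st l1 l2] := gr_p p pA.
    have [pa1 la1 _] := pth_p _ _ l1; have [pa2 la2 _] := pth_p _ _ l2.
    pose b y := w.2 && below w.1 y.
    have stp p' q' : step p' q' -> crosses (side1 w) p' q' (+) crosses (side0 w) p' q' =
        uses w p' q' (+) (b p' (+) b q').
      by move=> /(crosses_sides w)->; rewrite /b; case: (w.2).
    have := walk_sum_telescope stp pa2; have := walk_sum_telescope stp pa1.
    rewrite !walk_sum_add la1 la2 => E1 E2.
    rewrite /total addbACA (addbACA (walk_sum _ _ _)) E1 E2 stp //.
    rewrite /B -/(b (root p.1)) -/(b (root p.2)).
    move: (uses _ _ _) (walk_sum _ _ _) (walk_sum _ _ _) (b _) (b _) (b _) (b _).
    by do 7!case.
  rewrite (eq_bigr _ (fun p pC => tot p (subsetP Csub p pC))) big_split /=.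
  suff -> : \big[addb/false]_(p in C) (B p.1 (+) B p.2) = false by rewrite addbF.
  rewrite (eq_bigr (fun p => \big[addb/false]_(x | inc x p) B x)); last first.
    move=> p /(subsetP Csub)/arcs_neq pn; rewrite (bigD1 p.1) /inc ?eqxx //=.
    rewrite (big_pred1 p.2) // => x /=; have [->|ne] := eqVneq x p.1.
      by rewrite andbF (negbTE pn).
    by rewrite andbT /= eq_sym.
  rewrite (exchange_big_dep xpredT) //= big1 // => x _.
  rewrite -(eq_bigr _ (fun p _ => andbT (B x))) big_addb_and.
  have := Ceven x; rewrite odd_card (eq_bigl (fun p => (p \in C) && inc x p)).
    by move=> /negbTE->; rewrite andbF.
  by move=> p; rewrite inE.
have int w p x : lab p = Some x -> (forall y, ~ (lab w.1 = Some y /\ lab (far w) = Some y)) ->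
    walk_sum (uses w) (root x) (pth p) = false.
  move=> lp nb; have [_ _ /= /andP[lr ls]] := pth_p _ _ lp.
  apply: (@walk_sum_false _ (fun q => lab q == Some x)) => // a b /eqP la /eqP lb.
  apply/negbTE/negP => /orP[]/andP[/eqP Ea /eqP Eb]; apply: (nb x);
  by rewrite Ea Eb la lb.
have diff p w : p \in arcs -> ew p <> w -> uses w (gr p).1 (gr p).2 = false.
  by move=> pA ne; apply/negP => /(uses_inj (ew_uses p pA)).
have tot0 p w : p \in arcs -> (forall y, ~ (lab w.1 = Some y /\ lab (far w) = Some y)) ->
    total (uses w) p = uses w (gr p).1 (gr p).2.
  by move=> pA nb; have [_ l1 l2] := gr_p p pA; rewrite /total !int ?addbF.
exists h => [s s' [w [nb -> ->]] | p pA].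
  have : h (side1 w) (+) h (side0 w) = false.
    rewrite hs big1 // => p /(subsetP Csub) pA; rewrite tot0 //.
      by apply: diff => // pw; apply: nb; right; exists p.
    by move=> y hy; apply: nb; left; exists y.
  by case: (h _); case: (h _).
have -> : (h (side0 (ew p)) != h (side1 (ew p))) = h (side1 (ew p)) (+) h (side0 (ew p)).
  by case: (h _); case: (h _).
have nint y : ~ (lab (ew p).1 = Some y /\ lab (far (ew p)) = Some y).
  move=> [h1 h2]; case/negP: (arcs_neq pA); move: h1 h2.
  by case: (ew_lab p pA) => -[-> ->] [->] [->].
have use1 q : q \in C -> total (uses (ew p)) q = (q == p).
  move=> qC; have qA := subsetP Csub q qC; rewrite tot0 //.
  have [->|qp] := eqVneq q p; first exact: ew_uses.
  by apply: diff => // /ew_inj E; rewrite E ?eqxx in qp.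
rewrite hs (eq_bigr _ use1); have [pC|pC] := boolP (p \in C).
  by rewrite (bigD1 p) //= eqxx big1 // => q /andP[_ /negbTE].
by rewrite big1 // => q qC; apply: contraNF pC => /eqP<-.
Qed.

End Duality.

(** * Even edge sets and Euler's inequality *)

Section ArcDegrees.
Variable T : finType.
Implicit Types (x y z : T) (p q : T * T) (r : rel T) (C : {set T * T}).

(** The canonical orientation, by which an undirected edge is a single element of [arcs]. *)
Definition arc x y : T * T := if enum_rank x < enum_rank y then (x, y) else (y, x).
Definition dg C x : nat := #|[set p in C | inc x p]|.

Lemma rank_neq x y : x != y -> (enum_rank x < enum_rank y) || (enum_rank y < enum_rank x).
Proof.
move=> xy; rewrite -neq_ltn; apply: contraNneq xy => E.
by apply/eqP/enum_rank_inj/val_inj.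
Qed.

Lemma arcC x y : arc x y = arc y x.
Proof.
have [->//|xy] := eqVneq x y; rewrite /arc.
by case/orP: (rank_neq xy) => lt; rewrite lt ltnNge (ltnW lt).
Qed.

Lemma inc_arc v x y : inc v (arc x y) = (x == v) || (y == v).
Proof. by rewrite /inc /arc; case: ifP => //=; rewrite orbC. Qed.

Lemma arc_inj x y x' y' : arc x y = arc x' y' ->
  (x = x' /\ y = y') \/ (x = y' /\ y = x').
Proof. by rewrite /arc; case: ifP => _; case: ifP => _ [-> ->]; [left|right|right|left]. Qed.

Lemma mem_arcs r x y : symmetric r -> irreflexive r -> (arc x y \in arcs r) = r x y.
Proof.
move=> rs ri; rewrite inE /arc; have [->|xy] := eqVneq x y.
  by rewrite ltnn /= ri.
case/orP: (rank_neq xy) => lt; first by rewrite lt /= lt andbT.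
have nlt : (enum_rank x < enum_rank y) = false by rewrite ltnNge (ltnW lt).
by rewrite nlt /= lt andbT rs.
Qed.

Lemma arcs_arc r p : p \in arcs r -> p = arc p.1 p.2 /\ r p.1 p.2.
Proof. by rewrite inE /arc => /andP[-> ->]; case: p. Qed.

Lemma dg_nbr r x : symmetric r -> irreflexive r -> dg (arcs r) x = #|nbr r x|.
Proof.
move=> rs ri; rewrite -(@card_in_imset _ _ (arc x) (nbr r x)).
  apply: eq_card => p; rewrite inE; apply/andP/imsetP => [[pA]|[y]].
    have [pE rp] := arcs_arc pA; rewrite /inc => /orP[]/eqP px.
      by exists p.2; rewrite ?inE -px // -pE.
    by exists p.1; rewrite ?inE -px 1?rs // arcC -pE.
  by rewrite inE => rxy ->; rewrite mem_arcs // inc_arc eqxx.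
move=> y z _ _ /arc_inj[[]//|[xz yx]].
by rewrite yx xz.
Qed.

Lemma sum_dg r C : irreflexive r -> C \subset arcs r -> \sum_x dg C x = 2 * #|C|.
Proof.
move=> ri Csub; rewrite /dg.
rewrite (eq_bigr (fun x => \sum_(p in C) if inc x p then 1 else 0)); last first.
  move=> x _; rewrite -big_mkcondr /= -sum1_card; apply: eq_bigl => p.
  by rewrite inE.
rewrite exchange_big /= mulnC -sum_nat_const; apply: eq_bigr => p pC.
have [pE rp] := arcs_arc (subsetP Csub p pC).
have pn : p.1 != p.2 by apply: contraTneq rp => ->; rewrite ri.
rewrite -big_mkcond (bigD1 p.1) /inc ?eqxx //= (big_pred1 p.2) //.
move=> x /=; have [->|ne] := eqVneq x p.1; first by rewrite andbF (negbTE pn).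
by rewrite andbT /= eq_sym.
Qed.

Lemma sum_deg r : symmetric r -> irreflexive r -> \sum_x #|nbr r x| = 2 * #|arcs r|.
Proof. by move=> rs ri; rewrite -(sum_dg ri (subxx _)); apply: eq_bigr => x _; rewrite dg_nbr. Qed.

Definition symdiff C C' : {set T * T} := [set p | (p \in C) (+) (p \in C')].

Lemma odd_dg C x : odd (dg C x) = \big[addb/false]_p ((p \in C) && inc x p).
Proof.
by rewrite /dg odd_card_set big_mkcond; apply: eq_bigr => p _; case: (p \in C).
Qed.

Lemma odd_dg_symdiff C C' x :
  odd (dg (symdiff C C') x) = odd (dg C x) (+) odd (dg C' x).
Proof.
rewrite !odd_dg -big_split; apply: eq_bigr => p _ /=; rewrite inE.
by case: (p \in C); case: (p \in C'); case: (inc x p).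
Qed.

Lemma odd_dg1 x y v : x != y -> odd (dg [set arc x y] v) = (x == v) (+) (y == v).
Proof.
move=> xy; rewrite odd_dg (bigD1 (arc x y)) //= inE eqxx inc_arc /= big1 => [|p /negbTE pn].
  rewrite addbF; have [<-|] //= := eqVneq x v.
  by rewrite eq_sym (negbTE xy).
by rewrite inE pn.
Qed.

(** The first vertex of a longest path has a neighbour other than the second vertex, and by
    maximality it lies on the path. *)
Lemma cycle_of_no_leaf r x0 y0 : symmetric r -> irreflexive r -> r x0 y0 ->
  (forall x y, r x y -> exists2 z, r x z & z != y) ->
  exists2 s, ucycle r s & 3 <= size s.
Proof.
move=> rs ri r0 noleaf.
have [] : exists n, (exists s : seq T, [/\ path r (head x0 s) (behead s), uniq s & size s = n.+2]) /\
    ~ (exists s : seq T, [/\ path r (head x0 s) (behead s), uniq s & size s = n.+3]).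
  apply: contrapT => no.
  have all n : exists s : seq T, [/\ path r (head x0 s) (behead s), uniq s & size s = n.+2].
    elim: n => [|n IHn].
      have xy0 : x0 != y0 by apply: contraTneq r0 => ->; rewrite ri.
      by exists [:: x0; y0]; split; rewrite /= ?r0 ?inE ?xy0.
    apply: contrapT => no'; apply: no; exists n; split=> //.
  have [s [_ us ss]] := all #|T|.
  by have := card_uniqP us; have := max_card (mem s); rewrite ss => + E; rewrite E ltnNge leqnSn.
move=> n [[s [pth us sn]] maxs].
case: s pth us sn => [|x [|y s]] pth us sn; [by [] | by [] |].
move: pth sn => /= /andP[rxy pth] [sn].
have [z rxz zy] := noleaf x y rxy.
have xz : x != z by apply: contraTneq rxz => ->; rewrite ri.
have [zs|zs] := boolP (z \in s); last first.
  case: maxs; exists [:: z, x, y & s]; split; rewrite /= ?sn //.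
    by rewrite rs rxz rxy.
  by rewrite /= in us; rewrite us !inE eq_sym (negbTE xz) (negbTE zy) (negbTE zs).
have [s1 [s2 sE]] : exists s1 s2, s = rcons s1 z ++ s2.
  by case/splitPr: zs => s1 s2; exists s1, s2; rewrite cat_rcons.
subst s; exists [:: x, y & rcons s1 z]; last by rewrite /= size_rcons.
have : uniq ([:: x, y & rcons s1 z] ++ s2) by exact: us.
rewrite cat_uniq => /andP[us' _].
move: pth; rewrite cat_path => /andP[p1 _].
rewrite /ucycle us' andbT /cycle rcons_path /= rxy p1 last_rcons.
by rewrite rs.
Qed.

End ArcDegrees.

Section EvenSets.
Variables (T : finType) (e : rel T).
Hypotheses (e_sym : symmetric e) (e_irr : irreflexive e).
Implicit Types (x y z : T) (p q : T * T) (C B : {set T * T}).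

Definition even_set C : bool := (C \subset arcs e) && [forall x, ~~ odd (dg C x)].

Lemma even_symdiff C C' : even_set C -> even_set C' -> even_set (symdiff C C').
Proof.
move=> /andP[/subsetP Cs /forallP Ce] /andP[/subsetP Cs' /forallP Ce'].
apply/andP; split.
  apply/subsetP => p; rewrite inE.
  by have [/Cs//|_ /= /Cs'//] := boolP (p \in C).
by apply/forallP => x; rewrite odd_dg_symdiff (negbTE (Ce x)) (negbTE (Ce' x)).
Qed.

(** The edges of an even set form a graph without leaves. Each vertex of the cycle has at least two
    of them, so the cycle has at most as many vertices as [C] has edges. *)
Lemma even_cycle C p : even_set C -> p \in C ->
  exists s, [/\ ucycle e s, 3 <= size s, size s <= #|C| &
    cycle (fun x y => arc x y \in C) s].
Proof.
move=> /andP[Csub /forallP Ceven] pC.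
pose r x y := arc x y \in C.
have re x y : r x y -> e x y by move=> /(subsetP Csub); rewrite mem_arcs.
have rs : symmetric r by move=> x y; rewrite /r arcC.
have ri : irreflexive r by move=> x; apply/negP => /re; rewrite e_irr.
have CE : arcs r = C.
  apply/setP => q; apply/idP/idP => [qA|qC].
    by have [qE rq] := arcs_arc qA; rewrite qE.
  by have [qE _] := arcs_arc (subsetP Csub q qC); rewrite qE mem_arcs // /r -qE.
have noleaf x y : r x y -> exists2 z, r x z & z != y.
  move=> rxy; have := Ceven x; rewrite -CE dg_nbr //.
  rewrite (cardsD1 y) inE rxy /= negbK => od.
  have : 0 < #|nbr r x :\ y| by case: #|_| od.
  by case/card_gt0P => z; rewrite !inE => /andP[zy rxz]; exists z.
have [pE rp] : p = arc p.1 p.2 /\ r p.1 p.2.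
  by have [pE _] := arcs_arc (subsetP Csub p pC); rewrite /r -pE.
have [s us s3] := cycle_of_no_leaf rs ri rp noleaf.
have us' : ucycle e s.
  by case/andP: us => cs us; rewrite /ucycle us andbT; apply: sub_cycle cs.
exists s; split=> //; last by case/andP: us.
rewrite -(leq_pmul2l (isT : 0 < 2)) -CE -sum_deg //.
have uniqs : uniq s by case/andP: us.
apply: (@leq_trans (\sum_(x in s) 2)).
  by rewrite sum_nat_const mulnC (card_uniqP uniqs).
rewrite [X in _ <= X](bigID (mem s)) /=; apply: leq_trans (leq_addr _ _).
apply: leq_sum => x xs.
have rnx : r x (next s x) by have := next_cycle (proj1 (andP us)) xs.
have [z rxz zn] := noleaf x _ rnx.
rewrite (cardsD1 z) inE rxz (cardsD1 (next s x)) !inE rnx eq_sym zn.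
by [].
Qed.

Definition tri_set x y z : {set T * T} := [set arc x y; arc y z; arc z x].

Lemma tri_arcs x y z : e x y -> e y z -> e z x ->
  [/\ arc x y != arc y z, arc x y != arc z x & arc y z != arc z x].
Proof.
move=> /(edge_neq e_irr) xy /(edge_neq e_irr) yz /(edge_neq e_irr) zx.
by split; apply/eqP => /arc_inj[][E1 E2]; move: xy yz zx; rewrite ?E1 ?E2 ?eqxx // -?E1 -?E2 ?eqxx.
Qed.

Lemma card_tri x y z : e x y -> e y z -> e z x -> #|tri_set x y z| = 3.
Proof.
move=> exy eyz ezx; have [h1 h2 h3] := tri_arcs exy eyz ezx.
rewrite /tri_set setUC cardsU1 cards2 !inE h1 (eq_sym _ (arc x y)) (negbTE h2).
by rewrite eq_sym (negbTE h3).
Qed.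

Lemma even_tri x y z : e x y -> e y z -> e z x -> even_set (tri_set x y z).
Proof.
move=> exy eyz ezx; apply/andP; split.
  apply/subsetP => p; rewrite /tri_set !in_setU !in_set1 -orbA => /or3P[]/eqP->;
  by rewrite mem_arcs.
apply/forallP => v; have [h1 h2 h3] := tri_arcs exy eyz ezx.
have -> : tri_set x y z =
    symdiff (symdiff [set arc x y] [set arc y z]) [set arc z x].
  apply/setP => p; rewrite !inE; have [->|] := eqVneq p (arc x y).
    by rewrite (negbTE h1) (negbTE h2).
  by have [->|] := eqVneq p (arc y z); rewrite ?(negbTE h3).
rewrite !odd_dg_symdiff !odd_dg1 ?(edge_neq e_irr) //.
by case: (x == v); case: (y == v); case: (z == v).
Qed.

Hypothesis no45 : forall s, ucycle e s -> 3 <= size s -> size s = 3 \/ 6 <= size s.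

(** With fewer than six edges the cycle found in [C] is a triangle. Removing it leaves an even set
    of fewer than three edges, which is empty because a nonempty one would contain a cycle. *)
Lemma even_small C : even_set C -> C != set0 -> 3 <= #|C| /\
  (#|C| < 6 -> exists x y z, [/\ e x y, e y z, e z x & C = tri_set x y z]).
Proof.
move=> evC /set0Pn[p pC]; have [s [us s3 sC cs]] := even_cycle evC pC.
split; first exact: leq_trans s3 sC.
move=> C6; have ss : size s = 3.
  by case: (no45 us s3) => // s6; have := leq_trans s6 sC; rewrite leqNgt C6.
case: s us s3 sC cs ss => [|x [|y [|z [|? ?]]]] // us _ _ /and4P[xyC yzC zxC _] _.
have Csub := andP evC; have inE' a b : arc a b \in C -> e a b.
  by move=> /(subsetP Csub.1); rewrite mem_arcs.
have [[exy eyz] ezx] := (inE' _ _ xyC, inE' _ _ yzC, inE' _ _ zxC).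
exists x, y, z; split=> //.
have tC : tri_set x y z \subset C.
  by apply/subsetP => q; rewrite !inE -orbA => /or3P[]/eqP->.
apply/eqP; rewrite eqEsubset tC andbT; apply/subsetP => q qC.
apply: contraT => qt.
have evD := even_symdiff evC (even_tri exy eyz ezx).
have [|s' [_ s'3 s'D _]] := even_cycle evD (p := q); first by rewrite inE qC (negbTE qt).
have := leq_trans s'3 s'D; have -> : symdiff C (tri_set x y z) = C :\: tri_set x y z.
  apply/setP => a; rewrite in_setD inE; have := subsetP tC a.
  by case: (a \in C); case: (a \in tri_set x y z) => // /(_ isT).
by rewrite cardsD (setIidPr tC) card_tri //; clear -C6; lia.
Qed.

(** * Faces and their span *)

Section Span.
(* [s0 p] and [s1 p] are the two faces on the sides of the edge [p]; [R]
   relates adjacent squares lying in the same face. *)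
Variables (Sq : Type) (s0 s1 : T * T -> Sq) (R : Sq -> Sq -> Prop).
Hypothesis boundary_even : forall h : Sq -> bool, (forall s s', R s s' -> h s = h s') ->
  forall x, ~~ odd #|[set p in arcs e | (h (s0 p) != h (s1 p)) && inc x p]|.
Hypothesis even_boundary : forall C, C \subset arcs e ->
  (forall x, ~~ odd #|[set p in C | inc x p]|) ->
  exists2 h : Sq -> bool, (forall s s', R s s' -> h s = h s') &
    forall p, p \in arcs e -> (h (s0 p) != h (s1 p)) = (p \in C).

Let dart := (T * T * bool)%type.
Let sq (d : dart) : Sq := if d.2 then s1 d.1 else s0 d.1.
Let adm (h : Sq -> bool) : Prop := forall s s', R s s' -> h s = h s'.
(** Two sides are in the same face when no invariant function separates them, which replaces
    connectedness of the region. *)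
Let eqv (d d' : dart) : bool := `[< forall h, adm h -> h (sq d) = h (sq d') >].

Let eqv_refl d : eqv d d. Proof. exact/asboolP. Qed.
Let eqv_sym d d' : eqv d d' = eqv d' d.
Proof. by apply/asboolP/asboolP => E h /E. Qed.
Let eqv_trans d d' d'' : eqv d d' -> eqv d' d'' -> eqv d d''.
Proof. by move=> /asboolP E /asboolP E'; apply/asboolP => h ah; rewrite E ?E'. Qed.
Let eqvE d d' d'' : eqv d d' -> eqv d d'' = eqv d' d''.
Proof.
move=> E; apply/idP/idP; first by apply: eqv_trans; rewrite eqv_sym.
exact: eqv_trans.
Qed.

Let face (d : dart) : {set T * T} :=
  [set p in arcs e | eqv d (p, false) != eqv d (p, true)].
Definition faces : {set {set T * T}} := [set face d | d : dart] :\ set0.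

Lemma faces_even B : B \in faces -> even_set B /\ B != set0.
Proof.
rewrite in_setD1 => /andP[B0 /imsetP[d _ BE]]; split=> //; rewrite BE.
apply/andP; split; first by apply/subsetP => p; rewrite inE => /andP[].
(* The class of [d], extended to all squares, is an invariant function and so has an even
   boundary. *)
apply/forallP => x; pose o s := `[< forall h, adm h -> h (sq d) = h s >].
have := @boundary_even o _ x; rewrite /dg.
rewrite (eq_card (B := [set p in face d | inc x p])); last first.
  by move=> p; rewrite [RHS]in_set /face [X in _ = X && _]in_set -andbA [LHS]in_set.
apply=> s s' Rs; apply/asboolP/asboolP => E h ah; first by rewrite -(ah _ _ Rs) E.
by rewrite (ah _ _ Rs) E.
Qed.

Let face_mem d p : p \in face d -> face d = face (p, false) \/ face d = face (p, true).
Proof.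
have fE d' : eqv d d' -> face d = face d'.
  by move=> E; apply/setP => q; rewrite !inE !(eqvE _ E).
by rewrite inE => /andP[_]; case f0: (eqv d _); case f1: (eqv d _) => // _;
  [left | right]; apply: fE.
Qed.

(** An edge can only lie on the boundaries of the classes of its own two sides. *)
Lemma sum_faces : \sum_(B in faces) #|B| <= 2 * #|arcs e|.
Proof.
rewrite mulnC -sum_nat_const.
rewrite (eq_bigr (fun B => \sum_(p in arcs e) (p \in B))); last first.
  move=> B /faces_even[/andP[/subsetP Bs _] _]; rewrite -sum1_card.
  rewrite [RHS](eq_bigr (fun p => if p \in B then 1 else 0)) // -big_mkcondr.
  by apply: eq_bigl => p; case pB: (p \in B); rewrite ?andbF // Bs.
rewrite exchange_big /=; apply: leq_sum => p pA.
rewrite -big_mkcondr /= sum1_card.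
apply: (@leq_trans #|[set face (p, false); face (p, true)]|).
  apply/subset_leq_card/subsetP => B /andP[]; rewrite in_setD1 in_set2 => /andP[_ /imsetP[d _ ->]].
  by move=> /face_mem[->|->]; rewrite eqxx ?orbT.
by rewrite cards2; case: eqP.
Qed.

Let repr (d : dart) : dart := odflt d [pick d' | eqv d d'].
Let repr_eqv d : eqv d (repr d).
Proof. by rewrite /repr; case: pickP => [d'|]. Qed.
Let repr_eq d d' : eqv d d' -> repr d = repr d'.
Proof.
move=> E; rewrite /repr (eq_pick (fun d0 => eqvE d0 E)).
by case: pickP => // /(_ d'); rewrite eqv_refl.
Qed.

Definition span_sum (K : {set {set T * T}}) : {set T * T} :=
  [set p in arcs e | odd #|[set B in K | p \in B]|].

(** The boundaries of the classes on which [h] is true add up to [C]: an edge is counted once for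
    each of its sides with [h] true. *)
Lemma faces_span C : even_set C -> exists2 K : {set {set T * T}},
  K \subset faces & C = span_sum K.
Proof.
move=> /andP[Csub /forallP Cev]; have [h ah hC] := even_boundary Csub Cev.
pose rts := [pred d : dart | (repr d == d) && h (sq d)].
(* Different classes may have the same boundary, so a boundary is selected by the parity of the
   number of such classes. *)
pose K := [set B in faces | odd #|[set d in rts | face d == B]|].
exists K; first by apply/subsetP => B; rewrite inE => /andP[].
apply/setP => p; rewrite [RHS]inE; have [pA|pA] := boolP (p \in arcs e); last first.
  by apply/negbTE; apply: contra pA => /(subsetP Csub).
rewrite -hC //= odd_card_set.
have -> : \big[addb/false]_(B in K) (p \in B) =
    \big[addb/false]_(B in faces) \big[addb/false]_(d in rts | face d == B) (p \in face d).
  rewrite (eq_bigl (fun B => (B \in faces) && odd #|[set d in rts | face d == B]|)); last first.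
    by move=> B; rewrite inE.
  rewrite big_mkcondr; apply: eq_bigr => B Bf.
  rewrite (eq_bigr (fun d => (p \in B) && true)); last first.
    by move=> d /andP[_ /eqP->]; rewrite andbT.
  rewrite big_addb_and odd_card (eq_bigl (fun d => (d \in rts) && (face d == B))); last first.
    by move=> d; rewrite inE.
  by case: (p \in B) => //=; case: (\big[_/_]_(_ | _) _).
have -> : \big[addb/false]_(B in faces) \big[addb/false]_(d in rts | face d == B)
    (p \in face d) = \big[addb/false]_(d in rts) (p \in face d).
  rewrite (exchange_big_dep (mem rts)) /=; last by move=> B d _ /andP[].
  apply: eq_bigr => d dr; have [f0|f0] := eqVneq (face d) set0.
    by rewrite f0 !in_set0 big1.
  rewrite (big_pred1 (face d)) // => B /=; rewrite dr /= eq_sym.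
  have [->|] := eqVneq B (face d); rewrite ?andbF //.
  by rewrite !inE f0 imset_f.
have sumr (d0 : dart) : \big[addb/false]_(d in rts) eqv d d0 = h (sq d0).
  have hr : h (sq (repr d0)) = h (sq d0).
    by have /asboolP/(_ h ah)-> := repr_eqv d0.
  have rr : repr (repr d0) = repr d0 by apply/esym/repr_eq/repr_eqv.
  have urep d : d \in rts -> eqv d d0 -> d = repr d0.
    by rewrite inE => /andP[/eqP <- _] E; apply: repr_eq; exact: eqv_trans (repr_eqv d) E.
  have [hx|hx] := boolP (h (sq d0)); last first.
    rewrite big1 // => d dr; apply/negbTE; apply: contra hx => /(urep d dr) dE.
    by move: dr; rewrite inE dE hr => /andP[].
  rewrite (bigD1 (repr d0)) /=; last by rewrite inE rr eqxx hr hx.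
  rewrite eqv_sym repr_eqv big1 // => d /andP[dr ne].
  by apply/negbTE; apply: contra ne => /(urep d dr)->.
rewrite (eq_bigr (fun d => eqv d (p, false) (+) eqv d (p, true))); last first.
  by move=> d _; rewrite inE pA; case: (eqv d _); case: (eqv d _).
rewrite big_split /= !sumr /sq /=.
by case: (h _); case: (h _).
Qed.

End Span.

(** * Counting even sets and Euler's inequality *)

Section Bound.
Variable H : {set T}.
Hypotheses (H0 : H != set0) (eH : forall x y, e x y -> x \in H).
Hypothesis noC4 : forall a b c d, e a b -> e b c -> e c d -> e d a ->
  a != c -> b != d -> False.
Variable D : {set {set T * T}}.
Hypothesis D_even : forall B, B \in D -> even_set B /\ B != set0.
Hypothesis D_sum : \sum_(B in D) #|B| <= 2 * #|arcs e|.
Hypothesis D_span : forall C, even_set C -> exists2 K : {set {set T * T}},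
  K \subset D & C = span_sum K.

(* A set of edges is determined by an even set and the parities of its degrees,
   and the last parity is determined by the others. *)
Lemma card_even : 2 ^ #|arcs e| <= 2 ^ #|H|.-1 * #|[set C | even_set C]|.
Proof.
have [v vH] := set0Pn _ H0.
pose par C := [set x in H | odd (dg C x)] :\ v.
(* A fixed set of edges with the prescribed parities; the default is never reached when these
   parities occur. *)
pose rep P := odflt set0 [pick C in powerset (arcs e) | par C == P].
pose f C := (par C, symdiff C (rep (par C))).
have repP C : C \in powerset (arcs e) -> rep (par C) \in powerset (arcs e) /\
    par (rep (par C)) = par C.
  move=> CA; rewrite /rep; case: pickP => [C' /andP[C'A /eqP]//|/(_ C)].
  by rewrite CA eqxx.
have odd0 C x : C \subset arcs e -> x \notin H -> dg C x = 0.
  move=> CA xH; apply: eq_card0 => p; rewrite inE; apply/negP => /andP[/(subsetP CA)].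
  move=> /arcs_arc[_ ep] /orP[]/eqP px; move: xH; rewrite -px ?(eH ep) //.
  by rewrite e_sym in ep; rewrite (eH ep).
have sumodd C : C \subset arcs e -> \big[addb/false]_(x in H) odd (dg C x) = false.
  move=> CA; have := sum_dg e_irr CA.
  move=> /(congr1 odd); rewrite oddM /= (big_morph odd oddD (erefl : odd 0 = false)) => E.
  transitivity (\big[addb/false]_x odd (dg C x)); last exact: E.
  rewrite [RHS](bigID (mem H)) /= [X in _ = _ (+) X]big1 ?addbF // => x xH.
  by rewrite odd0.
have evf C : C \in powerset (arcs e) -> even_set (symdiff C (rep (par C))).
  move=> CA; have [RA RE] := repP C CA; rewrite powersetE in CA; rewrite powersetE in RA.
  apply/andP; split.
    apply/subsetP => p; rewrite inE.
    by have [/(subsetP CA)//|_ /= /(subsetP RA)//] := boolP (p \in C).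
  have eqx x : x != v -> odd (dg C x) = odd (dg (rep (par C)) x).
    move=> xv; have [xH|xH] := boolP (x \in H); last by rewrite !odd0.
    by move/setP/(_ x): RE; rewrite !inE xv xH.
  apply/forallP => x; rewrite odd_dg_symdiff negb_add.
  have [->|/eqx->//] := eqVneq x v.
  have := sumodd _ CA; have := sumodd _ RA; rewrite !(bigD1 v vH) /=.
  rewrite [X in _ (+) X = _ -> _](eq_bigr (fun x => odd (dg C x))); last first.
    by move=> y /andP[_ /eqx].
  by case: (odd _); case: (odd _); case: (\big[_/_]_(_ | _) _).
have injf : {in powerset (arcs e) &, injective f}.
  move=> C C' _ _ [pE sE]; rewrite pE in sE; apply/setP => p.
  move/setP/(_ p): sE; rewrite !inE.
  by case: (p \in C); case: (p \in C'); case: (p \in rep _).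
rewrite -card_powerset -(card_in_imset injf).
have -> : #|H|.-1 = #|H :\ v| by rewrite (cardsD1 v H) vH.
rewrite -card_powerset -cardsX; apply/subset_leq_card/subsetP => _ /imsetP[C CA ->].
rewrite !inE /= evf // andbT; apply/subsetP => x; rewrite !inE.
by move=> /and3P[-> ->].
Qed.

(** As [D] spans the even sets, there are at most 2 ^ |D| of them. *)
Lemma card_arcs_le : #|arcs e| <= #|H|.-1 + #|D|.
Proof.
rewrite -(leq_exp2l _ _ (isT : 1 < 2)) expnD; apply: leq_trans card_even _.
rewrite leq_mul2l; apply/orP; right; rewrite -card_powerset.
apply: leq_trans (leq_imset_card span_sum (powerset D)).
apply/subset_leq_card/subsetP => C; rewrite inE => /D_span[K KD ->].
by apply: imset_f; rewrite powersetE.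
Qed.

Definition tri_rel : rel T := fun x y => e x y && [exists z, e x z && e y z].

(** Let m be the number of edges. Triangles in [D] are edge-disjoint, because two on a common edge
    give a 4-cycle, and the other members of [D] have at least six edges. So 6 |D| <= 2 m + 3 k for
    the number k of these triangles, and 3 k is at most the number of edges lying in triangles.
    Eliminating |D| leaves 4 m <= 6 |H| - 6 + 3 k; the sums count every edge twice. *)
Lemma sparse_bound : 4 * (\sum_x #|nbr e x|) < 12 * #|H| + \sum_x #|nbr tri_rel x|.
Proof.
have t_sym : symmetric tri_rel.
  move=> x y; rewrite /tri_rel e_sym; congr (_ && _).
  by apply: eq_existsb => z; rewrite andbC.
have t_irr : irreflexive tri_rel by move=> x; rewrite /tri_rel e_irr.
rewrite !sum_deg //; pose tri := [set B in D | #|B| < 6].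
have triP B : B \in tri -> exists x y z, [/\ e x y, e y z, e z x & B = tri_set x y z].
  rewrite inE => /andP[/D_even[ev B0] B6].
  by have [_ /(_ B6)] := even_small ev B0.
have c3 : 3 * #|tri| <= #|arcs tri_rel|.
  have tE x y z p : e x y -> e y z -> e z x -> p \in tri_set x y z ->
      exists t, [/\ e p.1 p.2, e p.1 t, e p.2 t & tri_set x y z = tri_set p.1 p.2 t].
    move=> exy eyz ezx pt; have key a b c : e a b -> e b c -> e c a -> p = arc a b ->
        exists t, [/\ e p.1 p.2, e p.1 t, e p.2 t & tri_set a b c = tri_set p.1 p.2 t].
      move=> eab ebc eca ->; exists c; rewrite /arc; case: ifP => _ /=.
        by split=> //; rewrite e_sym.
      split=> //; try by rewrite e_sym.
      rewrite /tri_set (arcC a b) (arcC b c) (arcC c a); apply/setP => q.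
      by rewrite !inE; do 3![case: (q == _)].
    move: pt; rewrite !inE -orbA => /or3P[]/eqP pE.
    - exact: key.
    - have -> : tri_set x y z = tri_set y z x.
        by apply/setP => q; rewrite !inE; do 3![case: (q == _)].
      exact: key.
    - have -> : tri_set x y z = tri_set z x y.
        by apply/setP => q; rewrite !inE; do 3![case: (q == _)].
      exact: key.
  have triv : trivIset tri.
    apply/trivIsetP => B B' Bt B't; apply: contraR; rewrite -setI_eq0 => /set0Pn[p].
    rewrite inE => /andP[pB pB'].
    have [x [y [z [exy eyz ezx BE]]]] := triP B Bt.
    have [x' [y' [z' [exy' eyz' ezx' BE']]]] := triP B' B't.
    rewrite BE in pB; rewrite BE' in pB'.
    have [t [e1 e2 e3 tt]] := tE _ _ _ _ exy eyz ezx pB.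
    have [t' [e1' e2' e3' tt']] := tE _ _ _ _ exy' eyz' ezx' pB'.
    rewrite BE BE' tt tt'; suff -> : t = t' by [].
    apply/eqP/negPn/negP => ne; apply: (@noC4 t p.1 t' p.2) => //; rewrite 1?e_sym //.
    exact: (edge_neq e_irr).
  rewrite mulnC -sum_nat_const (eq_bigr (fun B : {set T * T} => #|B|)); last first.
    by move=> B /triP[x [y [z [exy eyz ezx ->]]]]; rewrite card_tri.
  move/eqP: triv => ->; apply/subset_leq_card/subsetP => p /bigcupP[B Bt pB].
  have [x [y [z [exy eyz ezx BE]]]] := triP B Bt; rewrite BE in pB.
  have [t [e1 e2 e3 _]] := tE _ _ _ _ exy eyz ezx pB.
  have : p \in arcs e.
    move: Bt; rewrite inE => /andP[/D_even[/andP[/subsetP Bs _] _] _].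
    by apply: Bs; rewrite BE.
  rewrite !inE /tri_rel => /andP[-> ->]; rewrite andbT /=.
  by apply/existsP; exists t; rewrite e2.
have c6 : 6 * #|D| <= 2 * #|arcs e| + 3 * #|tri|.
  apply: leq_trans (_ : \sum_(B in D) #|B| + 3 * #|tri| <= _); last by rewrite leq_add2r.
  rewrite mulnC -sum_nat_const.
  have -> : 3 * #|tri| = \sum_(B in D) if #|B| < 6 then 3 else 0.
    rewrite -big_mkcondr /= mulnC -sum_nat_const; apply: eq_bigl => B.
    by rewrite inE.
  rewrite -big_split /=; apply: leq_sum => B /D_even[ev B0].
  have [B3 _] := even_small ev B0; case: (ltnP #|B| 6) => [_|]; last by rewrite addn0.
  by rewrite -[6]/(3 + 3) leq_add2r.
have H1 : 0 < #|H| by apply/card_gt0P/set0Pn.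
by have := card_arcs_le; move: c3 c6 H1; clear; lia.
Qed.

End Bound.
End EvenSets.

(** * From a drawing to a labelled grid *)

Section Discrete.
Variables (T : finType) (e : rel T).
Hypothesis e_irr : irreflexive e.
Hypothesis e_sym : symmetric e.
Implicit Types (x y : T) (p q : T * T) (P : point).

Definition nearby (a b : point) : bool :=
  [&& a.1 <= b.1.+1, b.1 <= a.1.+1, a.2 <= b.2.+1 & b.2 <= a.2.+1].
(** Inserting corners displaces a point by at most one in each coordinate, and a gap of 3 survives
    this on both sides. *)
Definition apart (a b : point) : bool :=
  [|| a.1 + 3 <= b.1, b.1 + 3 <= a.1, a.2 + 3 <= b.2 | b.2 + 3 <= a.2].

(* The first and last thirds of an edge belong to its ends, the middle third to
   the edge itself. *)
Definition owner m p k : T + T * T :=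
  if k <= m then inl p.1 else if 2 * m <= k then inl p.2 else inr p.
(** The middle third of an edge may come close to the parts owned by its own ends, so this is no
    conflict. *)
Definition conflict (o o' : T + T * T) : bool :=
  match o, o' with
  | inl x, inl y => x != y
  | inl x, inr p | inr p, inl x => ~~ inc x p
  | inr p, inr q => p != q
  end.

Variables (m N : nat) (c : T * T -> nat -> point) (rt : T -> point).
Hypothesis m_gt0 : 0 < m.
Hypothesis c0 : forall p, p \in arcs e -> c p 0 = rt p.1.
Hypothesis c3 : forall p, p \in arcs e -> c p (3 * m) = rt p.2.
Hypothesis c_close : forall p k, p \in arcs e -> k < 3 * m -> nearby (c p k) (c p k.+1).
Let inN (a : point) : bool := (0 < a.1 < N) && (0 < a.2 < N).
Hypothesis rt_in : forall x, inN (rt x).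
Hypothesis c_in : forall p k, p \in arcs e -> k <= 3 * m -> inN (c p k).
Hypothesis rt_apart : forall x y, x != y -> apart (rt x) (rt y).
Hypothesis rt_c_apart : forall x p k, p \in arcs e -> k <= 3 * m ->
  conflict (inl x) (owner m p k) -> apart (rt x) (c p k).
Hypothesis c_apart : forall p q k l, p \in arcs e -> q \in arcs e ->
  k <= 3 * m -> l <= 3 * m -> conflict (owner m p k) (owner m q l) ->
  apart (c p k) (c q l).

(** A corner is inserted between consecutive sample points, whose rounded positions may be diagonal
    neighbours. *)
Let w p i : point := if odd i then ((c p (i./2).+1).1, (c p i./2).2) else c p i./2.

Let w_step p i : p \in arcs e -> i < 6 * m -> step (w p i) (w p i.+1).
Proof.
move=> pA i6; have k3 : i./2 < 3 * m by lia.
have := c_close pA k3; rewrite /w /= uphalf_half.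
case: (odd i) => /=.
  rewrite add1n; case: (c p i./2) => a b; case: (c p (i./2).+1) => a' b'.
  by rewrite /nearby /step /= !xpair_eqE eqxx /=; lia.
rewrite add0n; case: (c p i./2) => a b; case: (c p (i./2).+1) => a' b'.
by rewrite /nearby /step /= !xpair_eqE eqxx /=; lia.
Qed.

Let w_close p i : p \in arcs e -> i <= 6 * m -> nearby (w p i) (c p i./2).
Proof.
move=> pA i6; rewrite /w; case: ifP => [oi|_]; last first.
  by rewrite /nearby; lia.
have k3 : i./2 < 3 * m by lia.
have := c_close pA k3; case: (c p i./2) => a b; case: (c p (i./2).+1) => a' b'.
by rewrite /nearby /=; lia.
Qed.

Let w_in p i : p \in arcs e -> i <= 6 * m -> inN (w p i).
Proof.
move=> pA i6; have k3 : i./2 <= 3 * m by lia.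
have := c_in pA k3; rewrite /w; case: ifP => // oi.
have k3' : i./2 < 3 * m by lia.
have := c_in pA k3'; case: (c p i./2) => a b; case: (c p (i./2).+1) => a' b'.
by rewrite /inN /=; lia.
Qed.

Let close_apart (a b b' : point) : nearby a b -> nearby a b' -> apart b b' -> False.
Proof.
by case: a b b' => [a1 a2] [b1 b2] [d1 d2]; rewrite /nearby /apart /=; lia.
Qed.

Let close_refl (a : point) : nearby a a. Proof. by rewrite /nearby; lia. Qed.

Let w_conflict p q i j : p \in arcs e -> q \in arcs e -> i <= 6 * m -> j <= 6 * m ->
  w p i = w q j -> ~~ conflict (owner m p i./2) (owner m q j./2).
Proof.
move=> pA qA i6 j6 E; apply/negP => /(c_apart pA qA)-/(_ _ _)h.
apply: (close_apart (w_close pA i6) (b' := c q j./2)); first by rewrite E w_close.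
by apply: h; lia.
Qed.

Let rt_conflict x q j : q \in arcs e -> j <= 6 * m -> rt x = w q j ->
  ~~ conflict (inl x) (owner m q j./2).
Proof.
move=> qA j6 E; apply/negP => /(rt_c_apart qA)-/(_ _)h.
apply: (close_apart (close_refl (rt x)) (b' := c q j./2)); first by rewrite E w_close.
by apply: h; lia.
Qed.

(** The points certain to belong to [x], as opposed to those of the middle thirds, which have yet to
    be divided. *)
Let U0 x P : Prop := P = rt x \/ exists p i,
  [/\ p \in arcs e, i <= 6 * m, w p i = P & owner m p i./2 = inl x].

Let U0_inj x y P : U0 x P -> U0 y P -> x = y.
Proof.
move=> [->|[p [i [pA i6 wp op]]]] [yP|[q [j [qA j6 wq oq]]]].
- apply/eqP; apply: contraT => xy; have := rt_apart xy; rewrite -yP.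
  by rewrite /apart; lia.
- by have := rt_conflict qA j6 (esym wq); rewrite oq /= negbK => /eqP.
- by have := rt_conflict (x := y) pA i6; rewrite wp yP op /= negbK => /(_ erefl)/eqP.
- by have := w_conflict pA qA i6 j6; rewrite wp wq op oq /= negbK => /(_ erefl)/eqP.
Qed.

Let hit p : p \in arcs e -> exists i, `[< U0 p.2 (w p i) >].
Proof.
move=> pA; exists (6 * m); apply/asboolP; left.
have h1 : odd (6 * m) = false by lia.
have h2 : (6 * m)./2 = 3 * m by lia.
by rewrite /w h1 h2 c3.
Qed.

Let w0 p : p \in arcs e -> w p 0 = rt p.1. Proof. by move=> pA; rewrite /w /= c0. Qed.
Let w6 p : p \in arcs e -> w p (6 * m) = rt p.2.
Proof.
move=> pA; have h1 : odd (6 * m) = false by lia.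
have h2 : (6 * m)./2 = 3 * m by lia.
by rewrite /w h1 h2 c3.
Qed.

(** The walk of [p] is given to [p.1] until it meets the territory of [p.2] for the first time. The
    step taken there is the adjacency that represents the edge. *)
Let first_ex : exists first : T * T -> nat, forall p, p \in arcs e ->
  [/\ 0 < first p <= 6 * m, U0 p.2 (w p (first p)) &
      forall i, i < first p -> ~ U0 p.2 (w p i)].
Proof.
suff /choice[first h] : forall p, exists n, p \in arcs e -> [/\ 0 < n <= 6 * m,
    U0 p.2 (w p n) & forall i, i < n -> ~ U0 p.2 (w p i)] by exists first.
move=> p; have [pA|_] := boolP (p \in arcs e); last by exists 0.
have [n hn min] := ex_minnP (hit pA); exists n => _; split.
- apply/andP; split; last by apply: min; apply/asboolP; left; apply: w6.
  rewrite lt0n; apply: contraTneq hn => ->; apply/asboolP => h.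
  have /eqP := U0_inj h (or_introl (w0 pA)).
  by apply/negP; rewrite eq_sym (arcs_neq e_irr pA).
- exact/asboolP.
- by move=> i ni h; have := min i (asboolT h); rewrite leqNgt ni.
Qed.

Lemma path_of (f : nat -> point) n : (forall i, i < n -> step (f i) (f i.+1)) ->
  path step (f 0) (map f (iota 1 n)) /\ last (f 0) (map f (iota 1 n)) = f n.
Proof.
elim: n => [|n IHn] st //; have [|p l] := IHn; first by move=> i ni; apply/st/ltnW.
by rewrite -(addn1 n) iotaD map_cat cat_path last_cat /= p l !add1n andbT addn1 st.
Qed.

Lemma step_sym (a b : point) : step a b = step b a.
Proof.
by rewrite /step eq_sym (eq_sym a.1) (eq_sym a.2) (orbC (_ == b.2)) (orbC (_ == b.1)).
Qed.

Lemma discrete_model : exists lab, grid_labelling e lab rt N.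
Proof.
have [first firstP] := first_ex.
pose U x P := U0 x P \/ exists p i, [/\ p \in arcs e, p.1 = x, i < first p & w p i = P].
have i6 p i : p \in arcs e -> i < first p -> i <= 6 * m.
  by move=> /firstP[/andP[_ f6] _ _] /ltnW h; apply: leq_trans h f6.
have own p i : p \in arcs e -> i < first p -> owner m p i./2 = inl p.1 \/
    owner m p i./2 = inr p.
  move=> pA ip; have [_ _ nh] := firstP p pA.
  have := nh i ip; rewrite /owner; case: ifP => [_ _|_]; first by left.
  case: ifP => [h2|_]; last by right.
  case; right; exists p, i; split=> //; first exact: i6 pA ip.
  rewrite /owner h2; case: ifP => // h1; lia.
(* Points of a middle third can only meet the territory of an end of the edge, and before [first p]
   this is not [p.2]. *)
have prefix0 x P p i : U0 x P -> p \in arcs e -> i < first p -> w p i = P -> x = p.1.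
  move=> ux pA ip wp; have [_ _ nh] := firstP p pA.
  have i6' := i6 p i pA ip.
  case: (own p i pA ip) => op; first by apply: U0_inj ux _; right; exists p, i.
  have ninc : ~~ conflict (inl x) (inr p).
    case: ux => [PE|[q [j [qA j6 wq oq]]]]; rewrite -op.
      by apply: rt_conflict => //; rewrite -PE.
    by rewrite -oq; apply: w_conflict => //; rewrite wq.
  move: ninc; rewrite /= negbK => /orP[]/eqP // E.
  by case: (nh i ip); rewrite E wp.
have Uinj x y P : U x P -> U y P -> x = y.
  move=> [ux|[p [i [pA <- ip wp]]]] [uy|[q [j [qA <- jq wq]]]].
  - exact: U0_inj ux uy.
  - exact: prefix0 ux qA jq wq.
  - by apply/esym; apply: prefix0 uy pA ip wp.
  - have [i6p j6q] := (i6 _ _ pA ip, i6 _ _ qA jq).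
    case: (own p i pA ip) => op.
      by apply: prefix0 qA jq wq; right; exists p, i.
    case: (own q j qA jq) => oq.
      by apply/esym; apply: prefix0 pA ip wp; right; exists q, j.
    have := w_conflict pA qA i6p j6q; rewrite wp wq op oq /= negbK.
    by move=> /(_ erefl)/eqP->.
pose lab P := [pick x | `[< U x P >]].
have labP P x : lab P = Some x <-> U x P.
  rewrite /lab; case: pickP => [y /asboolP uy|no]; split=> //.
  - by case=> <-.
  - by move=> ux; rewrite (Uinj _ _ _ ux uy).
  - by move=> ux; have := no x; rewrite asboolT.
exists lab; split.
- move=> P; case lP: (lab P) => [x|//] _.
  case/labP: lP => [[->|[p [i [pA ip <- _]]]]|[p [i [pA _ ip <-]]]].
  + exact: rt_in.
  + exact: w_in.
  + exact: (w_in pA (i6 _ _ pA ip)).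
- have conn x (f : nat -> point) n : f 0 = rt x -> (forall i, i < n -> step (f i) (f i.+1)) ->
      (forall i, i <= n -> U x (f i)) -> exists s, [/\ path step (rt x) s,
        last (rt x) s = f n & all (fun Q => lab Q == Some x) (rt x :: s)].
    move=> f0 st uf; have [pt la] := path_of st; rewrite f0 in pt la.
    exists (map f (iota 1 n)); split=> //=; rewrite -{1}f0.
    apply/andP; split; first by apply/eqP/labP/uf.
    apply/allP => Q /mapP[i]; rewrite mem_iota => /andP[_ ni] ->.
    by apply/eqP/labP/uf; rewrite -ltnS -add1n.
  move=> P x /labP[[->|[p [i [pA ip <- op]]]]|[p [i [pA <- ip <-]]]].
  + exists [::]; split=> //=; rewrite andbT; apply/eqP/labP; left.
    by left.
  + move: op; rewrite /owner; case: ifP => [im [px]|mi].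
      rewrite -px; apply: (conn _ (w p)) => [|j ji|j ji].
      * exact: w0.
      * by apply: w_step => //; apply: leq_trans ji ip.
      * left; right; exists p, j; split=> //; first exact: leq_trans ji ip.
        by rewrite /owner (leq_trans _ im) ?half_leq.
    (* In the last third the walk leads on to the root of [p.2], so the path from this root follows
       it backwards. *)
    case: ifP => // mi2 [px]; rewrite -px.
    have [] := conn p.2 (fun j => w p (6 * m - j)) (6 * m - i).
    * by rewrite subn0 w6.
    * move=> j ji; rewrite step_sym (_ : 6 * m - j = (6 * m - j.+1).+1); last by lia.
      by apply: w_step => //; lia.
    * move=> j ji; left; right; exists p, (6 * m - j); split=> //; first by lia.
      rewrite /owner; have h : i <= 6 * m - j by lia.
      have h2 := half_leq h; rewrite (leq_trans mi2 h2).
      by case: ifP => // h3; lia.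
    * by move=> s; rewrite subKn // => hs; exists s.
  + apply: (conn _ (w p)) => [|j ji|j ji].
    * exact: w0.
    * by apply: w_step => //; apply: leq_trans ji (i6 _ _ pA ip).
    * by right; exists p, j; split=> //; apply: leq_ltn_trans ji ip.
have main p : p \in arcs e -> exists a : point * point,
    [/\ step a.1 a.2, lab a.1 = Some p.1 & lab a.2 = Some p.2].
  move=> pA; have [/andP[f0 f6] hf nh] := firstP p pA.
  exists (w p (first p).-1, w p (first p)); split=> /=.
  + by rewrite -{2}(prednK f0); apply: w_step; rewrite // prednK.
  + by apply/labP; right; exists p, (first p).-1; split=> //; rewrite prednK.
  + by apply/labP; left.
move=> x y exy; have xy : x != y by apply: contraTneq exy => ->; rewrite e_irr.
have [lt|ge] := ltnP (enum_rank x) (enum_rank y).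
  by apply: (main (x, y)); rewrite inE exy.
have yxA : (y, x) \in arcs e.
  rewrite inE /= e_sym exy ltn_neqAle ge andbT; apply: contraNneq xy => E.
  by apply/eqP/enum_rank_inj/val_inj.
have [[a b] [st la lb]] := main _ yxA.
by exists (b, a); split=> //; rewrite step_sym.
Qed.

End Discrete.

(** * Compactness and rounding *)

Section Topology.
Import all_order all_algebra lra classical_sets topology normedtype.
Import Order.TTheory GRing.Theory Num.Theory numFieldNormedType.Exports.
Local Open Scope ring_scope.
Local Open Scope classical_set_scope.

Section Curves.
Variable R : realType.
Implicit Types (x y s t d eps : R) (f g : R -> R * R) (p q r : R * R).

Definition dist p q : R := Num.max `|p.1 - q.1| `|p.2 - q.2|.

Lemma distC p q : dist p q = dist q p.
Proof. by rewrite /dist (distrC p.1) (distrC p.2). Qed.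

Lemma dist_lt p q eps : (dist p q < eps) = (`|p.1 - q.1| < eps) && (`|p.2 - q.2| < eps).
Proof. exact: gt_max. Qed.

Lemma dist_triangle p q r : dist p r <= dist p q + dist q r.
Proof.
rewrite /dist ge_max; apply/andP; split.
  apply: le_trans (ler_distD q.1 _ _) _; apply: lerD; rewrite le_max lexx //.
apply: le_trans (ler_distD q.2 _ _) _; apply: lerD; rewrite le_max lexx orbT //.
Qed.

Lemma dist_gt0 p q : p <> q -> 0 < dist p q.
Proof.
move=> pq; rewrite lt_max !normr_gt0 !subr_eq0 -negb_and; apply/negP.
by move=> /andP[/eqP p1 /eqP p2]; apply: pq; case: p q p1 p2 => [? ?] [? ?] /= -> ->.
Qed.

Lemma continuous_eps f : {within `[0, 1], continuous f} ->
  forall x, 0 <= x <= 1 -> forall eps, 0 < eps -> exists2 d, 0 < d &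
    forall y, 0 <= y <= 1 -> `|x - y| < d -> dist (f x) (f y) < eps.
Proof.
move=> /subspace_continuousP fc x x01 eps eps0.
have x01' : `[0, 1]%classic x by rewrite /= in_itv.
have /cvg_ballP/(_ _ eps0) := fc x x01'.
move=> /nbhs_ballP[d /= d0 hd]; exists d => // y y01 xy.
have [] : ball (f x) eps (f y) by apply: hd; rewrite //= in_itv.
by rewrite dist_lt => h1 h2; apply/andP.
Qed.

(** Compactness of the unit square turns bounds valid near each point into a uniform one, as a
    Lebesgue number does. *)
Lemma square_cover (P : R -> R -> R -> Prop) :
  (forall s t, 0 <= s <= 1 -> 0 <= t <= 1 -> exists2 d, 0 < d &
    forall s' t' d', 0 <= s' <= 1 -> 0 <= t' <= 1 -> `|s - s'| < d ->
      `|t - t'| < d -> 0 < d' < d -> P s' t' d') ->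
  exists2 d, 0 < d & forall s t, 0 <= s <= 1 -> 0 <= t <= 1 -> P s t d.
Proof.
move=> loc; pose K := `[0 : R, 1]%classic `*` `[0 : R, 1]%classic.
have /compact_near_coveringP cK : compact K.
  by apply: compact_setX; apply: segment_compact.
pose Q (d : R) (z : R * R) := K z -> P z.1 z.2 d.
have h : \forall d \near (0 : R)^'+, K `<=` Q d.
  apply: cK => -[s t] [/=]; rewrite !in_itv /= => s01 t01.
  have [d d0 hd] := loc s t s01 t01.
  exists (ball (s, t) d, [set d' | 0 < d' < d]) => /=.
    split; first exact: nbhsx_ballx.
    exists d => // d' /=; rewrite sub0r normrN => d'd d'0.
    by rewrite /= d'0 /=; apply: le_lt_trans d'd; apply: ler_norm.
  move=> [[s' t'] d'] /= [[sb tb] dd] [/=]; rewrite !in_itv /= => s01' t01'.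
  exact: hd.
have : \forall d \near (0 : R)^'+, 0 < d /\ K `<=` Q d.
  apply: filterS2 h (nbhs_right_gt (0 : R)) => d h' d0.
  by split.
case/filter_ex => d [d0 hd]; exists d => // s t s01 t01.
by apply: (hd (s, t)); split; rewrite /= in_itv.
Qed.

Lemma uniformly_continuous f : {within `[0, 1], continuous f} ->
  forall eps, 0 < eps -> exists2 d, 0 < d & forall s t, 0 <= s <= 1 ->
    0 <= t <= 1 -> `|s - t| < d -> dist (f s) (f t) < eps.
Proof.
move=> fc eps eps0; apply: square_cover => s t s01 t01.
have [->|st] := eqVneq s t.
  have [|d d0 hd] := continuous_eps fc t01 (eps := eps / 2); first lra.
  exists d => // s' t' d' s01' t01' ss tt dd _.
  have := hd _ s01' ss; have := hd _ t01' tt.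
  have := dist_triangle (f s') (f t) (f t'); rewrite (distC (f s') (f t)).
  lra.
(* Away from the diagonal the parameters stay apart, and the claim is vacuous for small bounds. *)
exists (`|s - t| / 3); first by rewrite divr_gt0 ?normr_gt0 ?subr_eq0.
move=> s' t' d' _ _ ss tt dd st'.
have := ler_distD s' s t; have := ler_distD t' s' t.
by rewrite (distrC t'); lra.
Qed.

Lemma separation f g a b c d : {within `[0, 1], continuous f} ->
  {within `[0, 1], continuous g} ->
  (forall s t, a <= s <= b -> c <= t <= d -> f s <> g t) ->
  0 <= a -> b <= 1 -> 0 <= c -> d <= 1 ->
  exists2 eps, 0 < eps & forall s t, a <= s <= b -> c <= t <= d ->
    eps <= dist (f s) (g t).
Proof.
move=> fc gc fg a0 b1 c0 d1.
suff [eps eps0 h] : exists2 eps, 0 < eps & forall s t, 0 <= s <= 1 -> 0 <= t <= 1 ->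
    a <= s <= b -> c <= t <= d -> eps <= dist (f s) (g t).
  by exists eps => // s t sab tcd; apply: h => //; lra.
apply: square_cover => s t s01 t01.
have away u v x : ~~ (u <= x <= v) -> exists2 e, 0 < e &
    forall y, `|x - y| < e -> ~~ (u <= y <= v).
  rewrite negb_and -!ltNge => /orP[xu|vx].
    exists (u - x) => [|y]; first by rewrite subr_gt0.
    by rewrite ltr_norml => /andP[h1 h2]; rewrite negb_and -!ltNge; apply/orP; left; lra.
  exists (x - v) => [|y]; first by rewrite subr_gt0.
  by rewrite ltr_norml => /andP[h1 h2]; rewrite negb_and -!ltNge; apply/orP; right; lra.
have [sab|/away[e e0 he]] := boolP (a <= s <= b); last first.
  by exists e => // s' t' d' _ _ /he/negP.
have [tcd|/away[e e0 he]] := boolP (c <= t <= d); last first.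
  by exists e => // s' t' d' _ _ _ /he/negP.
have r0 := dist_gt0 (fg s t sab tcd); set r := dist _ _ in r0.
have [|e1 e10 h1] := continuous_eps fc s01 (eps := r / 4); first lra.
have [|e2 e20 h2] := continuous_eps gc t01 (eps := r / 4); first lra.
exists (Num.min (r / 4) (Num.min e1 e2)); first by rewrite !lt_min e10 e20 andbT; lra.
move=> s' t' d' s01' t01'; rewrite !lt_min => /and3P[_ ss _] /and3P[_ _ tt].
move=> /and4P[_ dr _ _] _ _.
have := h1 _ s01' ss; have := h2 _ t01' tt.
have := dist_triangle (f s) (f s') (g t); have := dist_triangle (f s') (g t') (g t).
by rewrite -/r (distC (g t')); lra.
Qed.

(** By uniform continuity the curve moves by less than 1 in each of finitely many short intervals of
    time. *)
Lemma bounded_curve f : {within `[0, 1], continuous f} ->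
  exists L, forall s, 0 <= s <= 1 -> dist (f s) (0, 0) <= L.
Proof.
move=> fc; have [d d0 hd] := uniformly_continuous fc (ltr01 : 0 < 1 :> R).
have [n dn] : exists n, n.+1%:R^-1 < d.
  exists (Num.truncn d^-1); rewrite invf_plt ?posrE //.
  have dv : 0 <= d^-1 by rewrite invr_ge0 ltW.
  by case/andP: (truncn_itv dv).
have h (k : nat) s : 0 <= s <= 1 -> s <= k%:R / n.+1%:R ->
    dist (f s) (0, 0) <= dist (f 0) (0, 0) + k%:R.
  elim: k s => [|k IHk] s s01; have n0 : (0 : R) < n.+1%:R by rewrite ltr0n.
    rewrite mul0r addr0 => s0; suff -> : s = 0 by [].
    by apply/eqP; rewrite eq_le s0; case/andP: s01.
  move=> sk; have [sk'|sk'] := leP s (k%:R / n.+1%:R).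
    by apply: le_trans (IHk _ s01 sk') _; rewrite lerD2l ler_nat.
  have n1 : (k.+1%:R / n.+1%:R : R) = k%:R / n.+1%:R + n.+1%:R^-1.
    by rewrite -natr1 mulrDl mul1r.
  have k0 : (0 : R) <= k%:R / n.+1%:R by rewrite divr_ge0.
  have s'01 : 0 <= (k%:R / n.+1%:R : R) <= 1.
    by move/andP: s01 => [? ?]; rewrite k0 /=; apply: le_trans (ltW sk') _.
  have := IHk _ s'01 (lexx _).
  move: sk; rewrite n1; move: sk' dn s'01 {k0 n1}.
  set u := k%:R / n.+1%:R; set w := n.+1%:R^-1 => sk' dn s'01 sk.
  have : dist (f s) (f u) < 1.
    by apply: hd => //; rewrite ger0_norm ?subr_ge0 1?ltW //; lra.
  have := dist_triangle (f s) (f u) (0, 0); rewrite -natr1.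
  by lra.
exists (dist (f 0) (0, 0) + n.+1%:R) => s s01; apply: h => //.
by rewrite divff ?pnatr_eq0 //; case/andP: s01.
Qed.

End Curves.

Section Drawing.
Variables (R : realType) (T : finType) (e : rel T).
Hypotheses (e_sym : symmetric e) (e_irr : irreflexive e).
Implicit Types (x y : T) (p q : T * T) (s t : R).

Lemma finite_min (I : finType) (P : I -> R -> Prop) :
  (forall i, exists2 d, 0 < d & P i d) ->
  (forall i d d', 0 < d' <= d -> P i d -> P i d') ->
  exists2 d, 0 < d & forall i, P i d.
Proof.
move=> ex mono; have /choice[d hd] : forall i, exists d, 0 < d /\ P i d.
  by move=> i; have [d d0 pd] := ex i; exists d.
pose m := \big[Num.min/1]_i d i.
have m0 : 0 < m.
  apply: (big_ind (fun a : R => 0 < a)) => [|a b a0 b0|i _]; first exact: ltr01.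
    by rewrite lt_min a0.
  by case: (hd i).
exists m => // i; have [_ pd] := hd i; apply: mono pd; rewrite m0 /=.
by rewrite /m (bigD1 i) //= ge_min lexx.
Qed.

Lemma planar_curves : planar R e -> exists (pt : T -> R * R) (F : T * T -> R -> R * R),
  [/\ injective pt,
      forall p, p \in arcs e -> {within `[0, 1], continuous (F p)} /\
        [/\ F p 0 = pt p.1, F p 1 = pt p.2 &
          forall s t, 0 <= s <= 1 -> 0 <= t <= 1 -> F p s = F p t -> s = t],
      forall p s x, p \in arcs e -> 0 <= s <= 1 -> F p s = pt x ->
        s = 0 /\ x = p.1 \/ s = 1 /\ x = p.2 &
      forall p q s t, p \in arcs e -> q \in arcs e -> p != q ->
        0 <= s <= 1 -> 0 <= t <= 1 -> F p s = F q t -> exists x, F p s = pt x].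
Proof.
move=> [pt [arc [ptI arcP vtx cross]]]; exists pt.
have /choice[F FP] : forall p, exists f : R -> R * R, p \in arcs e ->
    [/\ {within `[0, 1], continuous f}, {in `[0, 1] &, injective f},
        f 0 = pt p.1, f 1 = pt p.2 & f @` `[0, 1] = arc [set p.1; p.2]%SET].
  move=> p; have [pA|_] := boolP (p \in arcs e); last by exists (fun=> 0).
  have [|f fP] := arcP p.1 p.2; last by exists f.
  by move: pA; rewrite inE => /andP[].
have inarc p s : p \in arcs e -> 0 <= s <= 1 -> arc [set p.1; p.2]%SET (F p s).
  by move=> pA s01; have [_ _ _ _ <-] := FP p pA; exists s; rewrite //= in_itv.
have i0 : 0 <= (0 : R) <= 1 by rewrite lexx ler01.
have i1 : 0 <= (1 : R) <= 1 by rewrite lexx ler01.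
exists F; split=> // [p pA|p s x pA s01 ps|p q s t pA qA pq s01 t01 pqst].
- have [? Fi ? ? _] := FP p pA; split=> //; split=> // s t s01 t01.
  by apply: Fi; rewrite inE /= in_itv.
- have [_ Fi F0 F1 _] := FP p pA.
  have : x \in [set p.1; p.2]%SET.
    apply: vtx; first by move: pA; rewrite inE => /andP[pA _]; exact: pA.
    by rewrite -ps; apply: inarc.
  rewrite !inE => /orP[]/eqP xE; [left|right]; split=> //; apply: Fi; rewrite ?inE /= ?in_itv //=.
    by rewrite ps F0 xE.
  by rewrite ps F1 xE.
- have [ep eq] : e p.1 p.2 /\ e q.1 q.2.
    by move: pA qA; rewrite !inE => /andP[-> _] /andP[-> _].
  have ne : [set p.1; p.2]%SET != [set q.1; q.2]%SET.
    apply: contra pq => /eqP/setP E.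
    have := E p.2; have := E p.1; rewrite !inE !eqxx orbT /= => /esym h1 /esym h2.
    move: pA qA h1 h2; rewrite !inE => /andP[_ lp] /andP[_ lq].
    case: p q lp lq {ep eq s01 t01 pqst E} => [a b] [c d] /= lp lq.
    move=> /orP[]/eqP E1 /orP[]/eqP E2; move: lp lq; rewrite E1 E2 ?eqxx //; lia.
  have h : (arc [set p.1; p.2]%SET `&` arc [set q.1; q.2]%SET) (F p s).
    by split; [|rewrite pqst]; apply: inarc.
  by have [x _ <-] := cross _ _ _ _ ep eq ne _ h; exists x.
Qed.

Section Pieces.
Variables (pt : T -> R * R) (F : T * T -> R -> R * R).
Hypothesis pt_inj : injective pt.
Hypothesis FP : forall p, p \in arcs e -> {within `[0, 1], continuous (F p)} /\
  [/\ F p 0 = pt p.1, F p 1 = pt p.2 &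
      forall s t, 0 <= s <= 1 -> 0 <= t <= 1 -> F p s = F p t -> s = t].
Hypothesis F_pt : forall p s x, p \in arcs e -> 0 <= s <= 1 -> F p s = pt x ->
  s = 0 /\ x = p.1 \/ s = 1 /\ x = p.2.
Hypothesis F_F : forall p q s t, p \in arcs e -> q \in arcs e -> p != q ->
  0 <= s <= 1 -> 0 <= t <= 1 -> F p s = F q t -> exists x, F p s = pt x.

Local Notation piece := (T + (T * T) * 'I_3)%type.

Let real_piece (a : piece) : bool := if a is inr (p, _) then p \in arcs e else true.
Let curve (a : piece) : R -> R * R :=
  match a with inl x => fun=> pt x | inr (p, _) => F p end.
Let lo (a : piece) : R := if a is inr (_, i) then i%:R / 3 else 0.
Let hi (a : piece) : R := if a is inr (_, i) then i.+1%:R / 3 else 1.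
Let own (a : piece) : T + T * T :=
  match a with
  | inl x => inl x
  | inr (p, i) => if (i <= 0)%N then inl p.1 else if (2 <= i)%N then inl p.2 else inr p
  end.

Let lohi a : 0 <= lo a /\ hi a <= 1.
Proof.
case: a => [x|[p i]] /=; first by rewrite lexx.
rewrite divr_ge0 // ler_pdivrMr // mul1r; split=> //.
by rewrite (ler_nat R i.+1 3) ltn_ord.
Qed.

Let curve_continuous a : real_piece a -> {within `[0, 1], continuous (curve a)}.
Proof.
case: a => [x _|[p i] pA] /=; first by apply: continuous_subspaceT => z; exact: cvg_cst.
by case: (FP pA).
Qed.

Let own_pt a s x : real_piece a -> lo a <= s <= hi a -> curve a s = pt x -> own a = inl x.
Proof.
case: a => [y _ _ /pt_inj->//|[p i] pA] /= sI sx.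
have [l h] := lohi (inr (p, i)); rewrite /= in pA l h.
have s01 : 0 <= s <= 1 by case/andP: sI => ? ?; apply/andP; split; lra.
case: (F_pt pA s01 sx) => -[s_ ->]; move: sI; rewrite s_.
  by move=> /andP[h0 _]; move: h0; rewrite pmulr_lle0 ?invr_gt0 // lern0 => /eqP->.
move=> /andP[_]; rewrite ler_pdivlMr // mul1r (ler_nat R 3) ltnS => i2.
by rewrite i2 leqNgt (leq_trans _ i2).
Qed.

Let pieces_disjoint a b s t : real_piece a -> real_piece b ->
  lo a <= s <= hi a -> lo b <= t <= hi b -> curve a s = curve b t ->
  ~~ conflict (own a) (own b).
Proof.
move=> ra rb sI tI st.
have [[x ax]|nx] := pselect (exists x, curve a s = pt x).
  by rewrite (own_pt ra sI ax) (own_pt rb tI (etrans (esym st) ax)) /= eqxx.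
case: a b ra rb sI tI st nx => [x|[p i]] [y|[q j]] //= pA qA sI tI st nx.
- by case: nx; exists x.
- by case: nx; exists x.
- by case: nx; exists y.
have [l h] := lohi (inr (p, i)); have [l' h'] := lohi (inr (q, j)).
rewrite /= in pA qA l h l' h'.
have s01 : 0 <= s <= 1 by case/andP: sI => ? ?; apply/andP; split; lra.
have t01 : 0 <= t <= 1 by case/andP: tI => ? ?; apply/andP; split; lra.
have [pq|pq] := eqVneq p q; last by case: nx; apply: F_F pA qA pq s01 t01 st.
rewrite -{}pq in qA st *; have [_ [_ _ /(_ s t s01 t01 st) ts]] := FP pA.
rewrite -{}ts in tI; move: sI tI => /andP[s1 s2] /andP[s3 s4].
case: i j s1 s2 s3 s4 {l h l' h' pA qA} => [[|[|[|i]]] //= ?] [[|[|[|j]]] //= ?] s1 s2 s3 s4;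
  rewrite /= /inc ?eqxx ?orbT //; lra.
Qed.

(** Vertices and closed thirds of edges are finitely many compact pieces, so the pairs that
    conflict, being disjoint, have a common positive distance. The bound does not depend on the
    number [m] of samples, which is chosen later. *)
Lemma drawing_separation : exists2 d, 0 < d &
  [/\ forall x y, x != y -> d <= dist (pt x) (pt y),
      forall x p k m, p \in arcs e -> (0 < m)%N -> (k <= 3 * m)%N ->
        conflict (inl x) (owner m p k) ->
        d <= dist (pt x) (F p (k%:R / (3 * m)%:R)) &
      forall p q k l m, p \in arcs e -> q \in arcs e -> (0 < m)%N ->
        (k <= 3 * m)%N -> (l <= 3 * m)%N ->
        conflict (owner m p k) (owner m q l) ->
        d <= dist (F p (k%:R / (3 * m)%:R)) (F q (l%:R / (3 * m)%:R))].
Proof.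
have [] := @finite_min _ (fun (ab : piece * piece) d =>
    real_piece ab.1 -> real_piece ab.2 -> conflict (own ab.1) (own ab.2) ->
    forall s t, lo ab.1 <= s <= hi ab.1 -> lo ab.2 <= t <= hi ab.2 ->
    d <= dist (curve ab.1 s) (curve ab.2 t)).
- move=> [a b] /=.
  have [/and3P[ra rb ab]|nab] := boolP [&& real_piece a, real_piece b & conflict (own a) (own b)].
    have [la ha] := lohi a; have [lb hb] := lohi b.
    have [|d d0 hd] := separation (curve_continuous ra) (curve_continuous rb) _ la ha lb hb.
      by move=> s t sI tI st; have := pieces_disjoint ra rb sI tI st; rewrite ab.
    by exists d.
  by exists 1 => // ra rb ab; rewrite ra rb ab in nab.
- move=> ab d d' /andP[_ dd] h ra rb cab s t sI tI.
  by apply: le_trans dd _; apply: h.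
move=> d d0 hd; exists d => //.
have piece_of p k m : p \in arcs e -> (0 < m)%N -> (k <= 3 * m)%N ->
    exists a, [/\ real_piece a, own a = owner m p k, curve a = F p &
      lo a <= k%:R / (3 * m)%:R <= hi a].
  move=> pA m0 km; have M0 : (0 : R) < m%:R by rewrite ltr0n.
  have T0 : (0 : R) < 3 by [].
  have TM0 : (0 : R) < 3 * m%:R by rewrite mulr_gt0.
  have E1 (u : nat) : (u%:R / 3 <= k%:R / (3 * m)%:R :> R) = (u * m <= k)%N.
    rewrite natrM ler_pdivrMr // mulrAC ler_pdivlMr // mulrCA (mulrC _ 3).
    by rewrite ler_pM2l // -natrM ler_nat.
  have E2 (v : nat) : (k%:R / (3 * m)%:R <= v%:R / 3 :> R) = (k <= v * m)%N.
    rewrite natrM ler_pdivrMr // mulrAC ler_pdivlMr // mulrCA (mulrC _ 3).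
    by rewrite ler_pM2l // -natrM ler_nat.
  have [k1|k1] := leqP k m.
    by exists (inr (p, ord0)); rewrite /= /owner k1 E1 E2; split=> //; lia.
  have [k2|k2] := leqP (2 * m) k.
    by exists (inr (p, ord_max)); rewrite /= /owner k2 (leqNgt k) k1 E1 E2; split=> //; lia.
  exists (inr (p, inord 1)); rewrite /= inordK // /owner (leqNgt k) k1 (leqNgt _ k) k2 E1 E2.
  by split=> //; lia.
split=> [x y xy|x p k m pA m0 km cf|p q k l m pA qA m0 km lm cf].
- by apply: (hd (inl x, inl y) _ _ _ 0 0) => //=; rewrite lexx ler01.
- have [a [ra oa <- aI]] := piece_of p k m pA m0 km.
  by apply: (hd (inl x, a) _ _ _ 0) => //=; rewrite ?oa // lexx ler01.
- have [a [ra oa <- aI]] := piece_of p k m pA m0 km.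
  have [b [rb ob <- bI]] := piece_of q l m qA m0 lm.
  by apply: (hd (a, b)) => //=; rewrite oa ob.
Qed.

End Pieces.

Lemma grid_model : planar R e -> exists lab root N, grid_labelling e lab root N.
Proof.
move=> /planar_curves[pt [F [ptI FP F_pt F_F]]].
have [d d0 [sepV sepVE sepE]] := drawing_separation ptI FP F_pt F_F.
(* A distance of [d] in one coordinate is then at least four cells, and rounding leaves a difference
   of at least 3. *)
pose h := d / 4; have h0 : 0 < h by rewrite divr_gt0.
have [] := @finite_min _ (fun p b => p \in arcs e -> forall s t, 0 <= s <= 1 ->
    0 <= t <= 1 -> `|s - t| < b -> dist (F p s) (F p t) < h).
- move=> p; have [pA|_] := boolP (p \in arcs e); last by exists 1.
  by have [b b0 hb] := uniformly_continuous (FP p pA).1 h0; exists b.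
- move=> p b b' /andP[_ bb] hb pA s t s01 t01 st; apply: hb => //.
  exact: lt_le_trans st bb.
move=> b b0 modulus.
(* [finite_min] provides small positive numbers, so the upper bound sought is written as an
   inverse. *)
have [] := @finite_min _ (fun p b => p \in arcs e -> forall s, 0 <= s <= 1 ->
    dist (F p s) (0, 0) <= b^-1).
- move=> p; have [pA|_] := boolP (p \in arcs e); last by exists 1.
  have [L hL] := bounded_curve (FP p pA).1.
  have L0 : 0 < Num.max L 1 by rewrite lt_max ltr01 orbT.
  exists (Num.max L 1)^-1; rewrite ?invr_gt0 // => _ s s01.
  by rewrite invrK le_max hL.
- move=> p l l' /andP[l'0 ll] hl pA s s01; apply: le_trans (hl pA s s01) _.
  by rewrite lef_pV2 ?posrE // (lt_le_trans l'0).
move=> lE lE0 boundE.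
pose V := \sum_x dist (pt x) (0, 0).
have dist0 z : 0 <= dist z (0, 0) by rewrite le_max normr_ge0.
have V0 : 0 <= V by apply: sumr_ge0 => x _; apply: dist0.
have boundV x : dist (pt x) (0, 0) <= V.
  by rewrite /V (bigD1 x) //= lerDl sumr_ge0 // => y _; apply: dist0.
pose L := lE^-1 + V; have lE1 : 0 <= lE^-1 by rewrite invr_ge0 ltW.
(* The successor keeps the rounded coordinates positive, as the margin of the grid requires. *)
pose g (u : R) := (Num.truncn ((u + L) / h)).+1.
pose G (z : R * R) := (g z.1, g z.2).
pose N := (Num.truncn ((L + L) / h)).+2.
have in0 u : `|u| <= L -> 0 <= (u + L) / h.
  by rewrite ler_norml => /andP[? ?]; rewrite divr_ge0 ?(ltW h0) //; lra.
have g_in u : `|u| <= L -> (0 < g u < N)%N.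
  move=> uL; rewrite /g /N /= !ltnS; apply: le_truncn; rewrite ler_pM2r ?invr_gt0 // lerD2r.
  by move: uL; rewrite ler_norml => /andP[].
have tr u : `|u| <= L -> (g u)%:R - 1 <= (u + L) / h < (g u)%:R.
  by move=> /in0/truncn_itv; rewrite /g -natr1 addrK.
have shift u v : (u + L) / h = (v + L) / h + (u - v) / h.
  by rewrite -mulrDl; congr (_ * _); lra.
have g_close u v : `|u| <= L -> `|v| <= L -> `|u - v| < h -> (g u <= (g v).+1)%N.
  move=> /tr/andP[u1 _] /tr/andP[_ v2]; rewrite ltr_norml => /andP[_ uv].
  have : (u - v) / h < 1 by rewrite ltr_pdivrMr ?mul1r.
  move: u1; rewrite (shift u v) => u1 uv1.
  suff : (g u)%:R < (g v + 2)%:R :> R by rewrite ltr_nat addn2 ltnS.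
  rewrite natrD; lra.
have g_apart u v : `|u| <= L -> `|v| <= L -> d <= u - v -> (g v + 3 <= g u)%N.
  move=> /tr/andP[_ u2] /tr/andP[v1 _] uv.
  have : 4 <= (u - v) / h by rewrite ler_pdivlMr // /h mulrC divfK ?pnatr_eq0.
  move: u2; rewrite (shift u v) => u2 uv4.
  suff : (g v + 3)%:R < (g u + 1)%:R :> R by rewrite ltr_nat addn1 ltnS.
  rewrite !natrD; lra.
have boxed z : dist z (0, 0) <= L -> `|z.1| <= L /\ `|z.2| <= L.
  by rewrite ge_max !subr0 => /andP[].
have G_in z : dist z (0, 0) <= L -> ((0 < (G z).1 < N) && (0 < (G z).2 < N))%N.
  by move=> /boxed[z1 z2]; rewrite !g_in.
have G_close z z' : dist z (0, 0) <= L -> dist z' (0, 0) <= L -> dist z z' < h ->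
    nearby (G z) (G z').
  move=> /boxed[z1 z2] /boxed[z'1 z'2]; rewrite dist_lt => /andP[d1 d2].
  by rewrite /nearby !g_close // distrC.
have G_apart z z' : dist z (0, 0) <= L -> dist z' (0, 0) <= L -> d <= dist z z' ->
    apart (G z) (G z').
  move=> /boxed[z1 z2] /boxed[z'1 z'2]; rewrite le_max /apart.
  rewrite !ler_normr !opprB.
  by case/orP => /orP[] /g_apart ->; rewrite ?orbT.
pose m := (Num.truncn b^-1).+1.
have m0 : (0 < m)%N by [].
have mb : (3 * m)%:R^-1 < b.
  rewrite invf_plt ?posrE //; have bv : 0 <= b^-1 by rewrite invr_ge0 ltW.
  case/andP: (truncn_itv bv) => _ bm; apply: lt_le_trans bm _.
  by rewrite ler_nat /m; lia.
have time k : (k <= 3 * m)%N -> 0 <= (k%:R / (3 * m)%:R : R) <= 1.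
  by move=> km; rewrite divr_ge0 //= ler_pdivrMr // mul1r ler_nat.
have F_in p k : p \in arcs e -> (k <= 3 * m)%N -> dist (F p (k%:R / (3 * m)%:R)) (0, 0) <= L.
  by move=> pA km; apply: le_trans (boundE p pA _ (time k km)) _; rewrite lerDl.
have V_in x : dist (pt x) (0, 0) <= L.
  by apply: le_trans (boundV x) _; rewrite lerDr.
have := @discrete_model T e e_irr e_sym m N (fun p k => G (F p (k%:R / (3 * m)%:R)))
  (fun x => G (pt x)) m0.
case=> [p pA|p pA|p k pA km|x|p k pA km|x y xy|x p k pA km cf|p q k l pA qA km lm cf|].
- by rewrite mul0r; have [_ [->]] := FP p pA.
- by rewrite divff ?gt_eqF //; have [_ [_ ->]] := FP p pA.
- have km' := ltnW km; apply: G_close; try exact: F_in.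
  apply: modulus => //; try exact: time.
  rewrite distrC -mulrBl -natr1 addrAC subrr add0r mul1r ger0_norm //.
  by rewrite invr_ge0 ltW.
- exact: G_in.
- exact/G_in/F_in.
- by apply: G_apart => //; apply: sepV.
- by apply: G_apart => //; [apply: F_in|apply: sepVE].
- by apply: G_apart => //; [apply: F_in|apply: F_in|apply: sepE].
by move=> lab; exists lab, (fun x => G (pt x)), N.
Qed.

End Drawing.
End Topology.

(** * The partition *)

Section Main.
Variables (T : finType) (e : rel T).
Hypotheses (e_sym : symmetric e) (e_irr : irreflexive e).
Implicit Types (A S : {set T}).

(** An induced subgraph on the same vertex type, so that partial colourings for different sets can
    be compared. *)
Definition restr A : rel T := fun x y => [&& e x y, x \in A & y \in A].

Lemma restr_sym A : symmetric (restr A).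
Proof. by move=> x y; rewrite /restr e_sym; congr (_ && _); rewrite andbC. Qed.

Lemma restr_irr A : irreflexive (restr A).
Proof. by move=> x; rewrite /restr e_irr. Qed.

Lemma restr_nbr A x : x \in A -> nbr (restr A) x = nbr e x :&: A.
Proof. by move=> xA; apply/setP => y; rewrite !inE /restr xA. Qed.

Lemma restr_nbr0 A x : x \notin A -> nbr (restr A) x = set0.
Proof. by move=> /negbTE xA; apply/setP => y; rewrite !inE /restr xA andbF. Qed.

Lemma sub_ucycle (e' : rel T) s : subrel e' e -> ucycle e' s -> ucycle e s.
Proof.
move=> sub /andP[cs us]; rewrite /ucycle us andbT.
by case: s cs {us} => //= x s; apply: sub_path.
Qed.

Lemma no_cycle4 : ~ has_cycle e 4 -> forall a b c d, e a b -> e b c -> e c d ->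
  e d a -> a != c -> b != d -> False.
Proof.
have ne := edge_neq e_irr; move=> nc a b c d ab bc cd da ac bd; apply: nc; exists [:: a; b; c; d] => //.
rewrite /ucycle /= ab bc cd da !inE !negb_or ac bd (ne _ _ ab) (ne _ _ bc) (ne _ _ cd).
by rewrite eq_sym (ne _ _ da).
Qed.

Lemma no_cycle45 : ~ has_cycle e 4 -> ~ has_cycle e 5 -> forall s, ucycle e s ->
  3 <= size s -> size s = 3 \/ 6 <= size s.
Proof.
move=> n4 n5 s us s3.
have s4 : size s <> 4 by move=> s4; apply: n4; exists s.
have s5 : size s <> 5 by move=> s5; apply: n5; exists s.
by move: s3 s4 s5; clear; lia.
Qed.

End Main.

Lemma planar_sparse (R : realType) (T : finType) (e0 e : rel T) (H : {set T}) :
  symmetric e0 -> irreflexive e0 -> planar R e0 ->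
  ~ has_cycle e0 4 -> ~ has_cycle e0 5 -> subrel e e0 -> symmetric e -> H != set0 ->
  4 * (\sum_(x in H) #|nbr e x :&: H|) < 12 * #|H| +
    \sum_(x in H) #|[set w in nbr e x :&: H | [exists z in H, e x z && e w z]]|.
Proof.
move=> e0_sym e0_irr pl n4 n5 sub0 e_sym H0.
have [lab [root [N [lab_in lab_conn lab_edge]]]] := grid_model e0_sym e0_irr pl.
have e_irr : irreflexive e by move=> x; apply/negP => /sub0; rewrite e0_irr.
have sub : subrel (restr e H) e0 by move=> x y /andP[/sub0].
(* The labelling obtained from the whole drawing also serves subgraphs: only fewer edges need to be
   represented. *)
have lab_grid : grid_labelling (restr e H) lab root N.
  by split=> // x y /sub/lab_edge.
have [s0 [s1 [Re [bd_even even_bd]]]] := grid_duality (restr_irr e_irr H) lab_grid.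
have := @sparse_bound T (restr e H) (restr_sym e_sym H) (restr_irr e_irr H) _ H H0 _ _
  (faces (restr e H) s0 s1 Re) (@faces_even _ _ _ _ _ _ bd_even)
  (sum_faces bd_even) (@faces_span _ _ _ _ _ _ even_bd).
have inside (F : T -> {set T}) : (forall x, x \notin H -> F x = set0) ->
    \sum_x #|F x| = \sum_(x in H) #|F x|.
  move=> F0; rewrite [LHS](bigID (mem H)) /= [X in _ + X]big1 ?addn0 // => x xH.
  by rewrite F0 ?cards0.
rewrite (inside (nbr (restr e H))); last exact: restr_nbr0.
rewrite (inside (nbr (tri_rel (restr e H)))); last first.
  move=> x /negbTE xH; apply/setP => y.
  by rewrite !inE /tri_rel /restr xH andbF.
rewrite (eq_bigr (fun x => #|nbr e x :&: H|)); last by move=> x xH; rewrite restr_nbr.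
rewrite [X in _ < _ + X](eq_bigr (fun x =>
  #|[set w in nbr e x :&: H | [exists z in H, e x z && e w z]]|)); last first.
  move=> x xH; congr #|pred_of_set _|; apply/setP => y.
  rewrite !inE /tri_rel /restr xH /=.
  case: (e x y) => //=; case yH: (y \in H) => //=.
  by apply: eq_existsb => z; case: (z \in H); rewrite ?andbT ?andbF.
apply.
- by move=> s /(sub_ucycle sub); apply: no_cycle45.
- by move=> x y /and3P[].
- move=> a b c d /sub ab /sub bc /sub cd /sub da; exact: no_cycle4 ab bc cd da.
Qed.

(** Induction on the size of the set to be coloured: if all smaller sets can be coloured and [S]
    cannot, then [S] is minimal, and its dense subset contradicts [planar_sparse]. *)
Lemma planar_colouring (R : realType) (T : finType) (e : rel T) :
  symmetric e -> irreflexive e -> planar R e ->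
  ~ has_cycle e 4 -> ~ has_cycle e 5 ->
  exists2 f, valid e f & forall x, f x != None.
Proof.
move=> e_sym e_irr pl n4 n5.
suff main n (S : {set T}) : #|S| <= n ->
    exists2 f, valid e f & forall x, (f x != None) = (x \in S).
  by have [f vf fS] := main _ setT (leqnn _); exists f => // x; rewrite fS inE.
have valid_within (U D : {set T}) f : D \subset U -> (forall x, (f x != None) = (x \in D)) ->
    valid (restr e U) f <-> valid e f.
  move=> /subsetP DU fD.
  have domU x c : f x = Some c -> x \in U by move=> fx; apply: DU; rewrite -fD fx.
  split=> -[fd fc]; split=> [x c fx|s c us s3 fs].
  - have := fd x c fx; rewrite /cdeg restr_nbr ?(domU _ _ fx) //.
    congr (_ <= _); congr #|pred_of_set _|; apply/setP => y; rewrite !inE.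
    by case fy: (f y == Some c); rewrite ?andbF // (domU y c) ?andbT //; apply/eqP.
  - apply: (fc s c _ s3 fs); move: us => /andP[cs us]; rewrite /ucycle us andbT.
    have sU : all (mem U) s by apply/allP => x /(allP fs)/eqP/domU.
    by apply: (sub_in_cycle _ sU cs) => x y xU yU exy; rewrite /restr exy xU.
  - apply: leq_trans (fd x c fx); apply/subset_leq_card/subsetP => y.
    by rewrite !inE => /andP[/andP[-> _] ->].
  - by apply: (fc s c _ s3 fs); apply: sub_ucycle us => x y /andP[].
elim: n S => [|n IHn] S Sn.
  exists (fun=> None) => [|x]; last by move: Sn; rewrite leqn0 cards_eq0 => /eqP->; rewrite inE.
  split=> [//|s c _ s3 /allP fs].
  by case: s s3 fs => // x s _ /(_ x (mem_head _ _)).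
apply: contrapT => nof.
have sub : subrel (restr e S) e by move=> x y /andP[].
have [||||H [H0]] := @dense_subset T (restr e S) (restr_sym e_sym S) (restr_irr e_irr S) _ S.
- move=> a b c d /sub ab /sub bc /sub cd /sub da; exact: no_cycle4 ab bc cd da.
- by move=> x y /and3P[].
- move=> D DS; have [|f vf fD] := IHn D.
    by rewrite -ltnS; apply: leq_trans (proper_card DS) Sn.
  by exists f => //; apply/(valid_within S D) => //; apply: proper_sub.
- move=> f vf fS; apply: nof; pose g x := if x \in S then f x else None.
  have gS x : (g x != None) = (x \in S).
    by rewrite /g; case: ifP => [/fS|].
  exists g => //; apply/(valid_within S S) => //; apply: (valid_sub vf) => x.
  by rewrite /g; case: ifP; [right|left].
by rewrite leqNgt (planar_sparse e_sym e_irr pl n4 n5 sub (restr_sym e_sym S) H0).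
Qed.

Lemma forest_of_colour (T : finType) (e : rel T) f c :
  valid e f -> forest_class (cap c) (induced e [set x | f x == Some c]).
Proof.
move=> [fd fc]; set A := [set x | f x == Some c]; split.
  move=> k k3 [s sk us]; apply: (fc (map (@sval T (fun x => x \in A)) s) c).
  - case/andP: us => cs us; rewrite /ucycle map_inj_uniq ?us ?andbT; last exact: val_inj.
    by rewrite cycle_map.
  - by rewrite size_map sk.
  - by apply/allP => _ /mapP[x _ ->]; have := valP x; rewrite inE.
apply/bigmax_leqP => x _; have /eqP fx : f (val x) == Some c by have := valP x; rewrite inE.
apply: leq_trans (fd _ _ fx); rewrite /degree -(card_image val_inj).
apply/subset_leq_card/subsetP => _ /imageP[y exy ->].
by rewrite !inE; apply/andP; split; [exact: exy|have := valP y; rewrite inE].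
Qed.

Theorem theorem1p2 (R : realType) (T : finType) (e : rel T)
    (e_sym : symmetric e) (e_irr : irreflexive e)
    (e_planar : planar R e)
    (no_C4 : ~ has_cycle e 4) (no_C5 : ~ has_cycle e 5) :
  exists V1 V2 : {set T},
    [/\ V1 :|: V2 = [set: T], [disjoint V1 & V2],
        forest_class 3 (induced e V1) & forest_class 4 (induced e V2)].
Proof.
have [f vf ftot] := planar_colouring e_sym e_irr e_planar no_C4 no_C5.
exists [set x | f x == Some false], [set x | f x == Some true]; split.
- by apply/setP => x; rewrite !inE; case: (f x) (ftot x) => [[]|].
- by rewrite -setI_eq0; apply/eqP/setP => x; rewrite !inE; case: (f x) => [[]|].
- exact: (forest_of_colour false vf).
- exact: (forest_of_colour true vf).
Qed.
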